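(* Let $n\ge2$ be an integer and $q\in[0,1)$. Let $(w_t)_{t\ge0}$ be the affine Hecke walk on $\widetilde S_n$ (with parameter $q$) started from $w_0=\mathrm{id}$, let $Y_i(t)=w_t^{-1}(i)$ for $i\in[n]$, and let $\chi_t(x)=\mathbf 1_{\{w_t(x)\le 0\}}$, $x\in\mathbb Z$, be its one-species projection. Put $$v_k=\frac{(1-q)(n+1-2k)}{n-1},\qquad k\in[n].$$ Then the following assertions hold. (i) (Leader law of large numbers.) Almost surely, there is a random permutation $(a_1,\dots,a_n)$ of $[n]$ such that, for all sufficiently large $t$, $$Y_{a_1}(t)>Y_{a_2}(t)>\cdots>Y_{a_n}(t),$$ and $Y_{a_k}(t)/t\to v_k$ as $t\to\infty$ for every $k\in[n]$. (ii) (Integrated limit shape.) Let $N_t(x)=\sum_{y>x}\chi_t(y)$ for $x\in\mathbb Z$. Then, almost surely, $$\sup_{u\in\mathbb R}\left|\frac{N_t(\lfloor ut\rfloor)}{t}-\mathcal H(u)\right|\longrightarrow 0\quad(t\to\infty),\qquad \mathcal H(u)=\frac1n\sum_{k=1}^n\max(v_k-u,0).$$ In particular, away from the break points $v_1,\dots,v_n$, the macroscopic density $\rho(u)=-\mathcal H'(u)$ is $$\rho(u)=\begin{cases}1,&u<v_n,\\ K/n,&v_{K+1}<u<v_K,\ 1\le K\le n-1,\\ 0,&u>v_1.\end{cases}$$ (iii) (Local equilibrium.) Let $x_t\in\mathbb Z$ be deterministic with $x_t/t\to u$ as $t\to\infty$, where $u\notin\{v_1,\dots,v_n\}$. Let $K=K(u)$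 be the unique integer in $\{0,\dots,n\}$ with $\rho(u)=K/n$. Then, for every fixed integer $N\ge1$, $$\bigl(\chi_t(x_t+j)\bigr)_{j=0}^{N-1}\ \Longrightarrow\ \bigl(\eta(j)\bigr)_{j=0}^{N-1},\qquad \eta\sim\nu_{n,K},$$ in distribution as $t\to\infty$; equivalently, for every bounded function $f:\{0,1\}^N\to\mathbb R$, $$\lim_{t\to\infty}\mathbb E\left[f\bigl((\chi_t(x_t+j))_{j=0}^{N-1}\bigr)\right]=\int f\bigl((\eta(j))_{j=0}^{N-1}\bigr)\,\nu_{n,K}(d\eta).$$
   Context: $[n]=\{1,\dots,n\}$. An affine permutation of size $n$ is a bijection $w:\mathbb Z\to\mathbb Z$ with $w(i+n)=w(i)+n$ for all $i$ and $\sum_{i=1}^n w(i)=\binom{n+1}{2}$; these form the group $\widetilde S_n$ (under composition). For $r\in\mathbb Z/n\mathbb Z$, the simple reflection $s_r\in\widetilde S_n$ simultaneously interchanges $r+kn$ and $r+kn+1$ for every $k\in\mathbb Z$. Let $\ell$ be the Coxeter length with respect to $\{s_r\}$; one has $\ell(ws_r)=\ell(w)+1$ iff $w(r)<w(r+1)$, and otherwise $\ell(ws_r)=\ell(w)-1$. The affine Hecke walk $(w_t)_{t\ge0}$ is the continuous-time Markov chain on $\widetilde S_n$ which jumps from $w$ to $ws_r$, for each $r\in\mathbb Z/n\mathbb Z$, at rate $1$ if $\ell(ws_r)=\ell(w)+1$ and at rate $q$ if $\ell(ws_r)=\ell(w)-1$. (Graphically: for each $r$ there is an independent rate-one Poisson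 process $\mathcal N_r$ whose points carry independent uniform $[0,1]$ marks; at a point of $\mathcal N_r$, $w$ becomes $ws_r$ if this increases the length, and if it decreases the length the change is made exactly when the mark is at most $q$.) The interpretation is that $w(x)$ is the label of the particle at position $x$; $Y_i(t)=w_t^{-1}(i)$ is the position of the $i$th ''leader''. For $K\in\{0,1,\dots,n\}$, $\nu_{n,K}$ is the probability law on $\{0,1\}^{\mathbb Z}$ obtained by choosing a uniformly random $K$-element subset $B\subset\mathbb Z/n\mathbb Z$ and setting $\eta(x)=\mathbf 1_{\{x \bmod n\,\in B\}}$, $x\in\mathbb Z$. *)

(* Defs.v *)
From HB Require Import structures.
From mathcomp Require Import all_boot all_order all_algebra all_fingroup.
From mathcomp Require Import all_classical all_reals all_analysis.

Set Implicit Arguments.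
Unset Strict Implicit.
Unset Printing Implicit Defensive.

Import Order.TTheory GRing.Theory Num.Theory.
Import numFieldNormedType.Exports.

Local Open Scope classical_set_scope.
Local Open Scope ring_scope.

(* [p t x y] is the probability of being in [y] at time [t] after starting
   from [x]; only [t >= 0] is meaningful. The last field says that [Q] is the
   derivative of the transition matrix at 0, so that off the diagonal [Q x y]
   is the rate of jumping from [x] to [y]. *)
Record transition_function (R : realType) (S : choiceType) (Q : S -> S -> R)
    (p : R -> S -> S -> R) : Prop := TransitionFunction {
  trans_ge0 : forall t x y, 0 <= t -> 0 <= p t x y ;
  trans_sum1 : forall t x, 0 <= t ->
    \esum_(y in [set: S]) (p t x y)%:E = 1%:E ;
  trans_0 : forall x y, p 0 x y = (x == y)%:R ;
  trans_semigroup : forall s t x z, 0 <= s -> 0 <= t ->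
    \esum_(y in [set: S]) (p s x y * p t y z)%:E = (p (s + t) x z)%:E ;
  trans_rate : forall x y,
    (p h x y - (x == y)%:R) / h @[h --> 0^'+] --> Q x y }.

(* Times range over [R], but nothing is required of [X t] for [t < 0]. The
   paths are almost surely right-continuous with left limits for the discrete
   topology of [S], i.e. they are step functions with finitely many jumps in
   bounded time intervals. In [ctmc_markov] the list [past] encodes the event
   that X_u = y for all (u, y) in [past]. *)
Record is_ctmc (R : realType) (d : measure_display) (T : measurableType d)
    (P : probability T R) (S : choiceType) (Q : S -> S -> R)
    (X : R -> T -> S) : Prop := IsCtmc {
  ctmc_measurable : forall t x, 0 <= t -> measurable [set om | X t om = x] ;
  ctmc_rcont : {ae P, forall om, forall t, 0 <= t ->
    \forall s \near t^'+, X s om = X t om} ;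
  ctmc_llim : {ae P, forall om, forall t, 0 < t ->
    exists x, \forall s \near t^'-, X s om = x} ;
  ctmc_markov : exists2 p, transition_function Q p &
    forall (past : seq (R * S)) (s t : R) (x y : S),
      (forall u, u \in past -> 0 <= u.1 <= s) -> 0 <= s <= t ->
      let A := [set om | (forall u, u \in past -> X u.1 om = u.2)
                         /\ X s om = x] in
      P (A `&` [set om | X t om = y]) = (P A * (p (t - s) x y)%:E)%E }.

Definition is_affine_perm (n : nat) (w : int -> int) : Prop :=
  [/\ bijective w,
      forall i, w (i + n%:Z) = w i + n%:Z &
      \sum_(1 <= i < n.+1) w i%:Z = 'C(n.+1, 2)%:Z].

Record affperm (n : nat) := AffPerm {
  affperm_fun :> int -> int ;
  affperm_funP : `[< is_affine_perm n affperm_fun >] }.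

HB.instance Definition _ n := [isSub for @affperm_fun n].
HB.instance Definition _ n := [Choice of affperm n by <:].

(* Interchanges r + kn and r + kn + 1 for all k; an involution for n >= 2.
   The representatives 0, ..., n - 1 in ['I_n] stand for Z/nZ. *)
Definition simple_refl (n : nat) (r : 'I_n) (x : int) : int :=
  if (x == r%:Z %[mod n%:Z])%Z then x + 1
  else if (x == r%:Z + 1 %[mod n%:Z])%Z then x - 1
  else x.

Definition refl_word (n : nat) (s : seq 'I_n) : int -> int :=
  foldr (fun r f => simple_refl r \o f) id s.

(* Minimal number of factors in an expression of [w] as a product of simple
   reflections (0 if there is no such expression, which does not happen for
   affine permutations). *)
Definition coxeter_length (n : nat) (w : int -> int) : nat :=
  xget 0%N [set k | (exists2 s : seq 'I_n, size s = k & w = refl_word s) /\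
                    (forall s : seq 'I_n, w = refl_word s -> (k <= size s)%N)].

Definition hecke_rate (R : realType) (n : nat) (q : R) (w : int -> int)
    (r : 'I_n) : R :=
  if coxeter_length n (w \o simple_refl r) == (coxeter_length n w).+1 then 1
  else if (coxeter_length n (w \o simple_refl r)).+1 == coxeter_length n w
       then q else 0.

(* The Q-matrix of the generator
   (L f)(w) = \sum_r rate(w, r) (f (w s_r) - f w). *)
Definition hecke_Qmatrix (R : realType) (n : nat) (q : R)
    (w w' : affperm n) : R :=
  \sum_(r < n) hecke_rate q w r *
    (((w' : int -> int) == w \o simple_refl r)%:R - (w' == w)%:R).

Definition affine_hecke_walk (R : realType) (n : nat) (q : R)
    (d : measure_display) (T : measurableType d) (P : probability T R)
    (w : R -> T -> affperm n) : Prop :=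
  is_ctmc P (hecke_Qmatrix q) w /\
  P [set om | affperm_fun (w 0 om) = id] = 1%E.

(* w^-1(i), the position of the particle labelled i *)
Definition position (n : nat) (w : affperm n) (i : int) : int :=
  xget 0 [set x | w x = i].

Definition one_species (n : nat) (w : affperm n) (x : int) : bool :=
  w x <= 0.

(* The support of the sum is finite because [w y > 0] for all large [y]. *)
Definition particle_count (R : realType) (n : nat) (w : affperm n)
    (x : int) : R :=
  \sum_(y \in [set y : int | x < y]) ((one_species w y)%:R : R).

(* v_k for 1 <= k <= n *)
Definition speed (R : realType) (n : nat) (q : R) (k : nat) : R :=
  (1 - q) * (n%:R + 1 - 2 * k%:R) / (n%:R - 1).

Definition limit_shape (R : realType) (n : nat) (q u : R) : R :=
  n%:R^-1 * \sum_(1 <= k < n.+1) Num.max (speed n q k - u) 0.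

Definition density (R : realType) (n : nat) (q u : R) : R :=
  - derive1 (limit_shape n q) u.

Definition cylinders : set (set (int -> bool)) :=
  [set A | exists (x : int) (b : bool), A = [set eta | eta x = b]].

(* {0,1}^Z with its product sigma-algebra *)
Notation config := (g_sigma_algebraType cylinders).

Definition periodic_config (n : nat) (B : {set 'I_n}) : config :=
  fun x : int => [exists b in B, (x == b%:Z %[mod n%:Z])%Z].

(* The uniform mixture of the Dirac masses at [periodic_config B], where [B]
   runs over the 'C(n, K) subsets of Z/nZ with [K] elements. *)
Definition periodic_law (R : realType) (n K : nat)
    : {measure set config -> \bar R} :=
  mscale ('C(n, K)%:R^-1)%:nng
    (msum (fun i => \d_(periodic_config
                          (nth finset.set0 (enum [set B : {set 'I_n} | #|B| == K]%SET) i)))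
          'C(n, K)).

Definition window (N : nat) (eta : int -> bool) (x : int)
    : {ffun 'I_N -> bool} :=
  [ffun j : 'I_N => eta (x + j%:Z)].

(* Main.v *)
(* For 0 <= K <= n let S_K be the sum of the positions of the K foremost
   leaders, and let B_K be the set of residues that they occupy. As long as the
   K-th and (K+1)-st leaders are not adjacent, B_K moves like the asymmetric
   exclusion process on the ring Z/n with K particles and S_K is its integrated
   current; an adjacent pair can only make S_K larger on average. The uniform
   law is stationary for this process, with current
   J_K = (1 - q) K (n - K) / (n - 1), and v_K = J_K - J_{K-1}.

   Since J is strictly concave in K, the gaps 2 S_K - S_{K-1} - S_{K+1}, corrected
   by bounded solutions of the Poisson equation, drift to infinity: a sum of
   exponentials of small negative multiples of them is a Lyapunov function that
   decays exponentially in mean. So adjacent leaders become exponentially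
   unlikely, and S_K / t is close to J_K up to exponentially small probabilities.
   Borel-Cantelli along a grid of mesh (m+1)^-2 in [m, m+1], on whose cells the
   paths eventually jump at most once, makes this almost sure; it gives the order
   and the speeds of the leaders, and the integrated limit shape follows
   deterministically. For the local limit, the K leaders faster than u are
   eventually to the right of the window and the others to its left, so that the
   window displays the periodic configuration of B_K, whose law converges to the
   uniform one. *)
Require Import Defs.
From mathcomp Require Import all_boot all_order all_algebra all_fingroup.
From mathcomp Require Import all_classical all_reals all_analysis measurable_realfun.
From mathcomp Require Import zify ring lra.

Set Implicit Arguments.
Unset Strict Implicit.
Unset Printing Implicit Defensive.

Import Order.TTheory GRing.Theory Num.Theory.
Import numFieldNormedType.Exports.

Local Open Scope classical_set_scope.
Local Open Scope ring_scope.

(** * Residues and simple reflections *)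

Section AffinePermutations.
Variables (n : nat) (n_gt1 : (1 < n)%N).

Local Notation "x ≡ y" := (x == y %[mod n%:Z])%Z (at level 70).

(** Exchanges of adjacent leaders are the obstacle. They add to the drift of the corrected S_K an
    excess that widens the gap K but narrows the gaps K - 1 and K + 1. Two facts tame it. The excess
    at K occurs only where the gap K is 1, hence minimal; there the exponential weight of K is
    almost the largest, and the harm done to its neighbours is compensated up to a small relative
    error. And the excess has to be nonnegative, a condition on the solution of the Poisson
    equation. This is why the corrector is a finite sum of iterates of a lazy exclusion chain, that
    is, an expected height increment, accessible to a monotone coupling. It solves the equation only
    up to a small constant, which strict concavity absorbs.

    The dynamics is given only through a transition function and finite-dimensional laws. So
    generators enter by one-step expansions with an error of order h^2: the derivative of the
    transition matrix at 0 and the semigroup law bound from below the probabilities of staying and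
    of a single jump, conservation of mass bounds the rest, and a discrete Gronwall lemma gives
    exponential estimates. *)

Lemma eqzmodP (x y : int) : reflect (exists k : int, x = y + n%:Z * k) (x ≡ y).
Proof.
rewrite eqz_mod_dvd; apply: (iffP dvdzP) => [[k e]|[k ->]]; exists k.
  by rewrite mulrC -e addrC subrK.
by rewrite addrC addKr mulrC.
Qed.

Lemma eqmod_add2r (z x y : int) : (x + z ≡ y + z) = (x ≡ y).
Proof. by rewrite !eqz_mod_dvd opprD addrACA subrr addr0. Qed.

Lemma eqmodDn (x y k : int) : (x + n%:Z * k ≡ y) = (x ≡ y).
Proof. by rewrite addrC mulrC modzMDl. Qed.

Lemma eqmod_sym (x y : int) : (x ≡ y) = (y ≡ x).
Proof. by rewrite eq_sym. Qed.

Lemma eqmod_trans (x y z : int) : x ≡ y -> y ≡ z -> x ≡ z.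
Proof. by move=> /eqP -> /eqP ->. Qed.

Lemma eqmod_small (x y : int) : `|x - y| < n%:Z -> x ≡ y -> x = y.
Proof.
move=> xy /eqzmodP[k e]; move: xy; rewrite e addrC addKr.
case: (k =P 0) => [->|k0]; first by rewrite mulr0 addr0.
rewrite normrM /= => h; nia.
Qed.

Lemma eqmod_succ (x : int) : ~~ (x + 1 ≡ x).
Proof. by apply/negP => /eqmod_small h; have := h ltac:(lia); lia. Qed.

Variant refl_spec (r : 'I_n) (x : int) : int -> Type :=
| ReflUp of x ≡ r%:Z : refl_spec r x (x + 1)
| ReflDown of x ≡ r%:Z + 1 : refl_spec r x (x - 1)
| ReflFix of ~~ (x ≡ r%:Z) & ~~ (x ≡ r%:Z + 1) : refl_spec r x x.

Lemma reflP r x : refl_spec r x (simple_refl r x).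
Proof.
rewrite /simple_refl; case: ifPn => h1; first by constructor.
by case: ifPn => h2; constructor.
Qed.

Lemma refl_up (r : 'I_n) x : x ≡ r%:Z -> simple_refl r x = x + 1.
Proof. by rewrite /simple_refl => ->. Qed.

Lemma refl_down (r : 'I_n) x : x ≡ r%:Z + 1 -> simple_refl r x = x - 1.
Proof.
move=> h; rewrite /simple_refl h; case: ifPn => // h'.
have : r%:Z + 1 ≡ r%:Z by apply: eqmod_trans h'; rewrite eqmod_sym.
by rewrite (negPf (eqmod_succ _)).
Qed.

Lemma refl_fix (r : 'I_n) x :
  ~~ (x ≡ r%:Z) -> ~~ (x ≡ r%:Z + 1) -> simple_refl r x = x.
Proof. by rewrite /simple_refl => /negPf -> /negPf ->. Qed.

Lemma reflK (r : 'I_n) : involutive (simple_refl r).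
Proof.
move=> x; case: (reflP r x) => h.
- by rewrite refl_down ?addrK // eqmod_add2r.
- by rewrite refl_up ?subrK // -(eqmod_add2r 1) subrK.
- by move=> h'; rewrite refl_fix.
Qed.

Lemma reflDn (r : 'I_n) x k : simple_refl r (x + n%:Z * k) = simple_refl r x + n%:Z * k.
Proof.
rewrite /simple_refl !eqmodDn; case: ifP => _; first by rewrite addrAC.
by case: ifP => // _; rewrite addrAC.
Qed.

Lemma n_gt0 : (0 < n)%N. Proof. exact: ltnW. Qed.

Lemma residue_lt (x : int) : (`|(x %% n%:Z)%Z| < n)%N.
Proof.
have := ltz_mod x (_ : n%:Z != 0); have := modz_ge0 x (_ : n%:Z != 0); have := n_gt0.
lia.
Qed.

Definition residue (x : int) : 'I_n := Ordinal (residue_lt x).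

Lemma residueE (x : int) : x ≡ (residue x)%:Z.
Proof.
have /= := modz_ge0 x (_ : n%:Z != 0); have := n_gt0 => ? ?.
by rewrite /residue /= gez0_abs ?modz_mod //; lia.
Qed.

Lemma residue_eq (x : int) (r : 'I_n) : (residue x == r) = (x ≡ r%:Z).
Proof.
apply/idP/idP => [/eqP <-|h]; first exact: residueE.
apply/eqP/ord_inj; apply/eqP; rewrite -eqz_nat; apply/eqP/eqmod_small.
  have := ltn_ord (residue x); have := ltn_ord r; lia.
by apply: eqmod_trans h; rewrite eqmod_sym residueE.
Qed.

Lemma residue_mod (x y : int) : (residue x == residue y) = (x ≡ y).
Proof.
rewrite residue_eq; apply/idP/idP => h.
  by apply: eqmod_trans h _; rewrite eqmod_sym residueE.
exact: eqmod_trans h (residueE y).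
Qed.

Lemma residue_ord (r : 'I_n) : residue r%:Z = r.
Proof. by apply/eqP; rewrite residue_eq. Qed.

(** A map that preserves and reflects congruence induces an injection of the finite set of residues,
    hence a permutation of it. *)
Lemma sum_periodic (f : int -> int) (s : int -> int) :
  (forall x k, f (x + n%:Z * k) = f x) ->
  {mono s : x y / x ≡ y} ->
  \sum_(i < n) f (s i%:Z) = \sum_(i < n) f i%:Z.
Proof.
move=> fper smono.
have fres x : f x = f (residue x)%:Z.
  by have /eqzmodP[k {1}->] := residueE x.
under eq_bigr do rewrite fres.
rewrite [RHS](reindex_inj (h := fun i : 'I_n => residue (s i%:Z))) //.
move=> i j /eqP; rewrite residue_mod smono => h.
by apply/eqP; rewrite -[i]residue_ord residue_eq.
Qed.

Lemma refl_mono (r : 'I_n) : {mono simple_refl r : x y / x ≡ y}.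
Proof.
have one a b : a ≡ b -> simple_refl r a ≡ simple_refl r b.
  by move=> /eqzmodP[k ->]; rewrite reflDn eqmodDn.
by move=> x y; apply/idP/idP => /one //; rewrite !reflK.
Qed.

Lemma sum_shift (f : int -> int) :
  \sum_(1 <= i < n.+1) f i%:Z = \sum_(i < n) f (i%:Z + 1).
Proof.
rewrite big_add1 big_mkord; apply: eq_bigr => i _.
by congr f; rewrite -addn1 PoszD.
Qed.

(** For the normalisation: the displacement [w x - x] is periodic, so its sum over a period is
    unchanged by composition with the reflection, and the reflection itself has total displacement
    zero. *)
Lemma affine_refl (w : int -> int) (r : 'I_n) :
  is_affine_perm n w -> is_affine_perm n (w \o simple_refl r).
Proof.
move=> [wbij wn wsum]; split.
- by apply: bij_comp => //; exists (simple_refl r); exact: reflK.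
- by move=> i /=; have := reflDn r i 1; rewrite mulr1 => ->.
have wnk i k : w (i + n%:Z * k) = w i + n%:Z * k.
  elim/int_rec: k => [|k IH|k IH]; first by rewrite mulr0 !addr0.
  - by rewrite -addn1 PoszD mulrDr mulr1 !addrA wn IH.
  - have := wn (i + n%:Z * - k.+1%:Z); rewrite -addrA.
    have -> : n%:Z * - k.+1%:Z + n%:Z = n%:Z * - k%:Z by lia.
    rewrite IH => e; lia.
rewrite -wsum !(sum_shift _) /=.
pose f x := w x - x.
have fper x k : f (x + n%:Z * k) = f x by rewrite /f wnk; lia.
have smono : {mono (fun x : int => x + 1) : x y / x ≡ y}.
  by move=> x y; rewrite eqmod_add2r.
have e1 : \sum_(i < n) f (simple_refl r (i%:Z + 1)) = \sum_(i < n) f (i%:Z + 1).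
  rewrite (sum_periodic (s := simple_refl r \o (fun x => x + 1)) fper).
    by rewrite (sum_periodic (s := fun x => x + 1) fper).
  by move=> x y /=; rewrite refl_mono smono.
have e2 : \sum_(i < n) (simple_refl r (i%:Z + 1) - (i%:Z + 1)) = 0.
  pose g x := simple_refl r x - x.
  have gper x k : g (x + n%:Z * k) = g x by rewrite /g reflDn; lia.
  rewrite (sum_periodic (s := fun x => x + 1) gper) //.
  pose r1 := residue (r%:Z + 1).
  have r1r : r1 != r by rewrite residue_eq eqmod_succ.
  rewrite (bigD1 r) //= (bigD1 r1) //= big1.
    rewrite /g refl_up // refl_down; last by rewrite eqmod_sym residueE.
    lia.
  move=> i /andP[ir ir1]; rewrite /g refl_fix ?subrr //.
    by rewrite -residue_eq residue_ord.
  by rewrite -residue_mod residue_ord.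
have : \sum_(i < n) (w (simple_refl r (i%:Z + 1)) - w (i%:Z + 1)) = 0.
  rewrite -[RHS]addr0 -[X in _ = X + _]e2 -[X in _ = _ + X](subrr (\sum_(i < n) f (i%:Z + 1))).
  rewrite -{1}e1 -sumrB -big_split /=; apply: eq_bigr => i _; rewrite /f; lia.
by rewrite sumrB => /eqP; rewrite subr_eq0 => /eqP.
Qed.

End AffinePermutations.

(** * Positions of the labels, inversions and the Coxeter length *)

Section Positions.
Variables (n : nat) (n_gt1 : (1 < n)%N).

Local Notation "x ≡ y" := (x == y %[mod n%:Z])%Z (at level 70).

Lemma affineDn (w : affperm n) i k : w (i + n%:Z * k) = w i + n%:Z * k.
Proof.
have [_ wn _] := asboolW (affperm_funP w).
elim/int_rec: k => [|k IH|k IH]; first by rewrite mulr0 !addr0.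
- by rewrite -addn1 PoszD mulrDr mulr1 !addrA wn IH.
- have := wn (i + n%:Z * - k.+1%:Z); rewrite -addrA.
  have -> : n%:Z * - k.+1%:Z + n%:Z = n%:Z * - k%:Z by lia.
  rewrite IH => e; lia.
Qed.

Lemma affine_inj (w : affperm n) : injective w.
Proof. by have [/bij_inj] := asboolW (affperm_funP w). Qed.

Lemma positionK (w : affperm n) i : w (position w i) = i.
Proof.
have [[g _ gK] _ _] := asboolW (affperm_funP w).
by rewrite /position; case: xgetP => // /(_ (g i)); rewrite /= gK.
Qed.

Lemma position_fun (w : affperm n) x : position w (w x) = x.
Proof. by apply: (@affine_inj w); rewrite positionK. Qed.

Lemma positionDn (w : affperm n) i k : position w (i + n%:Z * k) = position w i + n%:Z * k.
Proof. by apply: (@affine_inj w); rewrite affineDn !positionK. Qed.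

(** The default [w] of [insubd] never occurs, since the composition is always affine
    ([right_mulE]). *)
Definition right_mul (w : affperm n) (r : 'I_n) : affperm n :=
  insubd w ((w : int -> int) \o simple_refl r).

Lemma right_mulE w r : right_mul w r = w \o simple_refl r :> (int -> int).
Proof.
rewrite [LHS]val_insubd; case: ifPn => // /negP[]; apply/asboolP.
by apply: (affine_refl n_gt1); apply: asboolW; exact: affperm_funP.
Qed.

Lemma position_right_mul w r i : position (right_mul w r) i = simple_refl r (position w i).
Proof.
by apply: (@affine_inj (right_mul w r)); rewrite positionK right_mulE /= (reflK n_gt1) positionK.
Qed.

(** The ordinal [i] stands for the label [i + 1]. *)
Definition pos (w : affperm n) (i : 'I_n) : int := position w i.+1%:Z.

Lemma pos_right_mul w r i : pos (right_mul w r) i = simple_refl r (pos w i).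
Proof. exact: position_right_mul. Qed.

Lemma pos_mod_inj w i j : pos w i ≡ pos w j -> i = j.
Proof.
move=> /eqzmodP[k /(congr1 w)]; rewrite affineDn !positionK => e.
have h : i.+1%:Z ≡ j.+1%:Z by apply/eqzmodP; exists k.
apply/ord_inj; have := eqmod_small n_gt1 _ h.
have := ltn_ord i; have := ltn_ord j; lia.
Qed.

Lemma pos_inj w : injective (pos w).
Proof. by move=> i j e; apply: (@pos_mod_inj w); rewrite e. Qed.

Lemma pos_exists w x : exists i k, x = pos w i + n%:Z * k /\ w x = i.+1%:Z + n%:Z * k.
Proof.
have [k e] := elimT (eqzmodP _ _ _) (residueE n_gt1 (w x - 1)).
exists (residue n_gt1 (w x - 1)), k.
have e' : w x = (residue n_gt1 (w x - 1)).+1%:Z + n%:Z * k by lia.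
by split=> //; rewrite -[LHS](position_fun w) {1}e' positionDn.
Qed.

(* The labels [i + 1] and [j + 1] sit, up to multiples of [n], at the two ends
   [r] and [r + 1] of the edge; [k] is the difference of the multiples. *)
Record edge (w : affperm n) (r : 'I_n) (i j : 'I_n) (k : int) : Prop := Edge {
  edge_neq : i != j ;
  edge_left : pos w i ≡ r%:Z ;
  edge_right : pos w j = pos w i + 1 + n%:Z * k ;
  edge_ascent : (w r%:Z < w (r%:Z + 1)) = (k < 0) || (k == 0) && (i < j)%N ;
  edge_up : pos (right_mul w r) i = pos w i + 1 ;
  edge_down : pos (right_mul w r) j = pos w j - 1 ;
  edge_fix : forall l, l != i -> l != j -> pos (right_mul w r) l = pos w l }.

Lemma edge_exists (w : affperm n) (r : 'I_n) : exists i j k, edge w r i j k.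
Proof.
have [i [a [ia wia]]] := pos_exists w r%:Z.
have [j [b [jb wjb]]] := pos_exists w (r%:Z + 1).
have il : pos w i ≡ r%:Z by rewrite ia eqmod_sym eqmodDn.
have jr : pos w j ≡ r%:Z + 1 by rewrite jb eqmod_sym eqmodDn.
have ij : i != j.
  apply/eqP => e; move: il jr; rewrite e => h1 h2.
  have : r%:Z + 1 ≡ r%:Z by apply: eqmod_trans h1; rewrite eqmod_sym.
  by rewrite (negPf (eqmod_succ n_gt1 _)).
exists i, j, (a - b); split => //.
- by rewrite mulrBr; move: ia jb; lia.
- rewrite wia wjb; have := ltn_ord i; have := ltn_ord j => hj hi.
  case: (ltrgtP a b) => [ab|ba|ab]; last 1 first.
  + subst b; rewrite subrr ltxx eqxx /= ltrD2r ltz_nat ltnS //.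
  + have -> : (a - b < 0) by lia.
    by rewrite /=; nia.
  + have -> : (a - b < 0) = false by lia.
    have -> : (a - b == 0) = false by lia.
    by rewrite /=; nia.
- by rewrite pos_right_mul refl_up.
- by rewrite pos_right_mul refl_down.
- move=> l li lj; rewrite pos_right_mul refl_fix //.
  + by apply: contra li => h; apply/eqP/(@pos_mod_inj w)/(eqmod_trans h); rewrite eqmod_sym.
  + by apply: contra lj => h; apply/eqP/(@pos_mod_inj w)/(eqmod_trans h); rewrite eqmod_sym.
Qed.

(** Shi's formula for the length of an affine permutation, written with positions, that is, for the
    inverse, which has the same length. *)
Definition inversions (w : affperm n) : nat :=
  \sum_(p : 'I_n * 'I_n | (p.1 < p.2)%N) `|((pos w p.2 - pos w p.1) %/ n%:Z)%Z|.

Lemma divz_succ (d : int) : ~~ (n%:Z %| d + 1)%Z -> ((d + 1) %/ n%:Z)%Z = (d %/ n%:Z)%Z.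
Proof.
move=> h; have n0 : n%:Z != 0 by rewrite eqz_nat -lt0n (n_gt0 n_gt1).
have := divz_eq d n%:Z; have := ltz_mod d n0; have := modz_ge0 d n0.
move: (d %/ n%:Z)%Z (d %% n%:Z)%Z => a b b0 bn e.
have b1 : b + 1 != n%:Z.
  apply: contra h => /eqP b1; rewrite e -addrA b1; apply/dvdzP; exists (a + 1).
  by rewrite mulrDl mul1r.
rewrite e -addrA divzMDl // divz_small ?addr0 //; lia.
Qed.

Lemma pos_ndvd w i j : i != j -> ~~ (n%:Z %| pos w i - pos w j)%Z.
Proof. by apply: contra; rewrite -eqz_mod_dvd => /pos_mod_inj ->. Qed.

(** If just one of [a], [b] moves, their difference changes by 1, and neither the old nor the new
    difference is a multiple of [n]; so the quotient stays. *)
Lemma divz_pair w r i j k a b : edge w r i j k ->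
  a != b -> (a, b) != (i, j) -> (a, b) != (j, i) ->
  ((pos (right_mul w r) b - pos (right_mul w r) a) %/ n%:Z)%Z
  = ((pos w b - pos w a) %/ n%:Z)%Z.
Proof.
move=> [ij _ _ _ up dn fx] ab abij abji.
have ba : b != a by rewrite eq_sym.
have := pos_ndvd w ba; have := pos_ndvd (right_mul w r) ba.
have up_ x y : ~~ (n%:Z %| x)%Z -> x = y + 1 -> (x %/ n%:Z)%Z = (y %/ n%:Z)%Z.
  by move=> xn e; rewrite e divz_succ // -e.
have dn_ x y : ~~ (n%:Z %| y)%Z -> x = y - 1 -> (x %/ n%:Z)%Z = (y %/ n%:Z)%Z.
  by move=> xn e; symmetry; apply: up_ => //; lia.
have [ai|ai] := eqVneq a i; have [bj|bj] := eqVneq b j.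
- by move: abij; rewrite ai bj eqxx.
- subst a; rewrite up fx // => _ h2; apply: dn_ => //; lia.
- subst b; have [aj|aj] := eqVneq a j; first by move: ab; rewrite aj eqxx.
  by rewrite dn fx // => _ h2; apply: dn_ => //; lia.
- have [aj|aj] := eqVneq a j; have [bi|bi] := eqVneq b i.
  + by move: abji; rewrite aj bi eqxx.
  + subst a; rewrite dn fx // => h1 _; apply: up_ => //; lia.
  + subst b; rewrite up (fx a) // => h1 _; apply: up_ => //; lia.
  + by rewrite !fx.
Qed.

(** Only the pair of labels on the edge contributes to the change: its difference passes from
    [1 + n k] to [n k - 1], so its quotient drops from [k] to [k - 1] or, in the other order, rises
    from [- k - 1] to [- k]. *)
Lemma inversions_right_mul (w : affperm n) (r : 'I_n) :
  if w r%:Z < w (r%:Z + 1) then inversions (right_mul w r) = (inversions w).+1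
  else (inversions (right_mul w r)).+1 = inversions w.
Proof.
have [i [j [k e]]] := edge_exists w r.
have n0 : n%:Z != 0 by rewrite eqz_nat -lt0n (n_gt0 n_gt1).
have [ij _ jr asc up dn fx] := e.
have d1 m : ((1 + n%:Z * m) %/ n%:Z)%Z = m.
  by rewrite addrC mulrC divzMDl // divz_small ?addr0 //; lia.
have d2 m : ((n%:Z * m - 1) %/ n%:Z)%Z = m - 1.
  have -> : n%:Z * m - 1 = (m - 1) * n%:Z + (n%:Z - 1) by ring.
  by rewrite divzMDl // divz_small ?addr0 //; lia.
have dij : pos w j - pos w i = 1 + n%:Z * k by rewrite jr; lia.
have dji : pos w i - pos w j = n%:Z * - k - 1 by rewrite jr; lia.
have dij' : pos (right_mul w r) j - pos (right_mul w r) i = n%:Z * k - 1.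
  by rewrite up dn; lia.
have dji' : pos (right_mul w r) i - pos (right_mul w r) j = 1 + n%:Z * - k.
  by rewrite up dn; lia.
have split_ (a b : 'I_n) : (a < b)%N -> ((a, b) == (i, j)) || ((a, b) == (j, i)) ->
    exists S, inversions w = (`|((pos w b - pos w a) %/ n%:Z)%Z| + S)%N /\
    inversions (right_mul w r) =
      (`|((pos (right_mul w r) b - pos (right_mul w r) a) %/ n%:Z)%Z| + S)%N.
  move=> ab abij; exists (\sum_(p : 'I_n * 'I_n | (p.1 < p.2)%N && (p != (a, b)))
      `|((pos w p.2 - pos w p.1) %/ n%:Z)%Z|%N).
  split; first by rewrite /inversions (bigD1 (a, b)).
  rewrite /inversions (bigD1 (a, b)) //=; congr addn.
  apply: eq_bigr => -[c d] /= /andP[cd cdab]; rewrite (divz_pair e) //.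
  - by apply: contraL cd => /eqP ->; rewrite ltnn.
  - apply/eqP => -[ci dj]; case/orP: abij => /eqP[ai bj].
      by rewrite ci dj ai bj eqxx in cdab.
    by move: ab cd; rewrite ci dj ai bj ltnNge => /negP h /ltnW.
  - apply/eqP => -[ci dj]; case/orP: abij => /eqP[ai bj]; last first.
      by rewrite ci dj ai bj eqxx in cdab.
    by move: ab cd; rewrite ci dj ai bj ltnNge => /negP h /ltnW.
rewrite asc.
have [lij|lji|/ord_inj ejij] := ltngtP i j; last by rewrite ejij eqxx in ij.
- have [S [-> ->]] := split_ i j lij ltac:(by rewrite eqxx).
  rewrite dij dij' d1 d2; case: ifPn; lia.
- have [S [-> ->]] := split_ j i lji ltac:(by rewrite eqxx orbT).
  rewrite dji dji' d1 d2; case: ifPn; lia.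
Qed.

Lemma affine_id : `[< is_affine_perm n (@id int) >].
Proof.
apply/asboolP; split=> //; first by exists id.
have -> : 'C(n.+1, 2) = (\sum_(0 <= i < n) i.+1)%N.
  by rewrite -bin2_sum big_nat_recl //= add0n.
by rewrite big_add1 (big_morph Posz PoszD (erefl 0)).
Qed.

Definition affine1 : affperm n := AffPerm affine_id.

Lemma inversions1 : inversions affine1 = 0%N.
Proof.
rewrite /inversions big1 // => -[a b] /= ab.
have p1 (i : 'I_n) : pos affine1 i = i.+1%:Z by exact: (position_fun affine1 i.+1).
rewrite !p1 divz_small //; have := ltn_ord a; have := ltn_ord b; lia.
Qed.

(** Over one period [w] rises by exactly [n] in [n] strictly positive steps, so every step is 1 and
    [w] is a translation; the normalised sum rules out all translations but the identity. *)
Lemma no_descent (w : affperm n) :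
  (forall r : 'I_n, w r%:Z < w (r%:Z + 1)) -> w = affine1.
Proof.
move=> asc.
have asc' (x : int) : w x < w (x + 1).
  have [k e] := elimT (eqzmodP _ _ _) (residueE n_gt1 x).
  have := asc (residue n_gt1 x); move: (residue n_gt1 x) e => r -> {x}.
  by rewrite [_ + n%:Z * k + 1]addrAC !affineDn ltrD2r.
have ascN (x : int) (m : nat) : w x <= w (x + m%:Z) - m%:Z.
  elim: m => [|m IH]; first by rewrite addr0 subr0.
  have -> : x + m.+1%:Z = x + m%:Z + 1 by lia.
  have := asc' (x + m%:Z); lia.
have step (x : int) : w (x + 1) = w x + 1.
  have := asc' x; have := ascN (x + 1) n.-1.
  have -> : x + 1 + n.-1%:Z = x + n%:Z * 1 by have := n_gt1; lia.
  rewrite affineDn; have := n_gt1; lia.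
have wx (x : int) : w x = w 0 + x.
  elim/int_rec: x => [|m IH|m IH]; first by rewrite addr0.
  - by rewrite -addn1 PoszD step IH addrA.
  - have := step (- m.+1%:Z); have -> : - m.+1%:Z + 1 = - m%:Z by lia.
    rewrite IH; lia.
have [_ _] := asboolW (affperm_funP w).
have [_ _ <-] := asboolW affine_id.
rewrite !sum_shift; under eq_bigr do rewrite wx.
rewrite big_split /= sumr_const card_ord => e0.
have e : w 0 *+ n = 0 by apply: (@addIr _ (\sum_(i < n) (i%:Z + 1))); rewrite e0 add0r -[RHS](sum_shift n id).
have w0 : w 0 = 0.
  by move/eqP: e; rewrite mulrn_eq0 => /orP[h|/eqP //]; have := n_gt1; lia.
by apply/val_inj/funext => x; rewrite /= wx w0 add0r.
Qed.

Lemma refl_word_rcons (s : seq 'I_n) r :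
  refl_word (rcons s r) = refl_word s \o simple_refl r.
Proof. by elim: s => //= a s ->. Qed.

Lemma refl_word_affine (s : seq 'I_n) :
  exists2 w : affperm n, w = refl_word s :> (int -> int) & (inversions w <= size s)%N.
Proof.
elim/last_ind: s => [|s r [w ws ls]]; first by exists affine1; rewrite ?inversions1.
exists (right_mul w r); first by rewrite right_mulE refl_word_rcons ws.
rewrite size_rcons; have := inversions_right_mul w r; case: ifP => _; lia.
Qed.

(** Induction on the number of inversions: unless [w] is the identity it has a descent, and
    multiplying by that reflection removes one inversion. *)
Lemma affine_word (w : affperm n) : exists2 s : seq 'I_n,
  w = refl_word s :> (int -> int) & size s = inversions w.
Proof.
move: {-2}(inversions w) (erefl (inversions w)) => m; elim: m w => [|m IH] w e.
  suff -> : w = affine1 by exists [::].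
  apply: no_descent => r; have := inversions_right_mul w r; case: ifP => // _; lia.
have [r] : exists r : 'I_n, ~~ (w r%:Z < w (r%:Z + 1)).
  apply/not_existsP => h; have w1 : w = affine1.
    by apply: no_descent => r; apply/negP => hr; apply: (h r); apply/negP.
  by move: e; rewrite w1 inversions1.
move=> /negPf dr; have := inversions_right_mul w r; rewrite dr -e => -[e'].
have [s ws ss] := IH _ (esym e').
exists (rcons s r); last by rewrite size_rcons ss.
rewrite refl_word_rcons -ws right_mulE; apply/funext => x /=.
by rewrite (reflK n_gt1).
Qed.

Lemma coxeter_lengthE (w : affperm n) : coxeter_length n w = inversions w.
Proof.
have [s0 ws0 ss0] := affine_word w.
have low (s : seq 'I_n) : (w : int -> int) = refl_word s -> (inversions w <= size s)%N.
  move=> e; have [w' w's] := refl_word_affine s.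
  by have -> : w' = w by apply: val_inj; rewrite /= w's e.
rewrite /coxeter_length; case: xgetP => [k _ [[s sk ws] kmin]|].
  apply/anti_leq; rewrite -{1}ss0 kmin //= -sk; exact: low.
by move=> /(_ (inversions w)) []; split => //; exists s0.
Qed.

Definition rate (R : realType) (q : R) (w : affperm n) (r : 'I_n) : R :=
  if w r%:Z < w (r%:Z + 1) then 1 else q.

Lemma hecke_rateE (R : realType) (q : R) (w : affperm n) r :
  hecke_rate q w r = rate q w r.
Proof.
rewrite /hecke_rate /rate -right_mulE !coxeter_lengthE.
have := inversions_right_mul w r; case: ifP => _ e; first by rewrite e eqxx.
by rewrite -e eqxx; case: eqP => //; lia.
Qed.

End Positions.

(** * The exclusion process on the ring *)

Section RingExclusion.
Variables (R : realType) (n : nat) (n_gt1 : (1 < n)%N) (q : R).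
Hypothesis q01 : 0 <= q <= 1.
Implicit Types (r : 'I_n) (S : {set 'I_n}) (f : {set 'I_n} -> R).

Local Notation nxt r := (residue n_gt1 (r%:Z + 1)).

Lemma nxt_neq (r : 'I_n) : nxt r != r.
Proof. by rewrite residue_eq eqmod_succ. Qed.

Lemma nxt_inj : injective (fun r : 'I_n => nxt r).
Proof.
move=> r s /eqP; rewrite residue_mod eqmod_add2r -(residue_mod n_gt1) !residue_ord.
by move/eqP.
Qed.

Definition flip (r : 'I_n) (S : {set 'I_n}) : {set 'I_n} :=
  [set x | tperm r (nxt r) x \in S].

Lemma flipK r : involutive (flip r).
Proof. by move=> S; apply/setP => x; rewrite !inE tpermK. Qed.

Lemma card_flip r S : #|flip r S| = #|S|.
Proof.
rewrite -(card_imset (flip r S) (@perm_inj _ (tperm r (nxt r)))).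
apply: eq_card => x; apply/imsetP/idP => [[y]|xS].
  by rewrite inE => yS ->.
by exists (tperm r (nxt r) x); rewrite ?inE tpermK.
Qed.

Lemma in_flipl r S : (r \in flip r S) = (nxt r \in S).
Proof. by rewrite inE tpermL. Qed.

Lemma in_flipr r S : (nxt r \in flip r S) = (r \in S).
Proof. by rewrite inE tpermR. Qed.

Lemma flip_id r S : (r \in S) = (nxt r \in S) -> flip r S = S.
Proof.
move=> e; apply/setP => x; rewrite inE.
by case: tpermP => [->|->|//]; rewrite e.
Qed.

Definition right_jump (r : 'I_n) (S : {set 'I_n}) := (r \in S) && (nxt r \notin S).
Definition left_jump (r : 'I_n) (S : {set 'I_n}) := (r \notin S) && (nxt r \in S).

Lemma right_flip r S : right_jump r (flip r S) = left_jump r S.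
Proof. by rewrite /right_jump /left_jump in_flipl in_flipr andbC. Qed.

Lemma left_flip r S : left_jump r (flip r S) = right_jump r S.
Proof. by rewrite -right_flip flipK. Qed.

(** At each [r] the difference of the two indicators is the occupation of [r] minus that of the next
    site, and this telescopes around the ring. *)
Lemma sum_right_left S :
  \sum_r (right_jump r S)%:R = \sum_r (left_jump r S)%:R :> R.
Proof.
apply/eqP; rewrite -subr_eq0 -sumrB; apply/eqP.
transitivity (\sum_(r < n) ((r \in S)%:R - (nxt r \in S)%:R : R)).
  apply: eq_bigr => r _; rewrite /right_jump /left_jump.
  by case: (r \in S); case: (_ \in S); rewrite /= ?subrr ?subr0 ?sub0r.
by rewrite sumrB [X in X - _](reindex_inj nxt_inj) subrr.
Qed.

Definition jump_rate (r : 'I_n) (S : {set 'I_n}) : R :=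
  (right_jump r S)%:R + q * (left_jump r S)%:R.

Definition gen (f : {set 'I_n} -> R) (S : {set 'I_n}) : R :=
  \sum_r jump_rate r S * (f (flip r S) - f S).

(** One step of a lazy discrete-time version: the total jump rate is at most [n], so with this
    factor the chain stays put with probability at least 1/2. *)
Definition step (f : {set 'I_n} -> R) (S : {set 'I_n}) : R :=
  f S + (2 * n%:R)^-1 * gen f S.

Lemma n_gt0R : 0 < n%:R :> R.
Proof. by rewrite ltr0n; exact: n_gt0 n_gt1. Qed.

Lemma jump_rate_ge0 r S : 0 <= jump_rate r S.
Proof. by rewrite /jump_rate addr_ge0 // mulr_ge0 //; case/andP: q01. Qed.

Lemma jump_rate_le1 r S : jump_rate r S <= 1.
Proof.
rewrite /jump_rate /right_jump /left_jump; have /andP[q0 q1] := q01.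
by case: (r \in S); case: (_ \in S); rewrite /= ?mulr0 ?mulr1 ?addr0 ?add0r.
Qed.

Lemma sum_jump_rate S : \sum_r jump_rate r S <= n%:R.
Proof.
have -> : n%:R = \sum_(r < n) (1 : R) by rewrite sumr_const card_ord.
by apply: ler_sum => r _; exact: jump_rate_le1.
Qed.

(** By [sum_right_left], the total rate into a configuration equals the total rate out of it. *)
Lemma sum_jump_rate_flip S : \sum_r jump_rate r (flip r S) = \sum_r jump_rate r S.
Proof.
rewrite /jump_rate.
under eq_bigr do rewrite right_flip left_flip.
by rewrite !big_split /= -!mulr_sumr sum_right_left.
Qed.

(* The generator is doubly stochastic: the uniform law on each level is
   invariant because a ring has as many left ends of clusters as right ends. *)
Lemma sum_gen K f : \sum_(S : {set 'I_n} | #|S| == K) gen f S = 0.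
Proof.
rewrite exchange_big /=.
under eq_bigr => r _.
  under eq_bigr do rewrite mulrBr.
  rewrite sumrB (reindex_inj (inv_inj (flipK r))) /=.
  under eq_bigl do rewrite card_flip.
  under eq_bigr do rewrite flipK.
  over.
rewrite sumrB /= exchange_big [X in _ - X]exchange_big /= -sumrB big1 // => S _.
by rewrite -!mulr_suml sum_jump_rate_flip subrr.
Qed.

Lemma sum_step K f : \sum_(S : {set 'I_n} | #|S| == K) step f S
  = \sum_(S : {set 'I_n} | #|S| == K) f S.
Proof. by rewrite big_split /= -mulr_sumr sum_gen mulr0 addr0. Qed.

Lemma sum_gen_all f : \sum_S gen f S = 0.
Proof.
rewrite (partition_big (fun S : {set 'I_n} => inord #|S| : 'I_n.+1) xpredT) //=.
rewrite big1 // => K _; apply: etrans (sum_gen K f); apply: eq_bigl => S.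
by rewrite -val_eqE /= inordK // ltnS -[X in (_ <= X)%N](card_ord n) max_card.
Qed.

(** Up to a constant, the Dirichlet form of the symmetric exclusion process; it does not see [q]. *)
Definition energy (f : {set 'I_n} -> R) : R :=
  \sum_S \sum_r (f (flip r S) - f S) ^+ 2.

Lemma energy_ge0 f : 0 <= energy f.
Proof. by do 2 (apply: sumr_ge0 => ? _); exact: sqr_ge0. Qed.

(** The bijection [flip r] exchanges right and left jumps and keeps the squared increment, so each
    kind carries half of the energy. *)
Lemma right_energy f :
  \sum_S \sum_r (right_jump r S)%:R * (f (flip r S) - f S) ^+ 2 = energy f / 2.
Proof.
have e1 : \sum_S \sum_r (right_jump r S)%:R * (f (flip r S) - f S) ^+ 2
        = \sum_S \sum_r (left_jump r S)%:R * (f (flip r S) - f S) ^+ 2.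
  rewrite exchange_big [RHS]exchange_big; apply: eq_bigr => r _ /=.
  rewrite (reindex_inj (inv_inj (flipK r))) /=; apply: eq_bigr => S _.
  by rewrite right_flip flipK -sqrrN opprB.
suff : energy f = \sum_S \sum_r (right_jump r S)%:R * (f (flip r S) - f S) ^+ 2
     + \sum_S \sum_r (left_jump r S)%:R * (f (flip r S) - f S) ^+ 2.
  by rewrite -e1 => ->; field.
rewrite -big_split; apply: eq_bigr => S _; rewrite -big_split; apply: eq_bigr => r _ /=.
rewrite -mulrDl /right_jump /left_jump.
have := @flip_id r S; case: (r \in S); case: (nxt r \in S) => /= h;
  rewrite ?addr0 ?add0r ?mul1r // h // subrr expr0n mulr0 //.
Qed.

(** Invariance kills the sum of [gen f2], which leaves minus the quadratic form [D]; the square of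
    the increment costs half of it back. Keeping only the right jumps in [D] gives a bound uniform
    in [q], including [q = 0]. *)
Lemma sum_sqr_step f :
  \sum_S step f S ^+ 2 <= \sum_S f S ^+ 2 - energy f / (8 * n%:R).
Proof.
have n0 := n_gt0R.
pose f2 S := f S ^+ 2.
pose D S : R := \sum_r jump_rate r S * (f (flip r S) - f S) ^+ 2.
have key S : step f S ^+ 2 <= f2 S + (2 * n%:R)^-1 * gen f2 S - (4 * n%:R)^-1 * D S.
  have g2 : gen f2 S = 2 * f S * gen f S + D S.
    rewrite /gen /D mulr_sumr -big_split; apply: eq_bigr => r _ /=.
    by rewrite /f2; ring.
  (* Cauchy-Schwarz for the jump rates, of total mass at most [n]; it yields [h3]. *)
  have : 0 <= \sum_r jump_rate r S * ((f (flip r S) - f S) - gen f S / n%:R) ^+ 2.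
    by apply: sumr_ge0 => r _; rewrite mulr_ge0 ?jump_rate_ge0 ?sqr_ge0.
  have -> : \sum_r jump_rate r S * ((f (flip r S) - f S) - gen f S / n%:R) ^+ 2
     = D S - 2 * (gen f S / n%:R) * gen f S
       + (gen f S / n%:R) ^+ 2 * \sum_r jump_rate r S.
    rewrite [X in 2 * _ * X]/gen mulr_sumr /D -sumrB mulr_sumr -big_split.
    by apply: eq_bigr => r _ /=; ring.
  have h1 : (gen f S / n%:R) ^+ 2 * \sum_r jump_rate r S <= (gen f S / n%:R) ^+ 2 * n%:R.
    by rewrite ler_wpM2l ?sqr_ge0 ?sum_jump_rate.
  move=> h2; rewrite /step g2 /f2.
  have h3 : gen f S ^+ 2 / n%:R <= D S.
    have -> : gen f S ^+ 2 / n%:R = 2 * (gen f S / n%:R) * gen f S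
        - (gen f S / n%:R) ^+ 2 * n%:R by field; rewrite gt_eqF.
    lra.
  have -> : (f S + (2 * n%:R)^-1 * gen f S) ^+ 2 =
     f S ^+ 2 + (2 * n%:R)^-1 * (2 * f S * gen f S)
     + (4 * n%:R)^-1 * (gen f S ^+ 2 / n%:R) by field; rewrite gt_eqF.
  have h4 : (4 * n%:R)^-1 * (gen f S ^+ 2 / n%:R) <= (4 * n%:R)^-1 * D S.
    by rewrite ler_wpM2l // invr_ge0 mulr_ge0 // ltW.
  have -> : (2 * n%:R)^-1 * (2 * f S * gen f S + D S) =
    (2 * n%:R)^-1 * (2 * f S * gen f S) + 2 * ((4 * n%:R)^-1 * D S).
    by field; rewrite gt_eqF.
  lra.
apply: le_trans (ler_sum _ (fun S _ => key S)) _.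
rewrite sumrB big_split /= -!mulr_sumr sum_gen_all mulr0 addr0 lerD2l lerN2.
have -> : energy f / (8 * n%:R) = (4 * n%:R)^-1 * (energy f / 2).
  by field; rewrite gt_eqF.
apply: ler_wpM2l; first by rewrite invr_ge0 mulr_ge0 // ltW.
rewrite -right_energy.
apply: ler_sum => S _; apply: ler_sum => r _; rewrite ler_wpM2r ?sqr_ge0 //.
by rewrite /jump_rate lerDl mulr_ge0 //; case/andP: q01.
Qed.

Lemma energy_flip f r S : (f (flip r S) - f S) ^+ 2 <= energy f.
Proof.
rewrite /energy (bigD1 S) //= (bigD1 r) //= -addrA lerDl addr_ge0 //.
  by apply: sumr_ge0 => ? _; exact: sqr_ge0.
by do 2 (apply: sumr_ge0 => ? _); exact: sqr_ge0.
Qed.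

(** The constant [M] does not depend on [f]: a quantitative form of being connected by flips. *)
Definition tied S S' := exists M : R, forall f, (f S - f S') ^+ 2 <= M * energy f.

Lemma tied_refl S : tied S S.
Proof. by exists 0 => f; rewrite subrr expr0n mul0r. Qed.

Lemma tied_flip r S : tied S (flip r S).
Proof. by exists 1 => f; rewrite mul1r -sqrrN opprB energy_flip. Qed.

Lemma tied_sym S S' : tied S S' -> tied S' S.
Proof. by move=> [M MS]; exists M => f; rewrite -sqrrN opprB. Qed.

Lemma tied_trans S1 S2 S3 : tied S1 S2 -> tied S2 S3 -> tied S1 S3.
Proof.
move=> [M h] [M' h']; exists (2 * M + 2 * M') => f.
have := h f; have := h' f; have := sqr_ge0 (f S1 - f S2 - (f S2 - f S3)).
rewrite !expr2; lra.
Qed.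

Lemma card_initial (k : nat) : (k <= n)%N -> #|[set x : 'I_n | (x < k)%N]%SET| = k.
Proof.
move=> kn; rewrite -sum1_card -[RHS]card_ord -[RHS]sum1_card.
by rewrite (big_ord_widen _ (fun=> 1%N) kn); apply: eq_bigl => x; rewrite inE.
Qed.

(** Induction on the sum of the sites of [S]: a particle at [r + 1] with a hole at [r] is moved
    left, without wrapping around the ring; when no such move exists, [S] is an initial segment. *)
Lemma tied_initial S : tied S [set x : 'I_n | (x < #|S|)%N].
Proof.
have [m] := ubnP (\sum_(x in S) x)%N; elim: m S => // m IH S Sm.
have [[r [rn rS sS]]|h] :=
    pselect (exists r, [/\ (r.+1 < n)%N, r \notin S & nxt r \in S]); last first.
  have down (x y : 'I_n) : x \in S -> (y <= x)%N -> y \in S.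
    move=> xS; have [k] := ubnP (x - y)%N; elim: k y => // k IHk y xy yx.
    case: (eqVneq x y) => [<- //|nxy].
    have yn : (y.+1 < n)%N by have := ltn_ord x; move: nxy; rewrite -val_eqE /=; lia.
    have yS : Ordinal yn \in S.
      by apply: IHk => /=; move: nxy; rewrite -val_eqE /=; lia.
    apply/negPn/negP => ynS; apply: h; exists y; split=> //.
    suff -> : nxt y = Ordinal yn by [].
    by apply/eqP; rewrite residue_eq /= -addn1 PoszD.
  suff {1}-> : S = [set x : 'I_n | (x < #|S|)%N]%SET by exact: tied_refl.
  apply/eqP; rewrite eqEcard; apply/andP; split.
    apply/fintype.subsetP => x xS; rewrite inE.
    have : [set y : 'I_n | (y < x.+1)%N]%SET \subset S.
      by apply/fintype.subsetP => y; rewrite inE ltnS; exact: down.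
    by move/subset_leq_card; rewrite card_initial.
  by rewrite card_initial // -[X in (_ <= X)%N](card_ord n) max_card.
apply: tied_trans (tied_flip r S) _; rewrite -(card_flip r S); apply: IH.
have nr : nxt r = r.+1 :> nat.
  have -> : nxt r = Ordinal rn by apply/eqP; rewrite residue_eq /= -addn1 PoszD.
  by [].
rewrite ltnS in Sm; apply: leq_trans Sm.
rewrite (reindex_inj (@perm_inj _ (tperm r (nxt r)))).
under eq_bigl do rewrite inE tpermK.
rewrite (bigD1 (nxt r) sS) [X in (_ < X)%N](bigD1 (nxt r) sS) tpermR nr.
apply: (@leq_add r.+1 _ r.+1 _) => //; apply: leq_sum => x /andP[xS xn].
by rewrite tpermD // 1?eq_sym //; apply: contraNneq rS => <-.
Qed.

Lemma tied_card S S' : #|S| = #|S'| -> tied S S'.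
Proof.
move=> e; apply: tied_trans (tied_initial S) _; rewrite e.
exact/tied_sym/tied_initial.
Qed.

Definition centered f := forall K, \sum_(S : {set 'I_n} | #|S| == K) f S = 0.

(** A function with sum zero on a level cannot keep one strict sign there, so each [S] has a partner
    [S'] of the same size with [f S * f S' <= 0]. Then [f S ^+ 2] is at most the square of the
    difference, which the energy controls through [tied_card]. *)
Lemma poincare : exists2 C : R, 0 < C &
  forall f, centered f -> \sum_S f S ^+ 2 <= C * energy f.
Proof.
have hM (p : {set 'I_n} * {set 'I_n}) : exists M : R, 0 <= M /\ (#|p.1| = #|p.2| ->
    forall f, (f p.1 - f p.2) ^+ 2 <= M * energy f).
  case: (pselect (#|p.1| = #|p.2|)) => [/tied_card[M h]|h]; last by exists 0.
  exists `|M|; split=> // _ f; apply: le_trans (h f) _.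
  by rewrite ler_wpM2r ?energy_ge0 ?ler_norm.
have [M hM'] := choice hM.
pose C0 := \sum_p M p.
have C00 : 0 <= C0 by apply: sumr_ge0 => p _; have [] := hM' p.
exists (\sum_(S : {set 'I_n}) (C0 + 1)) => [|f fc].
  have C1 : 0 < C0 + 1 by rewrite ltr_wpDl.
  by rewrite (bigD1 finset.set0) //= ltr_pwDl // sumr_ge0 // => ? _; exact: ltW.
rewrite mulr_suml; apply: ler_sum => S _.
have [S' eS' ffS'] : exists2 S' : {set 'I_n}, #|S'| = #|S| & f S * f S' <= 0.
  apply: contrapT => h; have := fc #|S|.
  have : 0 < \sum_(S' : {set 'I_n} | #|S'| == #|S|) f S * f S'.
    rewrite (bigD1 S) //= ltr_pwDl //.
      rewrite ltNge; apply/negP => h'; apply: h; by exists S.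
    apply: sumr_ge0 => S' /andP[/eqP eS' _]; rewrite leNgt; apply/negP => h'.
    by apply: h; exists S' => //; exact: ltW.
  by rewrite -mulr_sumr => h0 h1; move: h0; rewrite h1 mulr0 ltxx.
have : f S ^+ 2 <= (f S - f S') ^+ 2.
  by have := sqr_ge0 (f S'); rewrite !expr2; lra.
move=> /le_trans; apply.
have [M0 /(_ (esym eS') f) /= h] := hM' (S, S').
apply: le_trans h _; rewrite ler_wpM2r ?energy_ge0 // ler_wpDr //.
rewrite /C0 (bigD1 (S, S')) //= lerDl; apply: sumr_ge0 => p _; by have [] := hM' p.
Qed.

Lemma centered_step f : centered f -> centered (step f).
Proof. by move=> fc K; rewrite sum_step. Qed.

Lemma centered_iter m f : centered f -> centered (iter m step f).
Proof. by move=> fc; elim: m => //= m IH; exact: centered_step. Qed.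

Lemma centered_mixing f (e : R) : 0 < e -> centered f ->
  exists m, forall S, `|iter m step f S| <= e.
Proof.
move=> e0 fc; have [C C0 pC] := poincare; have n0 := n_gt0R.
(* The Poincare inequality allows the rate [1 / (8 n C)]; the added 1 keeps the factor [1 - k]
   positive. *)
pose k : R := ((C * (8 * n%:R)) + 1)^-1.
have D0 : 0 < C * (8 * n%:R) by rewrite !mulr_gt0.
have k01 : 0 < k < 1.
  by rewrite invr_gt0 addr_gt0 //= invf_lt1 ?addr_gt0 // ltrDr.
pose N (g : {set 'I_n} -> R) := \sum_S g S ^+ 2.
have N0 g : 0 <= N g by apply: sumr_ge0 => S _; exact: sqr_ge0.
have contr g : centered g -> N (step g) <= (1 - k) * N g.
  move=> gc; apply: le_trans (sum_sqr_step g) _.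
  rewrite mulrBl mul1r lerD2l lerN2.
  have h : N g / (C * (8 * n%:R)) <= energy g / (8 * n%:R).
    rewrite invfM mulrA; apply: ler_wpM2r; first by rewrite invr_ge0 mulr_ge0 // ltW.
    by rewrite ler_pdivrMr // mulrC; exact: pC.
  apply: le_trans h; rewrite mulrC ler_wpM2l // lef_pV2 ?posrE ?addr_gt0 //.
  by rewrite lerDl.
have Nm m : N (iter m step f) <= (1 - k) ^+ m * N f.
  elim: m => [|m IH]; first by rewrite expr0 mul1r.
  rewrite iterS exprS -mulrA; apply: le_trans (contr _ (centered_iter m fc)) _.
  by rewrite ler_wpM2l // subr_ge0 ltW //; case/andP: k01.
have cv : (1 - k) ^+ m * N f @[m --> \oo] --> (0 : R).
  rewrite -[X in _ --> X](mul0r (N f)); apply: cvgMl; apply: cvg_expr.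
  by rewrite ger0_norm; case/andP: k01; lra.
have e2 : 0 < e ^+ 2 by rewrite exprn_gt0.
have /cvgrPdist_lt /(_ _ e2) [m _ /(_ m (leqnn m))] := cv.
rewrite sub0r normrN ger0_norm => [h|]; last first.
  by rewrite mulr_ge0 // exprn_ge0 // subr_ge0; case/andP: k01 => _ /ltW.
exists m => S; rewrite -(@ler_pXn2r _ 2) ?nnegrE ?normr_ge0 // ?(ltW e0) //.
rewrite real_normK ?num_real //; apply: le_trans (ltW h); apply: le_trans (Nm m).
by rewrite /N (bigD1 S) //= lerDl; apply: sumr_ge0 => ? _; exact: sqr_ge0.
Qed.

Definition level_mean f (K : nat) : R :=
  (\sum_(S : {set 'I_n} | #|S| == K) f S) / 'C(n, K)%:R.

Lemma card_level K : #|[pred S : {set 'I_n} | #|S| == K]| = 'C(n, K).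
Proof.
rewrite -[n in RHS]card_ord -card_draws; apply: eq_card => S.
by rewrite !inE.
Qed.

Lemma card_set_le S : (#|S| <= n)%N.
Proof. by rewrite -[X in (_ <= X)%N](card_ord n) max_card. Qed.

Lemma mixing f (e : R) : 0 < e ->
  exists m, forall S, `|iter m step f S - level_mean f #|S| | <= e.
Proof.
move=> e0; pose f0 S := f S - level_mean f #|S|.
have f0c : centered f0.
  move=> K; have [Kn|Kn] := leqP K n; last first.
    apply: big_pred0 => S; apply/negP => /eqP eK; have := card_set_le S; lia.
  rewrite sumrB [X in _ - X](eq_bigr (fun=> level_mean f K)); last by move=> S /eqP ->.
  rewrite sumr_const card_level -mulr_natr /level_mean divfK ?subrr //.
  by rewrite pnatr_eq0 -lt0n bin_gt0.
have [m h] := centered_mixing e0 f0c; exists m => S; apply: le_trans (h S).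
(* [step] is linear and fixes functions of the cardinality alone, since flips preserve it. *)
suff -> : iter m step f0 = (fun S => iter m step f S - level_mean f #|S|) by [].
elim: m {h} => // m IH; rewrite iterS IH; apply/funext => {}S /=.
rewrite /step addrAC; congr (_ + _ * _ - _); apply: eq_bigr => r _.
by rewrite card_flip; congr (_ * _); ring.
Qed.

End RingExclusion.

(** * Current, height functions and the approximate Poisson equation *)

Section Drift.
Variables (R : realType) (n : nat) (n_gt1 : (1 < n)%N) (q : R).
Hypothesis q01 : 0 <= q <= 1.
Implicit Types (r : 'I_n) (S : {set 'I_n}) (f : {set 'I_n} -> R) (h : int -> int).

Local Notation "x ≡ y" := (x == y %[mod n%:Z])%Z (at level 70).
Local Notation nxt r := (residue n_gt1 (r%:Z + 1)).
Local Notation flip := (flip n_gt1).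
Local Notation right_jump := (right_jump n_gt1).
Local Notation left_jump := (left_jump n_gt1).
Local Notation step := (step n_gt1 q).
Local Notation gen := (gen n_gt1 q).

Definition drift S : R :=
  (2 * n%:R)^-1 * \sum_r ((right_jump r S)%:R - q * (left_jump r S)%:R).

(* An approximate solution of the Poisson equation: its generator is
   [2 * n * (iter m step drift - drift)], and [iter m step drift] is nearly
   constant on each level. *)
Definition corrector (m : nat) S : R := \sum_(j < m) iter j step drift S.

(* [h] is the height function (integrated current) of the periodic
   configuration [S]. *)
Definition height_of h S := forall x : int, h (x - 1) - h x = (residue n_gt1 x \in S)%:Z.

(** Written as a minimum over neighbours, this is monotone in an arbitrary [h]; on a height function
    it adds 1 at the sites over [r] exactly when a right jump from [r] is possible ([raiseE]).
    Dually for [lower]. *)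
Definition raise r h (x : int) : int :=
  if x ≡ r%:Z then Num.min (h (x - 1)) (h (x + 1) + 1) else h x.

Definition lower r h (x : int) : int :=
  if x ≡ r%:Z then Num.max (h (x - 1) - 1) (h (x + 1)) else h x.

Lemma height_succ h S x : height_of h S ->
  h x - h (x + 1) = (residue n_gt1 (x + 1) \in S)%:Z.
Proof. by move/(_ (x + 1)); rewrite addrK. Qed.

Lemma residue_nxt r (x : int) : x ≡ r%:Z -> residue n_gt1 (x + 1) = nxt r.
Proof. by move=> h; apply/eqP; rewrite residue_mod eqmod_add2r. Qed.

Lemma raiseE r h S : height_of h S ->
  raise r h = fun x => h x + ((x ≡ r%:Z) && right_jump r S)%:Z.
Proof.
move=> hS; apply/funext => x; rewrite /raise; case: ifPn => xr /=; last by rewrite addr0.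
have := hS x; have := height_succ x hS.
rewrite (residue_nxt xr); move: xr; rewrite -(residue_eq n_gt1) => /eqP ->.
rewrite /right_jump; case: (r \in S); case: (nxt r \in S) => /=; lia.
Qed.

Lemma lowerE r h S : height_of h S ->
  lower r h = fun x => h x - ((x ≡ r%:Z) && left_jump r S)%:Z.
Proof.
move=> hS; apply/funext => x; rewrite /lower; case: ifPn => xr /=; last by rewrite subr0.
have := hS x; have := height_succ x hS.
rewrite (residue_nxt xr); move: xr; rewrite -(residue_eq n_gt1) => /eqP ->.
rewrite /left_jump; case: (r \in S); case: (nxt r \in S) => /=; lia.
Qed.

Lemma residue_pred r (x : int) : (x - 1 ≡ r%:Z) = (residue n_gt1 x == nxt r).
Proof. by rewrite residue_mod -(eqmod_add2r n 1) subrK. Qed.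

Lemma in_flip r S y : (y \in flip r S) =
  if y == r then nxt r \in S else if y == nxt r then r \in S else y \in S.
Proof. by rewrite inE; case: tpermP => [->|->|/eqP/negPf -> /eqP/negPf -> //]; rewrite ?eqxx // (negPf (nxt_neq n_gt1 r)). Qed.

Lemma height_raise r h S : height_of h S -> right_jump r S ->
  height_of (raise r h) (flip r S).
Proof.
move=> hS rS x; rewrite (raiseE r hS) rS !andbT in_flip.
have := hS x; rewrite residue_pred -(residue_eq n_gt1 x).
move: rS => /andP[r0 r1].
have := nxt_neq n_gt1 r; rewrite eq_sym => nr.
case: eqVneq => [->|_]; first by rewrite eq_sym (negPf nr) r0 (negPf r1) /=; lia.
by case: eqVneq => [->|_]; rewrite ?r0 ?(negPf r1) /= ?addr0 //; lia.
Qed.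

Lemma height_lower r h S : height_of h S -> left_jump r S ->
  height_of (lower r h) (flip r S).
Proof.
move=> hS rS x; rewrite (lowerE r hS) rS !andbT in_flip.
have := hS x; rewrite residue_pred -(residue_eq n_gt1 x).
move: rS => /andP[r0 r1].
have := nxt_neq n_gt1 r; rewrite eq_sym => nr.
case: eqVneq => [->|_]; first by rewrite eq_sym (negPf nr) r1 (negPf r0) /=; lia.
by case: eqVneq => [->|_]; rewrite ?r1 ?(negPf r0) /= ?subr0 //; lia.
Qed.

Lemma height_exists S : exists h, height_of h S.
Proof.
(* Each term of the sum is a staircase that goes up by 1 at the sites congruent to [s]. *)
exists (fun x => - \sum_(s in S) ((x - s%:Z) %/ n%:Z)%Z) => x.
have n0 : n%:Z != 0 by rewrite eqz_nat -lt0n (n_gt0 n_gt1).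
rewrite opprK addrC -sumrB.
have e (s : 'I_n) : ((x - s%:Z) %/ n%:Z)%Z - ((x - 1 - s%:Z) %/ n%:Z)%Z = (residue n_gt1 x == s)%:Z.
  rewrite residue_eq; case: (boolP (x ≡ s%:Z)) => [/eqzmodP[k ->]|xs].
    have -> : s%:Z + n%:Z * k - s%:Z = k * n%:Z by ring.
    have -> : s%:Z + n%:Z * k - 1 - s%:Z = (k - 1) * n%:Z + (n%:Z - 1) by ring.
    rewrite mulzK // divzMDl // divz_small; last by have := n_gt1; lia.
    lia.
  rewrite eqz_mod_dvd in xs; have := divz_succ n_gt1 (d := x - 1 - s%:Z).
  have -> : x - 1 - s%:Z + 1 = x - s%:Z by lia.
  by move=> -> //; rewrite subrr.
under eq_bigr do rewrite e.
have [xS|xS] := boolP (residue n_gt1 x \in S).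
  rewrite (bigD1 _ xS) /= eqxx big1 ?addr0 // => s /andP[_ /negPf h].
  by rewrite eq_sym h.
rewrite big1 // => s sS; case: eqP => // e'; by rewrite e' sS in xS.
Qed.

(* The monotone coupling: both kinds of jumps are monotone maps of heights. *)
Fixpoint volume (i : nat) h : R :=
  if i is j.+1 then
    volume j h * (1 - (1 + q) / 2)
    + (2 * n%:R)^-1 * \sum_r (volume j (raise r h) + q * volume j (lower r h))
  else \sum_(r < n) (h r%:Z)%:~R.

Lemma volume_mono i h h' : (forall x, h x <= h' x) -> volume i h <= volume i h'.
Proof.
have /andP[q0 q1] := q01.
elim: i h h' => [|i IH] h h' hh /=; first by apply: ler_sum => r _; rewrite ler_int.
apply: lerD; first by rewrite ler_wpM2r ?IH //; lra.
rewrite ler_wpM2l ?invr_ge0 ?mulr_ge0 //; apply: ler_sum => r _; apply: lerD.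
  apply: IH => x; rewrite /raise; case: ifP => // _.
  have := hh (x - 1); have := hh (x + 1); lia.
rewrite ler_wpM2l //; apply: IH => x; rewrite /lower; case: ifP => // _.
have := hh (x - 1); have := hh (x + 1); lia.
Qed.

Lemma correctorS m S : corrector m.+1 S = drift S + step (corrector m) S.
Proof.
rewrite /corrector big_ord_recl /=; congr (_ + _).
elim: m S => [|m IH] S.
  rewrite big_ord0 /step /gen big_ord0 add0r big1 ?mulr0 // => r _.
  by rewrite !big_ord0 subrr mulr0.
rewrite big_ord_recr IH /= /step big_ord_recr /= -!addrA; congr (_ + _).
rewrite addrCA; congr (_ + _); rewrite -mulrDr; congr (_ * _).
rewrite /gen -big_split; apply: eq_bigr => r _ /=.
by rewrite -mulrDr !big_ord_recr /=; congr (_ * _); ring.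
Qed.

Lemma sum_indicator r : \sum_(i < n) ((i%:Z ≡ r%:Z)%:Z)%:~R = 1 :> R.
Proof.
rewrite (bigD1 r) //= eqxx big1 ?addr0 // => i ir.
by rewrite -(residue_eq n_gt1) residue_ord (negPf ir).
Qed.

(** The expected total height after [i] steps is the initial one plus the expected displacement
    collected on the way, and the latter, [corrector i S], depends on [h] only through [S]. *)
Lemma volumeE i h S : height_of h S -> volume i h = volume 0 h + corrector i S.
Proof.
have n0 := n_gt0R R n_gt1.
elim: i h S => [|i IH] h S hS; first by rewrite /corrector big_ord0 addr0.
have up r : volume i (raise r h) = volume i h
    + (right_jump r S)%:R * (1 + corrector i (flip r S) - corrector i S).
  have [rS|rS] := boolP (right_jump r S); last first.
    rewrite mul0r addr0; congr volume; rewrite (raiseE r hS) (negPf rS).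
    by apply/funext => x; rewrite andbF addr0.
  rewrite (IH _ _ (height_raise hS rS)) (IH _ _ hS) mul1r /=.
  suff -> : \sum_(s < n) (raise r h s%:Z)%:~R = \sum_(s < n) (h s%:Z)%:~R + 1 :> R by ring.
  rewrite (raiseE r hS) rS -[X in _ = _ + X](sum_indicator r) -big_split; apply: eq_bigr => s _ /=.
  by rewrite andbT intrD.
have dn r : volume i (lower r h) = volume i h
    + (left_jump r S)%:R * (- 1 + corrector i (flip r S) - corrector i S).
  have [rS|rS] := boolP (left_jump r S); last first.
    rewrite mul0r addr0; congr volume; rewrite (lowerE r hS) (negPf rS).
    by apply/funext => x; rewrite andbF subr0.
  rewrite (IH _ _ (height_lower hS rS)) (IH _ _ hS) mul1r /=.
  suff -> : \sum_(s < n) (lower r h s%:Z)%:~R = \sum_(s < n) (h s%:Z)%:~R - 1 :> R by ring.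
  rewrite (lowerE r hS) rS -[X in _ = _ - X](sum_indicator r) -sumrB; apply: eq_bigr => s _ /=.
  by rewrite andbT intrB.
rewrite [LHS]/=; under eq_bigr do rewrite up dn.
rewrite correctorS /step /gen /drift -/(volume 0 h).
have -> : \sum_r (volume i h + (right_jump r S)%:R * (1 + corrector i (flip r S) - corrector i S)
     + q * (volume i h + (left_jump r S)%:R * (- 1 + corrector i (flip r S) - corrector i S)))
  = n%:R * ((1 + q) * volume i h)
   + (\sum_r ((right_jump r S)%:R - q * (left_jump r S)%:R)
    + \sum_r jump_rate n_gt1 q r S * (corrector i (flip r S) - corrector i S)).
  have -> : n%:R * ((1 + q) * volume i h) = \sum_(r < n) (1 + q) * volume i h.
    by rewrite sumr_const card_ord mulr_natl.
  by rewrite -!big_split; apply: eq_bigr => r _ /=; rewrite /jump_rate; ring.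
rewrite (IH _ _ hS); field; exact: lt0r_neq0.
Qed.

(** A left jump lowers the height function, so by monotonicity of [volume] the expected total height
    after [m] steps cannot become larger. This is the sign that makes the exchange of two adjacent
    leaders favourable to their level. *)
Lemma corrector_left m r S : left_jump r S ->
  0 <= 1 + corrector m S - corrector m (flip r S).
Proof.
move=> rS; have [h hS] := height_exists S.
have : volume m (lower r h) <= volume m h.
  by apply: volume_mono => x; rewrite (lowerE r hS) gerBl; case: (_ && _).
rewrite (volumeE m hS) (volumeE m (height_lower hS rS)) /=.
have -> : \sum_(s < n) (lower r h s%:Z)%:~R = \sum_(s < n) (h s%:Z)%:~R - 1 :> R.
  rewrite (lowerE r hS) rS -[X in _ = _ - X](sum_indicator r) -sumrB; apply: eq_bigr => s _ /=.
  by rewrite andbT intrB.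
lra.
Qed.

(** Two recursions for [corrector m.+1], splitting off its last term or its first one
    ([correctorS]), make the sum telescope. *)
Lemma gen_corrector m S :
  \sum_r ((right_jump r S)%:R - q * (left_jump r S)%:R) + gen (corrector m) S
  = 2 * n%:R * iter m step drift S.
Proof.
have n0 := n_gt0R R n_gt1.
have : corrector m.+1 S = corrector m S + iter m step drift S.
  by rewrite /corrector big_ord_recr.
rewrite correctorS /step addrCA => /addrI; rewrite /drift -mulrDr => <-.
by rewrite mulVKf // mulf_neq0 ?gt_eqF.
Qed.

Definition current (K : nat) : R :=
  (1 - q) * (K%:R * (n%:R - K%:R)) / (n%:R - 1).

Lemma pair_count_perm K (s : {perm 'I_n}) i j :
  \sum_(S : {set 'I_n} | #|S| == K) ((s i \in S) && (s j \notin S))%:R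
  = \sum_(S : {set 'I_n} | #|S| == K) ((i \in S) && (j \notin S))%:R :> R.
Proof.
rewrite (reindex_inj (imset_inj (@perm_inj _ s))) /=; apply: eq_big => S.
  by rewrite card_imset //; exact: perm_inj.
by rewrite !(mem_imset _ _ (@perm_inj _ s)).
Qed.

(** All ordered pairs of distinct sites contribute equally by symmetry, and a set of size [K] has
    [K (n - K)] pairs with the first site inside and the second outside. *)
Lemma pair_count K i j : (K <= n)%N -> i != j ->
  \sum_(S : {set 'I_n} | #|S| == K) ((i \in S) && (j \notin S))%:R
  = 'C(n, K)%:R * (K%:R * (n%:R - K%:R)) / (n%:R * (n%:R - 1)) :> R.
Proof.
move=> Kn ij; pose N (a b : 'I_n) : R :=
  \sum_(S : {set 'I_n} | #|S| == K) ((a \in S) && (b \notin S))%:R.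
have n0 := n_gt0R R n_gt1.
have n1 : 0 < n%:R - 1 :> R by rewrite subr_gt0 ltr1n.
have Nij a b : a != b -> N a b = N i j.
  (* The permutation [s1 * s2] takes the pair [(i, j)] to [(a, b)], because [s2] fixes [a]. *)
  move=> ab; pose s1 := tperm i a; pose s2 := tperm (s1 j) b.
  have s2a : s2 a = a.
    rewrite /s2 tpermD // 1?eq_sym // -[a in X in X != _](tpermL i a).
    by rewrite (inj_eq perm_inj).
  rewrite /N -(pair_count_perm K (s1 * s2)%g i j) !permM /s1 tpermL -/s1 s2a.
  by rewrite /s2 tpermL.
have tot : \sum_a \sum_(b | b != a) N a b = 'C(n, K)%:R * (K%:R * (n%:R - K%:R)).
  transitivity (\sum_(S : {set 'I_n} | #|S| == K)
      \sum_a \sum_(b | b != a) (((a \in S) && (b \notin S))%:R : R)).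
    rewrite [RHS]exchange_big; apply: eq_bigr => a _ /=.
    by rewrite [RHS]exchange_big.
  have inner S : #|S| == K ->
      \sum_a \sum_(b | b != a) (((a \in S) && (b \notin S))%:R : R) = K%:R * (n%:R - K%:R).
    move=> /eqP SK.
    transitivity (\sum_(a : 'I_n) \sum_(b : 'I_n) ((a \in S)%:R * (b \notin S)%:R : R)).
      apply: eq_bigr => a _; rewrite [RHS](bigD1 a) //=.
      have -> : (a \in S)%:R * (a \notin S)%:R = 0 :> R by case: (a \in S); rewrite /= ?mulr0 ?mul0r.
      by rewrite add0r; apply: eq_bigr => b _; rewrite -natrM mulnb.
    under eq_bigr do rewrite -mulr_sumr.
    rewrite -mulr_suml -!natr_sum; congr (_%:R * _).
      by rewrite -SK -sum1_card [RHS]big_mkcond.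
    rewrite -[in RHS]SK -natrB ?card_set_le //; congr (_%:R).
    have -> : (n - #|S| = #|~: S|%SET)%N by have := cardsC S; rewrite card_ord; lia.
    rewrite -sum1_card [RHS]big_mkcond.
    by apply: eq_bigr => b _; rewrite inE.
  by rewrite (eq_bigr _ inner) sumr_const (card_level n K) -[LHS]mulr_natl.
have tot2 : \sum_a \sum_(b | b != a) N a b = n%:R * (n%:R - 1) * N i j.
  transitivity (\sum_(a < n) \sum_(b < n | b != a) N i j).
    by apply: eq_bigr => a _; apply: eq_bigr => b ba; rewrite Nij // eq_sym.
  under eq_bigr do rewrite sumr_const cardC1 card_ord.
  rewrite sumr_const card_ord -mulrnA -[LHS]mulr_natr natrM mulrC.
  by rewrite -subn1 natrB ?(n_gt0 n_gt1) // [n%:R * _]mulrC.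
have nn : n%:R * (n%:R - 1) != 0 :> R by rewrite mulf_neq0 ?gt_eqF.
by apply: (mulfI nn); rewrite -/(N i j) -tot2 tot [RHS]mulrC divfK.
Qed.

Lemma level_mean_drift K : (K <= n)%N ->
  level_mean drift K = (2 * n%:R)^-1 * current K.
Proof.
move=> Kn; have n0 := n_gt0R R n_gt1.
have n1 : 0 < n%:R - 1 :> R by rewrite subr_gt0 ltr1n.
have C0 : 'C(n, K)%:R != 0 :> R by rewrite pnatr_eq0 -lt0n bin_gt0.
rewrite /level_mean /drift -mulr_sumr -mulrA; congr (_ * _).
have -> : \sum_(S : {set 'I_n} | #|S| == K)
    \sum_r ((right_jump r S)%:R - q * (left_jump r S)%:R)
  = (1 - q) * \sum_r \sum_(S : {set 'I_n} | #|S| == K) (right_jump r S)%:R :> R.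
  rewrite [in RHS]exchange_big mulr_sumr; apply: eq_bigr => S _ /=.
  by rewrite sumrB -mulr_sumr -(sum_right_left R n_gt1 S) mulrBl mul1r.
under eq_bigr => r _ do rewrite (pair_count Kn) 1?eq_sym ?nxt_neq //.
rewrite sumr_const card_ord -[in LHS]mulr_natr /current.
by field; rewrite C0 !gt_eqF.
Qed.

Lemma corrector_exists (e : R) : 0 < e -> exists m, forall S,
  `|\sum_r ((right_jump r S)%:R - q * (left_jump r S)%:R) + gen (corrector m) S
    - current #|S| | <= e.
Proof.
move=> e0; have n0 := n_gt0R R n_gt1.
have n20 : 0 < 2 * n%:R :> R by rewrite mulr_gt0.
have [m h] := mixing n_gt1 q01 drift (divr_gt0 e0 n20).
exists m => S; have := h S; rewrite level_mean_drift ?card_set_le // => {}h.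
rewrite gen_corrector.
have -> : 2 * n%:R * iter m step drift S - current #|S|
  = (iter m step drift S - (2 * n%:R)^-1 * current #|S|) * (2 * n%:R).
  by field; rewrite gt_eqF.
by rewrite normrM (gtr0_norm n20) -ler_pdivlMr.
Qed.

End Drift.

(** * Leaders, levels and gaps *)

Section Levels.
Variables (n : nat) (n_gt1 : (1 < n)%N).
Implicit Types (w : affperm n) (r i j : 'I_n) (K : nat).

Local Notation nxt r := (residue n_gt1 (r%:Z + 1)).
Local Notation flip := (flip n_gt1).
Local Notation right_jump := (right_jump n_gt1).
Local Notation left_jump := (left_jump n_gt1).

Definition ahead w i : {set 'I_n} := [set j | pos w i < pos w j].

Lemma rank_lt w i : (#|ahead w i| < n)%N.
Proof.
rewrite -[X in (_ < X)%N](card_ord n) -cardsT; apply: proper_card.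
by apply/properP; split; [apply/fintype.subsetP|exists i; rewrite !inE ?ltxx].
Qed.

(** Ranks count from the right and start at 0: the foremost leader has rank 0. *)
Definition rank w i : 'I_n := Ordinal (rank_lt w i).

Lemma rankE w i j : (rank w i < rank w j)%N = (pos w j < pos w i).
Proof.
have h a b : pos w b < pos w a -> (rank w a < rank w b)%N.
  move=> ba; apply: proper_card; apply/properP; split.
    by apply/fintype.subsetP => x; rewrite !inE; exact: lt_trans.
  by exists a; rewrite !inE ?ltxx.
apply/idP/idP => [ij|]; last exact: h.
case: (ltrgtP (pos w j) (pos w i)) => // [/h ji|/(pos_inj n_gt1) e].
  by move: (ltn_trans ij ji); rewrite ltnn.
by move: ij; rewrite e ltnn.
Qed.

Lemma rank_inj w : injective (rank w).
Proof.
move=> i j e; case: (ltrgtP (pos w i) (pos w j)) => [|| /(pos_inj n_gt1) //];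
  by rewrite -rankE e ltnn.
Qed.

Definition rank_perm w : 'S_n := perm (@rank_inj w).

Definition leader w (k : 'I_n) : 'I_n := ((rank_perm w)^-1)%g k.

Lemma rank_leader w k : rank w (leader w k) = k.
Proof. by have := permKV (rank_perm w) k; rewrite permE. Qed.

Lemma leader_rank w i : leader w (rank w i) = i.
Proof. by apply: (@rank_inj w); rewrite rank_leader. Qed.

Definition top K w : {set 'I_n} := [set i | (rank w i < K)%N].

Definition top_sum K w : int := \sum_(i in top K w) pos w i.

Definition top_set K w : {set 'I_n} := [set residue n_gt1 (pos w i) | i in top K w].

Lemma residue_pos_inj w : injective (fun i => residue n_gt1 (pos w i)).
Proof. by move=> i j /eqP; rewrite residue_mod => /(pos_mod_inj n_gt1). Qed.

Lemma mem_top_set K w i : (residue n_gt1 (pos w i) \in top_set K w) = (i \in top K w).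
Proof. exact: (mem_imset _ _ (@residue_pos_inj w)). Qed.

Lemma card_top K w : (K <= n)%N -> #|top K w| = K.
Proof.
move=> Kn; rewrite -[LHS](card_imset _ (@rank_inj w)) -[RHS](card_initial Kn).
apply: eq_card => x; rewrite !inE; apply/imsetP/idP => [[i]|xK].
  by rewrite inE => iK ->.
by exists (leader w x); rewrite ?inE rank_leader.
Qed.

Lemma card_top_set K w : (K <= n)%N -> #|top_set K w| = K.
Proof. by move=> Kn; rewrite card_imset ?card_top //; exact: residue_pos_inj. Qed.

Lemma top_sumS w (k : 'I_n) : top_sum k.+1 w = top_sum k w + pos w (leader w k).
Proof.
have h : leader w k \in top k.+1 w by rewrite inE rank_leader.
rewrite /top_sum (big_setD1 _ h) /= addrC; congr (_ + _); apply: eq_bigl => i.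
rewrite !inE ltnS leq_eqVlt andb_orr andbC.
have -> : (rank w i == k :> nat) = (i == leader w k).
  by rewrite -(inj_eq (@rank_inj w)) rank_leader.
by case: eqVneq => [->|_]; rewrite ?rank_leader ?ltnn /= ?orbF.
Qed.

Lemma leader_lt w (j k : 'I_n) : (j < k)%N -> pos w (leader w k) < pos w (leader w j).
Proof. by rewrite -rankE !rank_leader. Qed.

(** For [0 < K < n] this second difference is the distance between the K-th and the (K+1)-st leader,
    see [gapE]; in this form drifts of level sums pass to gaps by linearity. *)
Definition gap K w : int := 2 * top_sum K w - top_sum K.-1 w - top_sum K.+1 w.

Lemma gapE w (j k : 'I_n) : k = j.+1 :> nat ->
  gap k w = pos w (leader w j) - pos w (leader w k).
Proof. by move=> kj; rewrite /gap top_sumS kj /= top_sumS; ring. Qed.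

Lemma gap_ge1 K w : (0 < K < n)%N -> 1 <= gap K w.
Proof.
move=> /andP[K0 Kn]; have K1 : (K.-1 < n)%N by lia.
rewrite (@gapE w (Ordinal K1) (Ordinal Kn)) /=; last by lia.
have := @leader_lt w (Ordinal K1) (Ordinal Kn); rewrite /=; lia.
Qed.

(** The K-th leader is not to the right of [j] and the next one is not to the left of [i], so the
    positive distance between them is squeezed to 1. *)
Lemma gap1 K w i j : j \in top K w -> i \notin top K w -> pos w j = pos w i + 1 ->
  (0 < K < n)%N /\ gap K w = 1.
Proof.
rewrite !inE -leqNgt => jK Ki e.
have Kb : (0 < K < n)%N by have := ltn_ord (rank w i); lia.
split=> //; apply/eqP; rewrite eq_le gap_ge1 // andbT.
case/andP: Kb => K0 Kn; have K1 : (K.-1 < n)%N by lia.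
rewrite (@gapE w (Ordinal K1) (Ordinal Kn)) /=; last by lia.
have h1 : pos w (leader w (Ordinal K1)) <= pos w j.
  rewrite leNgt -rankE rank_leader -leqNgt -[(_ <= _)%N]/(rank w j <= K.-1)%N; lia.
have h2 : pos w i <= pos w (leader w (Ordinal Kn)).
  by rewrite leNgt -rankE rank_leader -leqNgt.
lia.
Qed.

Lemma residue_refl r (x : int) :
  residue n_gt1 (simple_refl r x) = tperm r (nxt r) (residue n_gt1 x).
Proof.
case: (reflP r x) => [h|h|h h'].
- by rewrite (residue_nxt n_gt1 h); move: h; rewrite -(residue_eq n_gt1) => /eqP ->; rewrite tpermL.
- move: (h); rewrite -(residue_mod n_gt1) => /eqP ->; rewrite tpermR.
  by apply/eqP; rewrite residue_eq -(eqmod_add2r n 1) subrK.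
- rewrite tpermD // eq_sym; last by rewrite residue_mod.
  by rewrite residue_eq.
Qed.

Lemma pos_edge w r i j k x : edge w r i j k ->
  pos (right_mul w r) x = pos w x + (x == i)%:Z - (x == j)%:Z.
Proof.
move=> [ij _ _ _ up dn fx].
have [->|xi] := eqVneq x i; first by rewrite (negPf ij) up subr0.
have [->|xj] := eqVneq x j; first by rewrite dn addr0.
by rewrite fx // addr0 subr0.
Qed.

(** Only [i] behind [j] can approach each other by two, and for [k != 0] their distance is then more
    than [n]. Every other pair approaches by at most one, and leaders never share a site. *)
Lemma pos_lt_edge w r i j k : edge w r i j k -> k != 0 ->
  forall a b, (pos (right_mul w r) a < pos (right_mul w r) b) = (pos w a < pos w b).
Proof.
move=> e k0; have [ij _ jr _ up dn _] := e.
have one a b : pos w a < pos w b -> pos (right_mul w r) a < pos (right_mul w r) b.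
  move=> ab; have abn : a != b by apply: contraTneq ab => ->; rewrite ltxx.
  have : pos (right_mul w r) a != pos (right_mul w r) b.
    by rewrite (inj_eq (@pos_inj n n_gt1 _)).
  have [/andP[/eqP ai /eqP bj]|] := boolP ((a == i) && (b == j)).
    rewrite ai bj up dn jr; move: ab; rewrite ai bj jr => h _.
    have : n%:Z <= n%:Z * k by nia.
    by have := n_gt1; lia.
  rewrite !(pos_edge _ e); move: ab.
  by case: (a == i); case: (b == j); case: (a == j); case: (b == i) => //=; lia.
move=> a b; apply/idP/idP; last exact: one.
case: (ltrgtP (pos w a) (pos w b)) => // [/one|/(pos_inj n_gt1) ->]; last by rewrite ltxx.
by move=> h1 h2; have := lt_trans h1 h2; rewrite ltxx.
Qed.

Lemma rank_edge w r i j k : edge w r i j k -> k != 0 -> rank (right_mul w r) = rank w.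
Proof.
move=> e k0; apply/funext => x; apply/ord_inj/eq_card => y.
by rewrite !inE (pos_lt_edge e k0).
Qed.

Lemma pos_swap w r i j : edge w r i j 0 ->
  forall x, pos (right_mul w r) x = pos w (tperm i j x).
Proof.
move=> [ij _ jr _ up dn fx] x; case: tpermP => [->|->|/eqP xi /eqP xj].
- by rewrite up jr mulr0 addr0.
- by rewrite dn jr mulr0 addr0 addrK.
- exact: fx.
Qed.

Lemma rank_swap w r i j : edge w r i j 0 ->
  forall x, rank (right_mul w r) x = rank w (tperm i j x).
Proof.
move=> e x; apply/ord_inj => /=.
rewrite -(card_imset _ (@perm_inj _ (tperm i j))); apply: eq_card => y.
rewrite inE; apply/imsetP/idP => [[z]|yx].
  by rewrite inE !(pos_swap e) => h ->.
by exists (tperm i j y); rewrite ?inE ?(pos_swap e) tpermK.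
Qed.

Lemma top_sum_edge K w r i j k : edge w r i j k -> k != 0 ->
  top_sum K (right_mul w r) = top_sum K w + (i \in top K w)%:Z - (j \in top K w)%:Z.
Proof.
move=> e k0; have [ij _ _ _ up dn fx] := e.
have -> : top_sum K (right_mul w r) = \sum_(x in top K w) pos (right_mul w r) x.
  by apply: eq_bigl => x; rewrite !inE (rank_edge e k0).
have ind y : \sum_(x in top K w) (x == y)%:Z = (y \in top K w)%:Z.
  have [yK|yK] := boolP (y \in top K w).
    by rewrite (bigD1 y) //= eqxx big1 ?addr0 // => x /andP[_ /negPf ->].
  by rewrite big1 // => x xK; case: eqP yK => // <-; rewrite xK.
by under eq_bigr do rewrite (pos_edge _ e); rewrite sumrB big_split /= !ind.
Qed.

Lemma top_set_edge K w r i j k : edge w r i j k -> k != 0 ->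
  top_set K (right_mul w r) = flip r (top_set K w).
Proof.
move=> e k0; have tE : top K (right_mul w r) = top K w.
  by apply/setP => x; rewrite !inE (rank_edge e k0).
apply/setP => x; rewrite inE /top_set tE; apply/imsetP/imsetP => -[y yK].
  move=> ->; exists y => //; by rewrite pos_right_mul // residue_refl tpermK.
move=> ey; exists y => //; by rewrite pos_right_mul // residue_refl -ey tpermK.
Qed.

Lemma top_sum_swap K w r i j : edge w r i j 0 -> top_sum K (right_mul w r) = top_sum K w.
Proof.
move=> e; rewrite /top_sum [RHS](reindex_inj (@perm_inj _ (tperm i j))) /=.
by apply: eq_big => [x|x _]; rewrite ?inE ?(rank_swap e) ?(pos_swap e).
Qed.

Lemma top_set_swap K w r i j : edge w r i j 0 -> top_set K (right_mul w r) = top_set K w.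
Proof.
move=> e; apply/setP => x; apply/imsetP/imsetP => -[y]; rewrite inE => yK ->.
  by exists (tperm i j y); rewrite ?inE -?(rank_swap e) ?(pos_swap e).
by exists (tperm i j y); rewrite ?inE ?(rank_swap e) ?(pos_swap e) tpermK.
Qed.

(* The third case is the only deviation from the exclusion process on the ring:
   the would-be left jump exchanges two adjacent leaders instead. *)
Lemma level_step K w r : let S := top_set K w in let w' := right_mul w r in
  [\/ [/\ right_jump r S, top_set K w' = flip r S, top_sum K w' = top_sum K w + 1
        & w r%:Z < w (r%:Z + 1)],
      [/\ left_jump r S, top_set K w' = flip r S, top_sum K w' = top_sum K w - 1
        & ~~ (w r%:Z < w (r%:Z + 1))],
      [/\ left_jump r S, top_set K w' = S, top_sum K w' = top_sum K w
        & (0 < K < n)%N /\ gap K w = 1] |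
      [/\ ~~ right_jump r S, ~~ left_jump r S, top_set K w' = S
        & top_sum K w' = top_sum K w]].
Proof.
move=> S w'; have [i [j [k e]]] := edge_exists n_gt1 w r.
have [ij il jr asc _ _ _] := e.
have ri : residue n_gt1 (pos w i) = r by apply/eqP; rewrite residue_eq.
have rj : residue n_gt1 (pos w j) = nxt r.
  apply/eqP; rewrite residue_mod jr eqmodDn eqmod_add2r //.
have iS : (r \in S) = (i \in top K w) by rewrite -mem_top_set ri.
have jS : (nxt r \in S) = (j \in top K w) by rewrite -mem_top_set rj.
have topP a b : a \in top K w -> b \notin top K w -> pos w b < pos w a.
  by rewrite !inE -rankE -leqNgt => h1 h2; exact: leq_trans h1 h2.
(* For [k = 0] the two leaders are neighbours: they trade places, and the set of the K foremost
   sites stays the same. *)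
have [k0|k0] := eqVneq k 0.
  subst k; move: jr; rewrite mulr0 addr0 => jr.
  have nr : ~~ right_jump r S.
    rewrite /right_jump iS jS; apply/negP => /andP[h1 h2].
    by have := topP _ _ h1 h2; lia.
  have [lS|lS] := boolP (left_jump r S).
    apply: Or43; split; rewrite ?(top_set_swap K e) ?(top_sum_swap K e) //.
    by move: lS; rewrite /left_jump iS jS => /andP[h1 h2]; apply: gap1 h2 h1 jr.
  by apply: Or44; split; rewrite ?(top_set_swap K e) ?(top_sum_swap K e).
have TS := top_set_edge K e k0; have TC := top_sum_edge K e k0.
have [rS|rS] := boolP (right_jump r S).
  have := rS; rewrite /right_jump iS jS => /andP[h1 h2].
  apply: Or41; split; rewrite // ?TC ?h1 ?(negPf h2) ?subr0 //.
  (* A foremost leader lies to the right of the other one, which forces [k < 0]: the move is an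
     ascent of [w]. *)
  rewrite asc; have := topP _ _ h1 h2; rewrite jr => h3.
  have -> : k < 0 by nia.
  by [].
have [lS|lS] := boolP (left_jump r S).
  have := lS; rewrite /left_jump iS jS => /andP[h1 h2].
  apply: Or42; split; rewrite // ?TC ?h2 ?(negPf h1) ?addr0 //.
  rewrite asc (negPf k0) /= orbF; have := topP _ _ h2 h1; rewrite jr => h3.
  by rewrite -leNgt; nia.
have eS : (r \in S) = (nxt r \in S).
  by move: rS lS; rewrite /right_jump /left_jump; case: (r \in S); case: (_ \in S).
apply: Or44; split=> //; first by rewrite TS flip_id.
by rewrite TC -iS eS jS addrK.
Qed.

(** The order can change only on an edge with [k = 0]. Its two leaders are then adjacent, and the
    gap of index [rank w i] is 1. *)
Lemma rank_const w r : (forall K, (0 < K < n)%N -> gap K w != 1) ->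
  rank (right_mul w r) = rank w.
Proof.
move=> h; have [i [j [k e]]] := edge_exists n_gt1 w r.
have [k0|k0] := eqVneq k 0; last exact: (rank_edge e k0).
exfalso; subst k; have [_ _ jr _ _ _ _] := e.
move: jr; rewrite mulr0 addr0 => jr.
have ji : j \in top (rank w i) w by rewrite inE rankE jr; lia.
have ii : i \notin top (rank w i) w by rewrite inE ltnn.
have [Kb g1] := gap1 ji ii jr.
by have := h _ Kb; rewrite g1.
Qed.

End Levels.

(** * The Lyapunov function *)

Section Lyapunov.
Variables (R : realType) (n : nat) (n_gt1 : (1 < n)%N) (q : R).
Hypothesis q01 : 0 <= q < 1.
Implicit Types (w : affperm n) (r : 'I_n) (K : nat) (S : {set 'I_n}).

Local Notation flip := (flip n_gt1).
Local Notation right_jump := (right_jump n_gt1).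
Local Notation left_jump := (left_jump n_gt1).
Local Notation gen := (gen n_gt1 q).
Local Notation top_set := (top_set n_gt1).
Local Notation current := (current n q).

Let q01' : 0 <= q <= 1. Proof. by case/andP: q01 => -> /ltW. Qed.

Definition genw (f : affperm n -> R) w : R :=
  \sum_r rate q w r * (f (right_mul w r) - f w).

Lemma rate_ge0 w r : 0 <= rate q w r.
Proof. by rewrite /rate; case: ifP => // _; case/andP: q01. Qed.

Lemma rate_le1 w r : rate q w r <= 1.
Proof. by rewrite /rate; case: ifP => // _; case/andP: q01'. Qed.

Lemma sum_rate w : \sum_r rate q w r <= n%:R.
Proof.
have -> : n%:R = \sum_(r < n) (1 : R) by rewrite sumr_const card_ord.
by apply: ler_sum => r _; exact: rate_le1.
Qed.

Lemma genwD f g w : genw (fun w => f w + g w) w = genw f w + genw g w.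
Proof. by rewrite /genw -big_split; apply: eq_bigr => r _ /=; ring. Qed.

Lemma genwZ a f w : genw (fun w => a * f w) w = a * genw f w.
Proof. by rewrite /genw mulr_sumr; apply: eq_bigr => r _ /=; ring. Qed.

Lemma genw_sum (s : seq nat) (f : nat -> affperm n -> R) w :
  genw (fun w => \sum_(K <- s) f K w) w = \sum_(K <- s) genw (f K) w.
Proof.
elim: s => [|K s IH].
  by rewrite big_nil /genw big1 // => r _; rewrite !big_nil subrr mulr0.
rewrite big_cons -IH -genwD; congr (genw _ w); apply/funext => x; exact: big_cons.
Qed.

(** From [1 - z <= expR (- z)] by taking inverses. *)
Lemma expR_le2 (z : R) : `|z| <= 1 / 2 -> expR z <= 1 + z + 2 * z ^+ 2.
Proof.
rewrite ler_norml => /andP[z1 z2].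
have h := expR_ge1Dx (- z); have h0 : 0 < 1 + - z by lra.
rewrite -[z]opprK expRN opprK; apply: le_trans (_ : (1 + - z)^-1 <= _).
  by rewrite lef_pV2 ?posrE ?expR_gt0.
rewrite invf_ple ?posrE //; last by have := sqr_ge0 z; lra.
rewrite -div1r ler_pdivrMr; last by have := sqr_ge0 z; lra.
have := sqr_ge0 z; rewrite expr2 => z3; nra.
Qed.

(** Second-order expansion of the exponential of a jump of size at most [d]; there are [n] jumps of
    rate at most 1. *)
Lemma genw_expR (Y : affperm n -> R) (d : R) w :
  (forall r, `|Y (right_mul w r) - Y w| <= d) -> d <= 1 / 2 ->
  genw (fun w => expR (Y w)) w <= expR (Y w) * (genw Y w + 2 * n%:R * d ^+ 2).
Proof.
move=> Yd d2; have d0 : 0 <= d by apply: le_trans (Yd (Ordinal (n_gt0 n_gt1))).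
rewrite /genw; have -> : 2 * n%:R * d ^+ 2 = \sum_(r < n) 2 * d ^+ 2.
  by rewrite sumr_const card_ord mulrAC mulr_natr.
rewrite -big_split mulr_sumr; apply: ler_sum => r _ /=.
have h := expR_le2 (le_trans (Yd r) d2); have ad := Yd r.
have -> : expR (Y (right_mul w r)) = expR (Y w) * expR (Y (right_mul w r) - Y w).
  by rewrite -expRD addrC subrK.
move: h ad; set a := Y _ - Y w => h ad; have E := expR_gt0 (Y w).
have -> : expR (Y w) * expR a - expR (Y w) = expR (Y w) * (expR a - 1) by ring.
rewrite mulrCA ler_pM2l //.
have a2 : a ^+ 2 <= d ^+ 2 by rewrite -real_normK ?num_real // lerXn2r ?nnegrE.
apply: le_trans (_ : rate q w r * (a + 2 * a ^+ 2) <= _).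
  by rewrite ler_wpM2l ?rate_ge0 //; lra.
rewrite mulrDr lerD2l; have := rate_le1 w r; have := rate_ge0 w r.
have := sqr_ge0 a; nra.
Qed.

Section Corrected.
Variables (psi : {set 'I_n} -> R) (e B : R).
Hypothesis psi_drift : forall S,
  `|\sum_r ((right_jump r S)%:R - q * (left_jump r S)%:R) + gen psi S - current #|S| | <= e.
Hypothesis psi_left : forall r S, left_jump r S -> 0 <= 1 + psi S - psi (flip r S).
Hypothesis psi_bound : forall S, `|psi S| <= B.

Definition corrected K w : R := (top_sum K w)%:~R + psi (top_set K w).

Definition stuck K w r := left_jump r (top_set K w) && (top_set K (right_mul w r) == top_set K w).

(** The drift that [corrected K] gains because a left jump, worth [- 1 + psi (flip r S) - psi S], is
    replaced by an exchange of adjacent leaders, worth 0. *)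
Definition excess K w : R :=
  \sum_r q * (stuck K w r)%:R * (1 + psi (top_set K w) - psi (flip r (top_set K w))).

Lemma flip_neq r S : left_jump r S -> flip r S != S.
Proof.
move=> /andP[r0 r1]; apply: contra r0 => /eqP <-.
by rewrite in_flipl.
Qed.

Lemma right_not_left r S : right_jump r S -> left_jump r S = false.
Proof. by rewrite /right_jump /left_jump => /andP[-> _]. Qed.

Lemma stuck_gap K w r : stuck K w r -> (0 < K < n)%N /\ gap K w = 1.
Proof.
move=> /andP[lS /eqP tS].
have [[rS _ _ _]|[_ tS' _ _]|[]//|[_ h _ _]] := level_step n_gt1 K w r.
- by rewrite (right_not_left rS) in lS.
- by have := flip_neq lS; rewrite -tS' tS eqxx.
- by rewrite lS in h.
Qed.

Lemma genw_corrected K w : genw (corrected K) w =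
  \sum_r ((right_jump r (top_set K w))%:R - q * (left_jump r (top_set K w))%:R)
  + gen psi (top_set K w) + excess K w.
Proof.
rewrite /genw /gen /excess -!big_split; apply: eq_bigr => r _ /=.
rewrite /corrected /jump_rate /rate /stuck.
have [[rS -> -> ->]|[lS -> -> /negPf ->]|[lS -> -> _]|[/negPf-> /negPf-> -> ->]]
  := level_step n_gt1 K w r.
- by rewrite (right_not_left rS) rS intrD /=; ring.
- have -> : right_jump r (top_set K w) = false.
    by apply/negP => /right_not_left; rewrite lS.
  by rewrite lS (negPf (flip_neq lS)) intrB /=; ring.
- have -> : right_jump r (top_set K w) = false.
    by apply/negP => /right_not_left; rewrite lS.
  by rewrite lS eqxx /=; ring.
- by rewrite /=; ring.
Qed.

Lemma excess_ge0 K w : 0 <= excess K w.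
Proof.
apply: sumr_ge0 => r _; rewrite /stuck; have [lS|_] := boolP (left_jump r _).
  by rewrite mulr_ge0 ?psi_left // mulr_ge0 //; case/andP: q01.
by rewrite mulr0 mul0r.
Qed.

Lemma B_ge0 : 0 <= B.
Proof. exact: le_trans (psi_bound finset.set0). Qed.

Lemma excess_le K w : excess K w <= n%:R * (1 + 2 * B).
Proof.
have -> : n%:R * (1 + 2 * B) = \sum_(r < n) (1 + 2 * B).
  by rewrite sumr_const card_ord mulr_natl.
have B0 := B_ge0.
apply: ler_sum => r _; case: (stuck K w r) => /=; last by rewrite mulr0 mul0r; lra.
have := psi_bound (top_set K w); have := psi_bound (flip r (top_set K w)).
rewrite !ler_norml mulr1 => /andP[? ?] /andP[? ?]; have /andP[? ?] := q01; nra.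
Qed.

Lemma excess_eq0 K w : ~~ ((0 < K < n)%N && (gap K w == 1)) -> excess K w = 0.
Proof.
move=> h; apply: big1 => r _; have [/stuck_gap[h1 h2]|] := boolP (stuck K w r).
  by rewrite h1 h2 eqxx in h.
by rewrite mulr0 mul0r.
Qed.

Lemma corrected_jump K w r : `|corrected K (right_mul w r) - corrected K w| <= 1 + 2 * B.
Proof.
have h1 := psi_bound (top_set K (right_mul w r)); have h2 := psi_bound (top_set K w).
have h3 : `|(top_sum K (right_mul w r))%:~R - (top_sum K w)%:~R| <= 1 :> R.
  have [[_ _ -> _]|[_ _ -> _]|[_ _ -> _]|[_ _ _ ->]] := level_step n_gt1 K w r.
  - by rewrite intrD addrAC subrr add0r normr1.
  - by rewrite intrB addrAC subrr add0r normrN normr1.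
  - by rewrite subrr normr0.
  - by rewrite subrr normr0.
move: h1 h2 h3; rewrite /corrected !ler_norml.
move=> /andP[? ?] /andP[? ?] /andP[? ?]; apply/andP; split; lra.
Qed.

Lemma genw_corrected_ge K w : (K <= n)%N -> current K - e + excess K w <= genw (corrected K) w.
Proof.
move=> Kn; rewrite genw_corrected lerD2r; have := psi_drift (top_set K w).
by rewrite card_top_set // ler_norml => /andP[h _]; lra.
Qed.

Lemma genw_corrected_le K w : (K <= n)%N -> genw (corrected K) w <= current K + e + excess K w.
Proof.
move=> Kn; rewrite genw_corrected lerD2r; have := psi_drift (top_set K w).
by rewrite card_top_set // ler_norml => /andP[_ h]; lra.
Qed.

Definition cgap K w : R := 2 * corrected K w - corrected K.-1 w - corrected K.+1 w.

Lemma cgap_near K w : `|cgap K w - (gap K w)%:~R| <= 4 * B.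
Proof.
have h1 := psi_bound (top_set K w); have h2 := psi_bound (top_set K.-1 w).
have h3 := psi_bound (top_set K.+1 w).
rewrite /cgap /gap /corrected !intrB intrM.
have -> : 2%:~R = 2 :> R by [].
move: h1 h2 h3; rewrite !ler_norml.
move=> /andP[? ?] /andP[? ?] /andP[? ?]; apply/andP; split; lra.
Qed.

Lemma cgap_jump K w r : `|cgap K (right_mul w r) - cgap K w| <= 4 * (1 + 2 * B).
Proof.
have h1 := corrected_jump K w r; have h2 := corrected_jump K.-1 w r.
have h3 := corrected_jump K.+1 w r.
move: h1 h2 h3; rewrite /cgap !ler_norml.
move=> /andP[? ?] /andP[? ?] /andP[? ?]; apply/andP; split; lra.
Qed.

Lemma genw_cgap K w : genw (cgap K) w =
  2 * genw (corrected K) w - genw (corrected K.-1) w - genw (corrected K.+1) w.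
Proof.
rewrite /genw mulr_sumr -!sumrB; apply: eq_bigr => r _; rewrite /cgap; ring.
Qed.

(** Minus the second difference of [current], which does not depend on [K] because [current] is
    quadratic in [K] ([curvatureE]). *)
Definition curvature : R := 2 * (1 - q) / (n%:R - 1).

Lemma curvature_gt0 : 0 < curvature.
Proof.
have /andP[q0 q1] := q01; rewrite divr_gt0 ?mulr_gt0 ?subr_gt0 //.
by rewrite ltr1n.
Qed.

Lemma curvatureE K : (0 < K)%N ->
  2 * current K - current K.-1 - current K.+1 = curvature.
Proof.
case: K => // K _; rewrite /current /curvature /= -!natr1.
by field; rewrite subr_eq0 (eqr_nat R n 1); case: (n) n_gt1 => [|[]].
Qed.

(** [th_small1] keeps the exponents within the range of [expR_le2]. By [th_small2] the errors of
    order [th ^+ 2], from the expansion and from [sum_excess], consume at most half of the drift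
    [th * curvature / 2]. *)
Variable th : R.
Hypothesis th_gt0 : 0 < th.
Hypothesis e_small : e <= curvature / 8.
Hypothesis th_small1 : th * (4 * (1 + 2 * B)) <= 1 / 2.
Hypothesis th_small2 :
  th * (32 * B * (n%:R * (1 + 2 * B)) + 2 * n%:R * (4 * (1 + 2 * B)) ^+ 2) <= curvature / 4.

Definition weight K w : R := expR (- (th * cgap K w)).

(* [current] is strictly concave in [K], so the corrected gaps have drift at
   least [curvature] up to a bounded error that pushes adjacent leaders apart;
   hence exponentials of small negative multiples of them decay on average. *)
Definition lyap w : R := \sum_(1 <= K < n) weight K w.

(** A gap of 1 is the smallest possible one, so the weight of [K] is the largest, up to the bounded
    corrections of the gaps. *)
Lemma weight_near K K' w : (0 < K < n)%N -> gap K w = 1 -> (0 < K' < n)%N ->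
  weight K' w <= (1 + 16 * th * B) * weight K w.
Proof.
move=> Kb g1 Kb'; have B0 := B_ge0.
have h1 := cgap_near K w; have h2 := cgap_near K' w.
have : (1 : R) <= (gap K' w)%:~R by rewrite -[1]/(1%:~R) ler_int gap_ge1.
move: h1 h2; rewrite g1 !ler_norml => /andP[h1 h2] /andP[h3 h4] h5.
have h6 : - (th * cgap K' w) <= 8 * th * B + - (th * cgap K w).
  have : th * (cgap K w - cgap K' w) <= th * (8 * B).
    by rewrite ler_pM2l //; move: h2 h3 h5; rewrite -[1%:~R]/(1 : R); lra.
  by rewrite mulrBr; lra.
rewrite /weight; apply: le_trans (_ : expR (8 * th * B + - (th * cgap K w)) <= _).
  by rewrite ler_expR.
rewrite expRD ler_pM2r ?expR_gt0 //.
have thB : 0 <= th * B by rewrite mulr_ge0 // ltW.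
have tB : 0 <= 8 * th * B <= 1 / 2.
  have h1' := th_small1; apply/andP; split; [lra|nra].
have : `|8 * th * B| <= 1 / 2 by rewrite ger0_norm; case/andP: tB.
move=> /expR_le2/le_trans; apply; case/andP: tB => ? ?; nra.
Qed.

(** Moving the shifts from the excess to the weights leaves, at [K], the weights of its neighbours.
    By [weight_near] each is at most [1 + 16 th B] times the weight of [K], so the term
    [- 2 * excess K] cancels all but a part of relative order [th]. *)
Lemma sum_excess w :
  \sum_(1 <= K < n) weight K w * (excess K.-1 w + excess K.+1 w - 2 * excess K w)
  <= 32 * th * B * (n%:R * (1 + 2 * B)) * lyap w.
Proof.
have B0 := B_ge0; have thB : 0 <= th * B by rewrite mulr_ge0 // ltW.
have c0 : 0 <= 1 + 16 * th * B by lra.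
have W0 K : 0 <= weight K w by rewrite expR_ge0.
have near K K' : (0 < K < n)%N -> (0 < K' < n)%N ->
    weight K' w * excess K w <= (1 + 16 * th * B) * (weight K w * excess K w).
  move=> Kb Kb'; have [g1|g1] := eqVneq (gap K w) 1; last first.
    by rewrite excess_eq0 ?mulr0 // (negPf g1) andbF.
  by rewrite mulrA ler_wpM2r ?excess_ge0 // weight_near.
have zero K : ~~ (0 < K < n)%N -> excess K w = 0.
  by move=> h; rewrite excess_eq0 // (negPf h).
have lo : \sum_(1 <= K < n) weight K w * excess K.-1 w
    <= \sum_(1 <= K < n) (1 + 16 * th * B) * (weight K w * excess K w).
  have -> : \sum_(1 <= K < n) weight K w * excess K.-1 w
      = \sum_(0 <= K < n.-1) weight K.+1 w * excess K w.
    by have := n_gt1; case: (n) => // m _; rewrite big_add1.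
  have h : (0 < n.-1)%N by have := n_gt1; lia.
  (* Boundary terms of the shifts vanish: the levels 0 and [n] have no gap and no excess. *)
  rewrite big_ltn // zero ?mulr0 ?add0r //.
  rewrite [X in _ <= X](big_cat_nat (n := n.-1)) ?leq_pred //= ler_wpDr //.
    by apply: sumr_ge0 => K _; rewrite mulr_ge0 // mulr_ge0 ?excess_ge0.
  apply: ler_sum_nat => K /andP[K1 K2]; apply: near; lia.
have hi : \sum_(1 <= K < n) weight K w * excess K.+1 w
    <= \sum_(1 <= K < n) (1 + 16 * th * B) * (weight K w * excess K w).
  have -> : \sum_(1 <= K < n) weight K w * excess K.+1 w
      = \sum_(2 <= K < n.+1) weight K.-1 w * excess K w.
    by rewrite [RHS]big_add1.
  rewrite big_nat_recr //= zero ?ltnn ?andbF // mulr0 addr0.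
  rewrite [X in _ <= X]big_ltn // ler_wpDl //.
    by rewrite mulr_ge0 // mulr_ge0 ?excess_ge0.
  apply: ler_sum_nat => K /andP[K1 K2]; apply: near; lia.
apply: le_trans (_ : \sum_(1 <= K < n) 32 * th * B * (weight K w * excess K w) <= _).
  have -> : \sum_(1 <= K < n) weight K w * (excess K.-1 w + excess K.+1 w - 2 * excess K w)
     = \sum_(1 <= K < n) weight K w * excess K.-1 w
     + \sum_(1 <= K < n) weight K w * excess K.+1 w
     - \sum_(1 <= K < n) 2 * (weight K w * excess K w).
    by rewrite -big_split -sumrB; apply: eq_bigr => K _ /=; ring.
  have -> : \sum_(1 <= K < n) 32 * th * B * (weight K w * excess K w)
     = \sum_(1 <= K < n) (1 + 16 * th * B) * (weight K w * excess K w)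
     + \sum_(1 <= K < n) (1 + 16 * th * B) * (weight K w * excess K w)
     - \sum_(1 <= K < n) 2 * (weight K w * excess K w).
    by rewrite -big_split -sumrB; apply: eq_bigr => K _ /=; ring.
  by rewrite lerD2r lerD.
rewrite /lyap mulr_sumr; apply: ler_sum => K _.
rewrite -[X in _ <= X]mulrA; apply: ler_wpM2l; first by lra.
by rewrite mulrC ler_wpM2r // excess_le.
Qed.

Lemma genw_lyap w : genw lyap w <= - (th * curvature / 4) * lyap w.
Proof.
have B0 := B_ge0.
rewrite /lyap genw_sum.
apply: le_trans (_ : \sum_(1 <= K < n) (weight K w * (th * (excess K.-1 w + excess K.+1 w - 2 * excess K w))
    + (- (th * (curvature / 2)) + 2 * n%:R * (th * (4 * (1 + 2 * B))) ^+ 2) * weight K w) <= _).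
  apply: ler_sum_nat => K /andP[K1 K2].
  have J r : `|- (th * cgap K (right_mul w r)) - - (th * cgap K w)| <= th * (4 * (1 + 2 * B)).
    rewrite -opprD -mulrBr normrN normrM gtr0_norm // ler_pM2l //.
    exact: cgap_jump.
  apply: le_trans (genw_expR J th_small1) _.
  rewrite -/(weight K w).
  have -> : genw (fun w0 => - (th * cgap K w0)) w = - (th * genw (cgap K) w).
    by rewrite /genw mulr_sumr -sumrN; apply: eq_bigr => r _; ring.
  rewrite genw_cgap.
  have h1 := @genw_corrected_ge K w (ltnW K2).
  have h2 := @genw_corrected_le K.-1 w (leq_trans (leq_pred K) (ltnW K2)).
  have h3 := @genw_corrected_le K.+1 w K2.
  have h4 := curvatureE K1.
  have W0 : 0 < weight K w by rewrite expR_gt0.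
  rewrite [X in _ <= _ + X]mulrC -mulrDr ler_pM2l // addrA lerD2r.
  (* The four errors [e] in the drifts cost at most half of the curvature. *)
  have h5 : curvature / 2 - (excess K.-1 w + excess K.+1 w - 2 * excess K w)
     <= 2 * genw (corrected K) w - genw (corrected K.-1) w - genw (corrected K.+1) w.
    move: h1 h2 h3 h4 e_small. lra.
  move: h5; rewrite -(ler_pM2l th_gt0); lra.
rewrite big_split /= -mulr_sumr -/(lyap w).
have -> : \sum_(1 <= K < n) weight K w * (th * (excess K.-1 w + excess K.+1 w - 2 * excess K w))
  = th * \sum_(1 <= K < n) weight K w * (excess K.-1 w + excess K.+1 w - 2 * excess K w).
  by rewrite mulr_sumr; apply: eq_bigr => K _; rewrite mulrCA.
have L0 : 0 <= lyap w by apply: sumr_ge0 => K _; exact: expR_ge0.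
have h := sum_excess w.
have h' : th * \sum_(1 <= K < n) weight K w * (excess K.-1 w + excess K.+1 w - 2 * excess K w)
   <= th * (32 * th * B * (n%:R * (1 + 2 * B)) * lyap w) by rewrite ler_pM2l.
apply: le_trans (lerD h' (lexx _)) _.
have -> : th * (32 * th * B * (n%:R * (1 + 2 * B)) * lyap w) +
 (- (th * (curvature / 2)) + 2 * n%:R * (th * (4 * (1 + 2 * B))) ^+ 2) * lyap w
 = (th * (th * (32 * B * (n%:R * (1 + 2 * B)) + 2 * n%:R * (4 * (1 + 2 * B)) ^+ 2))
    - th * (curvature / 2)) * lyap w by ring.
rewrite ler_wpM2r //.
have : th * (th * (32 * B * (n%:R * (1 + 2 * B)) + 2 * n%:R * (4 * (1 + 2 * B)) ^+ 2))
  <= th * (curvature / 4) by rewrite ler_pM2l.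
lra.
Qed.

Lemma lyap_ge0 w : 0 <= lyap w.
Proof. by apply: sumr_ge0 => K _; exact: expR_ge0. Qed.

Lemma lyap_le w : lyap w <= n%:R * expR (4 * th * B).
Proof.
apply: le_trans (_ : \sum_(1 <= K < n) expR (4 * th * B) <= _).
  apply: ler_sum_nat => K Kb; rewrite ler_expR.
  have : (1 : R) <= (gap K w)%:~R by rewrite -[1]/(1%:~R) ler_int gap_ge1.
  have := cgap_near K w; rewrite ler_norml => /andP[h1 h2] h3.
  have : th * (- cgap K w) <= th * (4 * B) by rewrite ler_pM2l //; lra.
  by rewrite mulrN; lra.
rewrite sumr_const_nat -[X in X <= _]mulr_natl ler_wpM2r ?expR_ge0 // ler_nat leq_subr //.
Qed.

Lemma lyap_gap1 K w : (0 < K < n)%N -> gap K w = 1 ->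
  expR (- (th * (1 + 4 * B))) <= lyap w.
Proof.
move=> Kb g1; have /andP[K0 Kn] := Kb.
rewrite /lyap (big_cat_nat (n := K)) //=; last exact: ltnW.
rewrite ler_wpDl ?sumr_ge0 // => [? _|]; first exact: expR_ge0.
rewrite big_ltn // ler_wpDr ?sumr_ge0 // => [? _|]; first exact: expR_ge0.
rewrite ler_expR lerN2 ler_pM2l //; have := cgap_near K w.
by rewrite g1 ler_norml -[1%:~R]/(1 : R) => /andP[h1 h2]; lra.
Qed.

End Corrected.
End Lyapunov.

(** * Test functions for the level sums and the occupied residues *)

Section LevelFunctions.
Variables (R : realType) (n : nat) (n_gt1 : (1 < n)%N) (q : R).
Hypothesis q01 : 0 <= q < 1.
Implicit Types (w : affperm n) (r : 'I_n) (K : nat) (S : {set 'I_n}).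

Local Notation current := (current n q).
Local Notation genw := (genw q).

Let q01' : 0 <= q <= 1. Proof. by case/andP: q01 => -> /ltW. Qed.

Lemma finite_bound (T : finType) (f : T -> R) : exists B : R, forall x, `|f x| <= B.
Proof.
exists (\sum_x `|f x|) => x; rewrite (bigD1 x) //= lerDl.
by apply: sumr_ge0 => ? _; exact: normr_ge0.
Qed.

Lemma lyapunov : exists (F : affperm n -> R) (c M m : R),
  [/\ 0 < c, 0 < m, (forall w, 0 <= F w <= M), (forall w, genw F w <= - c * F w)
    & (forall K w, (0 < K < n)%N -> gap K w = 1 -> m <= F w)].
Proof.
have c0 := curvature_gt0 n_gt1 q01.
have e0 : 0 < curvature n q / 8 by rewrite divr_gt0.
have [m drift] := corrector_exists n_gt1 q01' e0.
have left := fun r S => @corrector_left R n n_gt1 q q01' m r S.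
have [B bound] := finite_bound (corrector n_gt1 q m).
have B0 : 0 <= B := B_ge0 bound.
have n0 := n_gt0R R n_gt1.
pose D : R := 32 * B * (n%:R * (1 + 2 * B)) + 2 * n%:R * (4 * (1 + 2 * B)) ^+ 2.
have B1 : 0 < 1 + 2 * B by lra.
have D0 : 0 < D.
  rewrite ltr_wpDl //; first by rewrite !mulr_ge0 // ltW.
  by apply: mulr_gt0; [rewrite mulr_gt0|apply/exprn_gt0/mulr_gt0].
pose th : R := Num.min ((1 / 2) / (4 * (1 + 2 * B))) (curvature n q / 4 / D).
have B4 : 0 < 4 * (1 + 2 * B) by rewrite mulr_gt0.
have th0 : 0 < th.
  rewrite lt_min; apply/andP; split; apply: divr_gt0 => //; exact: divr_gt0.
have th1 : th * (4 * (1 + 2 * B)) <= 1 / 2.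
  by rewrite -ler_pdivlMr // ge_min lexx.
have th2 : th * D <= curvature n q / 4 by rewrite -ler_pdivlMr // ge_min lexx orbT.
exists (lyap n_gt1 (corrector n_gt1 q m) th), (th * curvature n q / 4).
exists (n%:R * expR (4 * th * B)), (expR (- (th * (1 + 4 * B)))).
split.
- by apply: divr_gt0 => //; apply: mulr_gt0.
- exact: expR_gt0.
- by move=> w; rewrite lyap_ge0 (lyap_le n_gt1 bound th0).
- move=> w; exact: (genw_lyap q01 drift left bound th0 (lexx _) th1 th2).
- by move=> K w Kb g1; apply: (lyap_gap1 n_gt1 bound th0 Kb g1).
Qed.

(** The excess is nonnegative, so dropping it keeps a lower bound on the drift of the corrected
    level sum. *)
Lemma lower_function (eps : R) K : 0 < eps -> (K <= n)%N ->
  exists (X : affperm n -> R) (B J : R),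
  [/\ forall w, `|X w - (top_sum K w)%:~R| <= B,
      forall w r, `|X (right_mul w r) - X w| <= J
    & forall w, current K - eps <= genw X w].
Proof.
move=> e0 Kn; have [m drift] := corrector_exists n_gt1 q01' e0.
have left := fun r S => @corrector_left R n n_gt1 q q01' m r S.
have [B bound] := finite_bound (corrector n_gt1 q m).
exists (corrected n_gt1 (corrector n_gt1 q m) K), B, (1 + 2 * B); split.
- by move=> w; rewrite /corrected addrAC subrr add0r.
- by move=> w r; exact: corrected_jump.
- move=> w; apply: le_trans (genw_corrected_ge drift w Kn).
  by rewrite lerDl (excess_ge0 q01 left).
Qed.

(** The excess, present only where the gap is 1, is paid for by adding a multiple of the Lyapunov
    function, whose drift is strictly negative there. *)
Lemma upper_function (eps : R) K : 0 < eps -> (K <= n)%N ->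
  exists (X : affperm n -> R) (B J : R),
  [/\ forall w, `|X w - (top_sum K w)%:~R| <= B,
      forall w r, `|X (right_mul w r) - X w| <= J
    & forall w, genw X w <= current K + eps].
Proof.
move=> e0 Kn; have [m drift] := corrector_exists n_gt1 q01' e0.
have [B bound] := finite_bound (corrector n_gt1 q m).
have [F [c [M [m0 [c0 m00 FM LF Fg]]]]] := lyapunov.
have B0 : 0 <= B := B_ge0 bound.
pose X0 := corrected n_gt1 (corrector n_gt1 q m) K.
(* [A * (c * m0)] equals the upper bound of the excess in [excess_le]. *)
pose A := n%:R * (1 + 2 * B) / (m0 * c).
have A0 : 0 <= A by rewrite divr_ge0 ?mulr_ge0 ?(ltW c0) ?(ltW m00) //; lra.
exists (fun w => X0 w + A * F w), (B + A * M), (1 + 2 * B + A * M); split.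
- move=> w; have -> : X0 w + A * F w - (top_sum K w)%:~R
    = corrector n_gt1 q m (top_set n_gt1 K w) + A * F w by rewrite /X0 /corrected; ring.
  apply: le_trans (ler_normD _ _) _; rewrite lerD // normrM (ger0_norm A0).
  by have /andP[? ?] := FM w; rewrite ler_wpM2l // ger0_norm.
- move=> w r; rewrite opprD addrACA -mulrBr.
  apply: le_trans (ler_normD _ _) _; rewrite lerD ?corrected_jump //.
  rewrite normrM (ger0_norm A0) ler_wpM2l // ler_norml.
  by have /andP[? ?] := FM w; have /andP[? ?] := FM (right_mul w r); apply/andP; split; lra.
- move=> w; rewrite genwD genwZ.
  have h1 := genw_corrected_le drift w Kn.
  have h2 : A * genw F w <= A * (- c * F w) by rewrite ler_wpM2l.
  have h3 : excess n_gt1 q (corrector n_gt1 q m) K w <= A * (c * F w).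
    have F0 : 0 <= F w by case/andP: (FM w).
    have [/andP[Kb /eqP g1]|h] := boolP ((0 < K < n)%N && (gap K w == 1)); last first.
      by rewrite excess_eq0 // mulr_ge0 // mulr_ge0 // ltW.
    apply: le_trans (excess_le n_gt1 q01 bound K w) _.
    apply: le_trans (_ : A * (c * m0) <= _).
      by rewrite /A [c * _]mulrC divfK // gt_eqF // mulr_gt0.
    by rewrite ler_wpM2l // ler_wpM2l // ?(ltW c0) // (Fg K).
  have e1 : A * (- c * F w) = - (A * (c * F w)) by ring.
  rewrite e1 in h2; lra.
Qed.

(** [top_set K] follows the exclusion generator except for the stuck left jumps, and these require
    the gap [K] to be 1. *)
Lemma genw_top_set (phi : {set 'I_n} -> R) K : exists C : R, 0 <= C /\ forall w,
  let d := genw (fun w => phi (top_set n_gt1 K w)) w - gen n_gt1 q phi (top_set n_gt1 K w) in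
  `|d| <= C /\ (~~ ((0 < K < n)%N && (gap K w == 1)) -> d = 0).
Proof.
have [B bound] := finite_bound phi; have B0 : 0 <= B := le_trans (normr_ge0 _) (bound finset.set0).
have term w r : let S := top_set n_gt1 K w in
   rate q w r * (phi (top_set n_gt1 K (right_mul w r)) - phi S)
    - jump_rate n_gt1 q r S * (phi (flip n_gt1 r S) - phi S)
   = - (q * (stuck n_gt1 K w r)%:R * (phi (flip n_gt1 r S) - phi S)).
  rewrite /jump_rate /rate /stuck /=.
  have [[rS -> _ ->]|[lS -> _ /negPf ->]|[lS -> _ _]|[/negPf-> /negPf-> -> _]]
  := level_step n_gt1 K w r.
  - by rewrite (right_not_left rS) rS /=; ring.
  - have -> : right_jump n_gt1 r (top_set n_gt1 K w) = false.
      by apply/negP => /right_not_left; rewrite lS.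
    by rewrite lS (negPf (flip_neq lS)) /=; ring.
  - have -> : right_jump n_gt1 r (top_set n_gt1 K w) = false.
      by apply/negP => /right_not_left; rewrite lS.
    by rewrite lS eqxx /=; ring.
  - by rewrite /=; ring.
exists (\sum_(r < n) 2 * B); split; first by apply: sumr_ge0 => *; lra.
move=> w d; have -> : d = \sum_r (- (q * (stuck n_gt1 K w r)%:R *
    (phi (flip n_gt1 r (top_set n_gt1 K w)) - phi (top_set n_gt1 K w)))).
  by rewrite /d /genw /gen -sumrB; apply: eq_bigr => r _; rewrite term.
split.
  apply: le_trans (ler_norm_sum _ _ _) _; apply: ler_sum => r _.
  rewrite normrN normrM -[X in _ <= X]mul1r ler_pM //.
    have /andP[? ?] := q01'; rewrite normrM; case: (stuck _ _ _ _) => /=.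
      by rewrite normr1 mulr1 ger0_norm.
    by rewrite normr0 mulr0.
  apply: le_trans (ler_normB _ _) _; have := bound (flip n_gt1 r (top_set n_gt1 K w)).
  have := bound (top_set n_gt1 K w); lra.
move=> h; apply: big1 => r _; have [/stuck_gap[h1 h2]|] := boolP (stuck n_gt1 K w r).
  by rewrite h1 h2 eqxx in h.
by rewrite mulr0 mul0r oppr0.
Qed.

End LevelFunctions.

(** * Transition probabilities and expectations *)

Section TransitionBounds.
Variables (R : realType) (S : choiceType) (Q : S -> S -> R) (p : R -> S -> S -> R).
Hypothesis Qp : transition_function Q p.

Lemma bernoulli_le (a : R) N : 0 <= a <= 1 -> 1 - N%:R * (1 - a) <= a ^+ N.
Proof.
move=> /andP[a0 a1]; elim: N => [|N IH]; first by rewrite expr0 mul0r subr0.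
rewrite exprS; apply: le_trans (_ : a * (1 - N%:R * (1 - a)) <= _); last by rewrite ler_wpM2l.
have : 0 <= N%:R * (1 - a) ^+ 2 by rewrite mulr_ge0 ?sqr_ge0.
rewrite -natr1 expr2; nra.
Qed.

Lemma esum_ge_seq (a : S -> R) (s : seq S) (x : R) : (forall y, 0 <= a y) ->
  \esum_(y in [set: S]) (a y)%:E = x%:E -> uniq s -> \sum_(y <- s) a y <= x.
Proof.
move=> a0 e us; rewrite -lee_fin -e; apply: esum_ge.
exists [set` s]; first by split.
by rewrite -fsbig_seq // sumEFin.
Qed.

Lemma trans_le1 t x y : 0 <= t -> p t x y <= 1.
Proof.
move=> t0; have := @esum_ge_seq (p t x) [:: y] 1 (fun z => trans_ge0 Qp x z t0) (trans_sum1 Qp x t0) isT.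
by rewrite big_seq1.
Qed.

Lemma trans_compose s t x y z : 0 <= s -> 0 <= t -> p s x y * p t y z <= p (s + t) x z.
Proof.
move=> s0 t0.
have := @esum_ge_seq (fun y => p s x y * p t y z) [:: y] _
  (fun y => mulr_ge0 (trans_ge0 Qp x y s0) (trans_ge0 Qp y z t0))
  (trans_semigroup Qp x z s0 t0) isT.
by rewrite big_seq1.
Qed.

Lemma trans_compose2 s t x z : 0 <= s -> 0 <= t -> x != z ->
  p s x x * p t x z + p s x z * p t z z <= p (s + t) x z.
Proof.
move=> s0 t0 xz.
have := @esum_ge_seq (fun y => p s x y * p t y z) [:: x; z] _
  (fun y => mulr_ge0 (trans_ge0 Qp x y s0) (trans_ge0 Qp y z t0))
  (trans_semigroup Qp x z s0 t0).
by rewrite /= inE xz big_cons big_seq1 => ->.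
Qed.

Lemma trans_short x y (e h : R) : 0 < e -> 0 < h -> exists N0 : nat, forall N, (N0 <= N)%N ->
  `|p (h / N.+1%:R) x y - (x == y)%:R - h / N.+1%:R * Q x y| <= e * (h / N.+1%:R).
Proof.
move=> e0 h0; have /cvgrPdist_le /(_ e e0) := @trans_rate _ _ _ _ Qp x y.
rewrite near_withinE => -[/= d d0 hd].
have [N0 hN] : exists N0 : nat, forall N, (N0 <= N)%N -> h / N.+1%:R < d.
  exists (Num.truncn (h / d)) => N; move=> NN0.
  rewrite ltr_pdivrMr // mulrC -ltr_pdivrMr //.
  apply: lt_le_trans (_ : (Num.truncn (h / d)).+1%:R <= _).
    by rewrite truncnS_gt.
  by rewrite ler_nat ltnS.
exists N0 => N NN0; have s0 : 0 < h / N.+1%:R by rewrite divr_gt0.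
have := hd (h / N.+1%:R); rewrite /= sub0r normrN gtr0_norm // => /(_ (hN _ NN0) s0).
set s := h / _; set u := p _ _ _ - _ => hh.
have -> : u - s * Q x y = - (s * (Q x y - u / s)).
  by rewrite mulrBr opprB mulrCA divff ?mulr1 // gt_eqF.
by rewrite normrN normrM gtr0_norm // mulrC ler_pM2r.
Qed.

Lemma trans_diag_pow s x N : 0 <= s -> p s x x ^+ N <= p (s *+ N) x x.
Proof.
move=> s0; elim: N => [|N IH]; first by rewrite mulr0n expr0 (trans_0 Qp) eqxx.
rewrite exprS mulrS; apply: le_trans (trans_compose x x x s0 (mulrn_wge0 N s0)).
by rewrite ler_wpM2l // (trans_ge0 Qp).
Qed.

(** Staying at [x] in each of many short steps is one way to be there at time [t]; Bernoulli's
    inequality makes the product of the short-time bounds linear. *)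
Lemma trans_diag t x : 0 <= t -> 1 + t * Q x x <= p t x x.
Proof.
rewrite le_eqVlt => /orP[/eqP <-|t0]; first by rewrite (trans_0 Qp) eqxx mul0r addr0.
apply/ler_addgt0Pr => e e0; have et : 0 < e / t by rewrite divr_gt0.
have [N0 /(_ N0 (leqnn _))] := trans_short x x et t0.
set s := t / _; have s0 : 0 < s by rewrite divr_gt0.
have sN : s *+ N0.+1 = t by rewrite -mulr_natr /s divfK // pnatr_eq0.
rewrite eqxx ler_norml => /andP[h1 _].
have h2 := trans_diag_pow x N0.+1 (ltW s0); rewrite sN in h2.
have h3 := @bernoulli_le (p s x x) N0.+1.
rewrite (trans_ge0 Qp x x (ltW s0)) (trans_le1 x x (ltW s0)) in h3.
have h5 : N0.+1%:R * (- (e / t * s)) <= N0.+1%:R * (p s x x - 1 - s * Q x x).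
  by rewrite ler_wpM2l.
have e1 : N0.+1%:R * (e / t * s) = e.
  by rewrite mulrCA mulr_natl sN divfK // gt_eqF.
have e2 : N0.+1%:R * (s * Q x x) = t * Q x x by rewrite mulrA mulr_natl sN.
rewrite mulrN e1 in h5; lra.
Qed.

(** Counts the ways from [x] to [y] in [N] steps that stay at [x], jump once and stay at [y]: there
    are [N] places for the jump, and each other step has probability at least [a]. *)
Lemma trans_off_pow (s a : R) x y N : 0 <= s -> x != y -> 0 <= a <= 1 ->
  a <= p s x x -> a <= p s y y ->
  N%:R * p s x y * a ^+ N <= p (s *+ N) x y.
Proof.
move=> s0 xy /andP[a0 a1] ax ay; elim: N => [|N IH].
  by rewrite !mul0r mulr0n (trans_0 Qp) (negPf xy).
rewrite [s *+ _]mulrSr; apply: le_trans (trans_compose2 (mulrn_wge0 N s0) s0 xy).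
have pxy := trans_ge0 Qp x y s0.
have h1 : a ^+ N.+1 <= p (s *+ N) x x.
  apply: le_trans (_ : a ^+ N <= _); first by rewrite exprS ler_piMl ?exprn_ge0.
  apply: le_trans (trans_diag_pow x N s0).
  by rewrite lerXn2r ?nnegrE // (trans_ge0 Qp).
have h2 : p (s *+ N) x y * a <= p (s *+ N) x y * p s y y.
  by rewrite ler_wpM2l // (trans_ge0 Qp) // mulrn_wge0.
have h3 : N%:R * p s x y * a ^+ N * a <= p (s *+ N) x y * a by rewrite ler_wpM2r.
have h4 : p s x y * a ^+ N.+1 <= p (s *+ N) x x * p s x y.
  by rewrite mulrC ler_wpM2r.
rewrite -natr1; apply: le_trans (lerD h4 (le_trans h3 h2)).
by rewrite le_eqVlt; apply/orP; left; apply/eqP; rewrite exprS; ring.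
Qed.

(** [L] bounds all exit rates, so in [trans_off_pow] the steps without the jump have a joint
    probability of at least [1 - L * t]. *)
Lemma trans_off (L : R) t x y : 0 <= t -> 0 <= L -> (forall z, - L <= Q z z) ->
  x != y -> L * t <= 1 -> t * Q x y * (1 - L * t) <= p t x y.
Proof.
move=> + L0 QL xy Lt; rewrite le_eqVlt => /orP[/eqP <-|t0].
  by rewrite (trans_0 Qp) (negPf xy) !mul0r.
apply/ler_addgt0Pr => e e0; have et : 0 < e / t by rewrite divr_gt0.
have [N0 /(_ N0 (leqnn _))] := trans_short x y et t0.
set s := t / _; have s0 : 0 < s by rewrite divr_gt0.
have sN : s *+ N0.+1 = t by rewrite -mulr_natr /s divfK // pnatr_eq0.
have st : s <= t by rewrite ler_pdivrMr // ler_peMr ?ler1n // ltW.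
rewrite (negPf xy) subr0 ler_norml => /andP[h1 _].
have diag z : 1 - L * s <= p s z z.
  apply: le_trans (trans_diag z (ltW s0)); rewrite lerD2l -mulNr mulrC.
  by rewrite ler_wpM2l // ltW.
have Ls : L * s <= 1 by apply: le_trans Lt; rewrite ler_wpM2l.
have Ls0 : 0 <= L * s by rewrite mulr_ge0 // ltW.
have a01 : 0 <= 1 - L * s <= 1 by rewrite subr_ge0 Ls gerBl.
have := @trans_off_pow s _ x y N0.+1 (ltW s0) xy a01 (diag x) (diag y).
rewrite sN => h2.
have h3 := bernoulli_le N0.+1 a01.
have e3 : 1 - N0.+1%:R * (1 - (1 - L * s)) = 1 - L * t.
  by rewrite subKr mulrCA mulr_natl sN.
rewrite e3 in h3.
have P0 := trans_ge0 Qp x y (ltW s0).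
have h4 : N0.+1%:R * p s x y * (1 - L * t) <= p t x y.
  by apply: le_trans h2; rewrite ler_wpM2l // mulr_ge0.
have h5 : N0.+1%:R * (- (e / t * s)) <= N0.+1%:R * (p s x y - s * Q x y).
  by rewrite ler_wpM2l.
have e1 : N0.+1%:R * (e / t * s) = e.
  by rewrite mulrCA mulr_natl sN divfK // gt_eqF.
have e2 : N0.+1%:R * (s * Q x y) = t * Q x y by rewrite mulrA mulr_natl sN.
rewrite mulrN e1 mulrBr e2 in h5.
have Lt1 : 1 - L * t <= 1 by rewrite gerBl mulr_ge0 // ltW.
have h6 : (t * Q x y - e) * (1 - L * t) <= N0.+1%:R * p s x y * (1 - L * t).
  by rewrite ler_wpM2r //; lra.
have h7 : e * (1 - L * t) <= e * 1 by rewrite ler_pM2l.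
lra.
Qed.

End TransitionBounds.

(** * The Q-matrix of the walk and the countability of its states *)

Section HeckeMatrix.
Variables (R : realType) (n : nat) (n_gt1 : (1 < n)%N) (q : R).
Implicit Types (w : affperm n) (r : 'I_n).

Lemma right_mul_neq w r : right_mul w r != w.
Proof.
apply/eqP => /(congr1 (fun w : affperm n => (w : int -> int) r%:Z)).
rewrite right_mulE //= refl_up // => /(affine_inj); lia.
Qed.

Lemma right_mul_inj w : injective (right_mul w).
Proof.
move=> r s /(congr1 (fun w : affperm n => (w : int -> int) r%:Z)).
rewrite !right_mulE //= => /(affine_inj).
rewrite refl_up //; case: (reflP s r%:Z) => [h _|h h'|h h' h'']; try lia.
by apply/eqP; rewrite -(residue_ord n_gt1 r) (residue_eq n_gt1).
Qed.

Lemma hecke_Qmatrix_off w r : hecke_Qmatrix q w (right_mul w r) = rate q w r.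
Proof.
rewrite /hecke_Qmatrix (bigD1 r) //= hecke_rateE // right_mulE // eqxx.
rewrite (negPf (right_mul_neq w r)) subr0 mulr1 big1 ?addr0 // => s sr.
rewrite subr0 -!right_mulE //.
suff /negPf -> : (right_mul w r : int -> int) != right_mul w s by rewrite mulr0.
apply/eqP => /val_inj/right_mul_inj e; by rewrite e eqxx in sr.
Qed.

Lemma hecke_Qmatrix_diag w : hecke_Qmatrix q w w = - \sum_r rate q w r.
Proof.
rewrite /hecke_Qmatrix -sumrN; apply: eq_bigr => r _.
rewrite hecke_rateE // eqxx -right_mulE //.
suff /negPf -> : (w : int -> int) != right_mul w r by rewrite sub0r mulrN1.
by apply/eqP => /val_inj e; have := right_mul_neq w r; rewrite -e eqxx.
Qed.

(** An affine permutation is determined by its values on one period, so the state space is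
    countable. *)
Definition code_window w : nat := pickle [seq (w : int -> int) i%:Z | i <- iota 0 n].

Lemma code_window_inj : injective code_window.
Proof.
move=> w w' /(pcan_inj pickleK) e; apply/val_inj/funext => x /=.
have [k ->] := elimT (eqzmodP _ _ _) (residueE n_gt1 x).
rewrite !(affineDn n_gt1).
suff -> : (w : int -> int) (residue n_gt1 x)%:Z = (w' : int -> int) (residue n_gt1 x)%:Z by [].
have /(congr1 (fun s => nth 0 s (residue n_gt1 x))) := e.
by rewrite !(nth_map 0%N) ?size_iota // nth_iota // add0n.
Qed.

End HeckeMatrix.

(** * Random variables with countably many values *)

Section DiscreteVariable.
Variables (R : realType) (d : measure_display) (T : measurableType d) (P : probability T R).
Variables (S : Type) (code : S -> nat) (X : T -> S).
Hypothesis code_inj : injective code.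
Hypothesis mX : forall x, measurable [set om | X om = x].

Lemma discrete_preimage (A : set S) : measurable [set om | A (X om)].
Proof.
have -> : [set om | A (X om)] = \bigcup_k [set om | A (X om) /\ code (X om) = k].
  apply/seteqP; split=> [om Aom|om [k _ []] //]; by exists (code (X om)).
apply: bigcup_measurable => k _.
have [[x [Ax xk]]|h] := pselect (exists x, A x /\ code x = k).
  suff -> : [set om | A (X om) /\ code (X om) = k] = [set om | X om = x] by exact: mX.
  by apply/seteqP; split=> om /= [] => [_|->//]; rewrite -xk => /code_inj.
suff -> : [set om | A (X om) /\ code (X om) = k] = set0 by exact: measurable0.
by apply/seteqP; split=> om //= [Ax xk]; apply: h; exists (X om).
Qed.

Lemma discrete_fun_measurable (f : S -> R) : measurable_fun [set: T] (fun om => f (X om)).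
Proof. by move=> _ Y mY; rewrite setTI; exact: (discrete_preimage (f @^-1` Y)). Qed.

(** The fibres of [X] form a countable measurable partition, over which both integrals split. *)
Lemma discrete_compare (F G : T -> \bar R) :
  measurable_fun [set: T] F -> measurable_fun [set: T] G ->
  (forall om, 0 <= F om)%E -> (forall om, 0 <= G om)%E ->
  (forall x, \int[P]_(om in [set om | X om = x]) F om
          <= \int[P]_(om in [set om | X om = x]) G om)%E ->
  (\int[P]_om F om <= \int[P]_om G om)%E.
Proof.
move=> mF mG F0 G0 FG.
pose E k := [set om | code (X om) = k].
have mE k : measurable (E k) by exact: (discrete_preimage (fun x => code x = k)).
have ET : setT = \bigcup_k E k by apply/seteqP; split=> // om _; exists (code (X om)).
have tE : trivIset setT E by move=> i j _ _ [om [/= <- <-]].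
rewrite ET !(ge0_integral_bigcup P mE) -?ET //.
apply: lee_nneseries => k _; first by move=> _; exact: integral_ge0.
have [[x xk]|h] := pselect (exists x, code x = k).
  suff -> : E k = [set om | X om = x] by exact: FG.
  by apply/seteqP; split=> om; rewrite /E /= -xk; [move/code_inj|move=> ->].
suff -> : E k = set0 by rewrite !integral_set0.
by apply/seteqP; split=> om //= e; apply: h; exists (X om).
Qed.

Lemma discrete_prob_le (A : set S) (B : set T) (c : R) : 0 <= c -> measurable B ->
  (forall x, A x -> P ([set om | X om = x] `&` B) <= c%:E * P [set om | X om = x])%E ->
  (P ([set om | A (X om)] `&` B) <= c%:E * P [set om | A (X om)])%E.
Proof.
move=> c0 mB h; have mA := discrete_preimage A.
have mAB : measurable ([set om | A (X om)] `&` B) by exact: measurableI.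
rewrite -[X in (P X <= _)%E]setIT -(integral_indic P measurableT mAB).
rewrite -[X in (_ <= _ * P X)%E]setIT -(integral_indic P measurableT mA).
have mi C : measurable C -> measurable_fun [set: T] (fun om => (\1_C om)%:E : \bar R).
  by move=> mC; apply/measurable_EFinP; exact: measurable_indic.
rewrite -ge0_integralZl_EFin //; last exact: mi.
apply: discrete_compare.
- exact: mi.
- by apply: measurable_funeM; exact: mi.
- by move=> om; rewrite lee_fin.
- by move=> om; rewrite mule_ge0 // lee_fin.
move=> x.
rewrite ge0_integralZl_EFin //; last by apply: measurable_funTS; exact: mi.
rewrite !integral_indic //.
have [Ax|nAx] := pselect (A x).
  have -> : [set om | A (X om)] `&` B `&` [set om | X om = x] = [set om | X om = x] `&` B.
    apply/seteqP; split=> om /=; first by move=> [[_ ?] ?].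
    by move=> [e ?]; rewrite e.
  have -> : [set om | A (X om)] `&` [set om | X om = x] = [set om | X om = x].
    apply/seteqP; split=> om /=; first by case.
    by move=> e; rewrite e.
  exact: h.
have -> : [set om | A (X om)] `&` B `&` [set om | X om = x] = set0.
  by apply/seteqP; split=> om //= => -[[a _] e]; apply: nAx; rewrite -e.
by rewrite measure0 mule_ge0.
Qed.

End DiscreteVariable.

(** * Expectations of bounded observables *)

Section Expectation.
Variables (R : realType) (n : nat) (n_gt1 : (1 < n)%N) (q : R).
Hypothesis q01 : 0 <= q < 1.
Variables (d : measure_display) (T : measurableType d) (P : probability T R).
Variable w : R -> T -> affperm n.
Hypothesis walk : affine_hecke_walk q P w.

Local Notation genw := (genw q).

Definition bounded_obs (f : affperm n -> R) := exists M : R, forall x, `|f x| <= M.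

Let ctmc : is_ctmc P (hecke_Qmatrix q) w. Proof. by case: walk. Qed.

Lemma walk_measurable t (A : set (affperm n)) : 0 <= t -> measurable [set om | A (w t om)].
Proof.
move=> t0; apply: (discrete_preimage (code_window_inj n_gt1)) => x.
exact: ctmc_measurable ctmc t x t0.
Qed.

Lemma walk_fun_measurable t (f : affperm n -> R) : 0 <= t ->
  measurable_fun [set: T] (fun om => f (w t om)).
Proof.
move=> t0; apply: (discrete_fun_measurable (code_window_inj n_gt1)) => x.
exact: ctmc_measurable ctmc t x t0.
Qed.

Lemma walk_integrable t f : 0 <= t -> bounded_obs f ->
  P.-integrable setT (EFin \o (fun om => f (w t om))).
Proof.
move=> t0 [M fM]; apply: measurable_bounded_integrable => //.
- by apply: le_lt_trans (probability_le1 P measurableT) _; rewrite ltry.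
- exact: walk_fun_measurable.
- exists M; split; first exact: num_real.
  by move=> M' MM' om _; exact: le_trans (fM _) (ltW MM').
Qed.

Definition expec (t : R) (f : affperm n -> R) : R := \int[P]_om f (w t om).

Lemma expecE t f : 0 <= t -> bounded_obs f ->
  (\int[P]_om (f (w t om))%:E)%E = (expec t f)%:E.
Proof. by move=> t0 bf; rewrite fineK // integrable_fin_num // walk_integrable. Qed.

Lemma expecD t f g : 0 <= t -> bounded_obs f -> bounded_obs g ->
  expec t (fun x => f x + g x) = expec t f + expec t g.
Proof. by move=> t0 bf bg; apply: RintegralD => //; exact: walk_integrable. Qed.

Lemma expecZ t a f : 0 <= t -> bounded_obs f ->
  expec t (fun x => a * f x) = a * expec t f.
Proof. by move=> t0 bf; apply: RintegralZl => //; exact: walk_integrable. Qed.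

Lemma expec_le t f g : 0 <= t -> bounded_obs f -> bounded_obs g ->
  (forall x, f x <= g x) -> expec t f <= expec t g.
Proof. by move=> t0 bf bg fg; apply: le_Rintegral => //; exact: walk_integrable. Qed.

Lemma expec_cst t (a : R) : expec t (fun=> a) = a.
Proof.
rewrite /expec Rintegral_cst // -[X in fine X]/(P setT) probability_setT.
by rewrite /= mulr1.
Qed.

Lemma bounded_obs_cst a : bounded_obs (fun=> a).
Proof. by exists `|a|. Qed.

Lemma bounded_obsD f g : bounded_obs f -> bounded_obs g -> bounded_obs (fun x => f x + g x).
Proof.
by move=> [M h] [M' h']; exists (M + M') => x; apply: le_trans (ler_normD _ _) (lerD (h x) (h' x)).
Qed.

Lemma bounded_obsZ a f : bounded_obs f -> bounded_obs (fun x => a * f x).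
Proof. by move=> [M h]; exists (`|a| * M) => x; rewrite normrM ler_wpM2l. Qed.

Lemma bounded_genw f : bounded_obs f -> bounded_obs (genw f).
Proof.
move=> [M h]; exists (\sum_(r < n) 2 * M) => x.
apply: le_trans (ler_norm_sum _ _ _) _; apply: ler_sum => r _.
rewrite normrM -[X in _ <= X]mul1r ler_pM //.
  by rewrite ger0_norm ?rate_ge0 // rate_le1.
apply: le_trans (ler_normB _ _) _; have := h x; have := h (right_mul x r); lra.
Qed.

Lemma expec_norm t f (M : R) : 0 <= t -> (forall x, `|f x| <= M) -> `|expec t f| <= M.
Proof.
move=> t0 h; have bf : bounded_obs f by exists M.
rewrite ler_norml -{1}(expec_cst t M) -{2}(expec_cst t M).
have -> : - expec t (fun=> M) = expec t (fun=> - M) by rewrite !expec_cst.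
apply/andP; split; apply: expec_le => //; try exact: bounded_obs_cst.
  by move=> x; have := h x; rewrite ler_norml => /andP[].
by move=> x; have := h x; rewrite ler_norml => /andP[].
Qed.

End Expectation.

(** * First-order expansion of expectations in time *)

Section OneStep.
Variables (R : realType) (n : nat) (n_gt1 : (1 < n)%N) (q : R).
Hypothesis q01 : 0 <= q < 1.
Variables (d : measure_display) (T : measurableType d) (P : probability T R).
Variable w : R -> T -> affperm n.
Hypothesis walk : affine_hecke_walk q P w.

Local Notation genw := (genw q).
Local Notation expec := (expec P w).
Implicit Types f : affperm n -> R.

Lemma sum_uniq_eq (f : affperm n -> R) (v : affperm n) (ys : seq (affperm n)) : uniq ys ->
  \sum_(y <- ys) f y * (v == y)%:R = f v * (v \in ys)%:R.
Proof.
elim: ys => [|y ys IH] /=; first by rewrite big_nil mulr0.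
move=> /andP[yys uys]; rewrite big_cons IH // inE.
case: eqVneq => [->|_] /=; first by rewrite (negPf yys) mulr0 addr0.
by rewrite mulr0 add0r.
Qed.

Definition neighbours (x : affperm n) := x :: [seq right_mul x r | r <- enum 'I_n].

Lemma neighbours_uniq x : uniq (neighbours x).
Proof.
rewrite /= map_inj_uniq ?enum_uniq ?andbT; last exact: right_mul_inj.
by apply/mapP => -[r _ e]; have := right_mul_neq n_gt1 x r; rewrite -e eqxx.
Qed.

(** Combines the lower bounds for staying and for a single jump; the error comes from the factor
    [1 - n h] of [trans_off], summed over [n] neighbours. *)
Lemma neighbour_mass f (M h : R) x p : transition_function (hecke_Qmatrix q) p ->
  (forall y, 0 <= f y <= M) -> 0 <= h -> n%:R * h <= 1 ->
  f x + h * genw f x <= \sum_(y <- neighbours x) f y * p h x y + n%:R ^+ 2 * h ^+ 2 * M.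
Proof.
move=> pQ fM h0 nh; rewrite big_cons big_map big_enum /=.
have f0 y : 0 <= f y by case/andP: (fM y).
have n0 := n_gt0R R n_gt1.
have Qdiag (z : affperm n) : - (n%:R : R) <= hecke_Qmatrix q z z.
  by rewrite hecke_Qmatrix_diag // lerN2 (sum_rate q01).
have h1 : f x * (1 - h * \sum_r rate q x r) <= f x * p h x x.
  rewrite ler_wpM2l //; have := trans_diag pQ x h0.
  by rewrite hecke_Qmatrix_diag // mulrN.
have h2 : \sum_r f (right_mul x r) * (h * rate q x r * (1 - n%:R * h))
    <= \sum_r f (right_mul x r) * p h x (right_mul x r).
  apply: ler_sum => r _; rewrite ler_wpM2l //.
  have := trans_off pQ h0 (ltW n0) Qdiag (_ : x != right_mul x r) nh.
  by rewrite hecke_Qmatrix_off // eq_sym; apply; exact: right_mul_neq.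
have e1 : \sum_r f (right_mul x r) * (h * rate q x r * (1 - n%:R * h))
    = h * (1 - n%:R * h) * \sum_r rate q x r * f (right_mul x r).
  by rewrite mulr_sumr; apply: eq_bigr => r _; ring.
have e2 : genw f x = \sum_r rate q x r * f (right_mul x r) - f x * \sum_r rate q x r.
  by rewrite mulr_sumr -sumrB; apply: eq_bigr => r _; ring.
have h3 : \sum_r rate q x r * f (right_mul x r) <= n%:R * M.
  have -> : n%:R * M = \sum_(r < n) M by rewrite sumr_const card_ord mulr_natl.
  apply: ler_sum => r _; have /andP[? fr] := fM (right_mul x r).
  apply: le_trans fr; rewrite ler_piMl //; exact: rate_le1.
rewrite e1 in h2; rewrite e2.
set s := \sum_r _ in h1 *; set s2 := \sum_r rate q x r * f _ in h2 h3 *.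
have h4 : n%:R * h ^+ 2 * s2 <= n%:R * h ^+ 2 * (n%:R * M).
  by rewrite ler_wpM2l // mulr_ge0 // ?sqr_ge0 // ltW.
have e3 : n%:R ^+ 2 * h ^+ 2 * M = n%:R * h ^+ 2 * (n%:R * M) by ring.
have e4 : h * (1 - n%:R * h) * s2 = h * s2 - n%:R * h ^+ 2 * s2 by ring.
rewrite e3; rewrite e4 in h2; move: h1; rewrite !mulrBr mulr1 => h1.
have e5 : h * (f x * s) = f x * (h * s) by ring.
rewrite e5; lra.
Qed.

Let mw (t : R) x (t0 : 0 <= t) : measurable [set om | w t om = x].
Proof. by case: walk => c _; exact: ctmc_measurable c t x t0. Qed.

(** Conditions on the state at time [t] and keeps only its neighbours, which is a lower bound
    because [f] is nonnegative. *)
Lemma expec_lower f (M t h : R) : (forall y, 0 <= f y <= M) -> 0 <= t -> 0 <= h ->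
  n%:R * h <= 1 ->
  expec t (fun x => f x + h * genw f x) <= expec (t + h) f + n%:R ^+ 2 * h ^+ 2 * M.
Proof.
move=> fM t0 h0 nh.
have M0 : 0 <= M by have /andP[a b] := fM (affine1 n); exact: le_trans a b.
have f0 y : 0 <= f y by case/andP: (fM y).
have bf : bounded_obs f by exists M => y; have /andP[a b] := fM y; rewrite ger0_norm.
have th0 : 0 <= t + h by rewrite addr_ge0.
set K := n%:R ^+ 2 * h ^+ 2 * M.
have K0 : 0 <= K by rewrite !mulr_ge0 // sqr_ge0.
have bg : bounded_obs (fun x => f x + h * genw f x).
  by apply: bounded_obsD => //; apply: bounded_obsZ; exact: bounded_genw.
have g0 x : 0 <= f x + h * genw f x.
  have -> : f x + h * genw f x = f x * (1 - h * \sum_r rate q x r)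
      + h * \sum_r rate q x r * f (right_mul x r).
    by rewrite /genw mulrBr mulr1 !mulr_sumr -addrA -sumrN -big_split;
       congr (_ + _); apply: eq_bigr => r _ /=; ring.
  rewrite addr_ge0 // mulr_ge0 //.
    rewrite subr_ge0; apply: le_trans nh; rewrite mulrC ler_wpM2r //.
    exact: sum_rate.
  by apply: sumr_ge0 => r _; rewrite mulr_ge0 // rate_ge0.
rewrite -(expec_cst P w (t + h) K) -(expecD n_gt1 walk th0 bf (bounded_obs_cst n K)).
rewrite -lee_fin -(expecE n_gt1 walk t0 bg).
rewrite -(expecE n_gt1 walk th0 (bounded_obsD bf (bounded_obs_cst n K))).
have mf (u : R) (g : affperm n -> R) : 0 <= u -> measurable_fun [set: T] (fun om => (g (w u om))%:E : \bar R).
  by move=> u0; apply/measurable_EFinP; exact: (walk_fun_measurable n_gt1 walk g u0).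
apply: (discrete_compare (code_window_inj n_gt1) (fun x => mw x t0)).
- exact: (mf t (fun x => f x + h * genw f x)).
- exact: (mf (t + h) (fun x => f x + K)).
- by move=> om; rewrite lee_fin.
- by move=> om; rewrite lee_fin addr_ge0.
move=> x; have mA := mw x t0; set A := [set om | w t om = x] in mA *.
rewrite (@eq_integral _ _ _ P A (fun=> (f x + h * genw f x)%:E)); last first.
  by move=> om; rewrite inE /A /= => ->.
rewrite integral_cst //.
have [p pQ mk] : exists2 p, transition_function (hecke_Qmatrix q) p & forall y,
   (P (A `&` [set om | w (t + h) om = y]) = P A * (p h x y)%:E)%E.
  have [p pQ mk] := ctmc_markov (proj1 walk); exists p => // y.
  have := mk [::] t (t + h) x y; rewrite addrAC subrr add0r /=.
  have -> : [set om | (forall u : R * affperm n, u \in [::] -> w u.1 om = u.2) /\ w t om = x] = A.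
    by apply/seteqP; split=> om //= [].
  by apply => //; rewrite t0 lerDl.
pose B y := [set om | w (t + h) om = y].
have mB y : measurable (B y) by exact: mw.
pose phi om : R := \sum_(y <- neighbours x) f y * \1_(B y) om.
have mphi1 y : measurable_fun A (fun om => (f y * \1_(B y) om)%:E : \bar R).
  apply/measurable_EFinP; apply: measurable_funM => //; exact: measurable_indic.
have step1 : (\int[P]_(om in A) (phi om + K)%:E <= \int[P]_(om in A) (f (w (t + h) om) + K)%:E)%E.
  apply: ge0_le_integral => //.
  - move=> om _; rewrite lee_fin addr_ge0 //; apply: sumr_ge0 => y _.
    by rewrite mulr_ge0.
  - apply/measurable_EFinP; apply: measurable_funD => //.
    apply: measurable_sum => y; apply: measurable_funM => //; exact: measurable_indic.
  - exact/measurable_funTS/(mf (t + h) (fun x => f x + K)).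
  - move=> om _; rewrite lee_fin lerD2r /phi.
    under eq_bigr => y _.
      have -> : \1_(B y) om = (w (t + h) om == y)%:R :> R.
        rewrite indicE; congr (_%:R); congr nat_of_bool.
        by apply/idP/eqP; rewrite inE.
      over.
    rewrite sum_uniq_eq ?neighbours_uniq //.
    by rewrite ler_piMr // lern1 leq_b1.
apply: le_trans step1.
have -> : (\int[P]_(om in A) (phi om + K)%:E
   = (\sum_(y <- neighbours x) f y * p h x y + K)%:E * P A)%E.
  under eq_integral do rewrite EFinD.
  rewrite ge0_integralD //; last 2 first.
  - move=> om _; rewrite lee_fin; apply: sumr_ge0 => y _; by rewrite mulr_ge0.
  - apply/measurable_EFinP; apply: measurable_sum => y.
    by apply: measurable_funM => //; exact: measurable_indic.
  rewrite integral_cst // EFinD ge0_muleDl ?lee_fin //; last first.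
    by apply: sumr_ge0 => y _; rewrite mulr_ge0 // (trans_ge0 pQ).
  congr (_ + _)%E.
  under eq_integral do rewrite /phi -sumEFin.
  rewrite ge0_integral_sum //; last by move=> y om _; rewrite lee_fin mulr_ge0.
  rewrite -sumEFin ge0_sume_distrl; last first.
    by move=> y _; rewrite lee_fin mulr_ge0 // (trans_ge0 pQ).
  apply: eq_bigr => y _.
  under eq_integral do rewrite EFinM.
  rewrite ge0_integralZl_EFin //; last first.
    by apply/measurable_EFinP; exact: measurable_indic.
  rewrite integral_indic // setIC; have := mk y; rewrite -/(B y) => e.
  by rewrite [X in (_ * X)%E]e EFinM muleAC muleA.
by rewrite lee_wpmul2r // lee_fin neighbour_mass.
Qed.

Lemma genw_sub (M : R) f x : genw (fun y => M - f y) x = - genw f x.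
Proof. by rewrite /genw -sumrN; apply: eq_bigr => r _; ring. Qed.

(** [expec_lower] for [f] gives one side and for [M - f] the other: conservation of mass supplies
    the upper bound. *)
Lemma expec_step f (M t h : R) : (forall y, 0 <= f y <= M) -> 0 <= t -> 0 <= h ->
  n%:R * h <= 1 ->
  `|expec (t + h) f - (expec t f + h * expec t (genw f))| <= n%:R ^+ 2 * h ^+ 2 * M.
Proof.
move=> fM t0 h0 nh.
have bf : bounded_obs f.
  exists M => y; have /andP[a b] := fM y; by rewrite ger0_norm.
have bL := bounded_genw q01 bf.
have th0 : 0 <= t + h by rewrite addr_ge0.
have h1 := expec_lower fM t0 h0 nh.
have fM' y : 0 <= M - f y <= M by have /andP[? ?] := fM y; rewrite subr_ge0 gerBl; apply/andP.
have h2 := expec_lower fM' t0 h0 nh.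
have e1 : expec t (fun x => f x + h * genw f x) = expec t f + h * expec t (genw f).
  by rewrite (expecD n_gt1 walk) ?(expecZ n_gt1 walk) //; exact: bounded_obsZ.
have bN : bounded_obs (fun x => -1 * f x) by exact: bounded_obsZ.
have eN u : 0 <= u -> expec u (fun x => M - f x) = M - expec u f.
  move=> u0; have -> : (fun x => M - f x) = (fun x => M + -1 * f x).
    by apply/funext => x; rewrite mulN1r.
  rewrite (expecD n_gt1 walk) ?(expecZ n_gt1 walk) ?expec_cst ?mulN1r //.
  exact: (bounded_obs_cst n).
have e2 : expec t (fun x => (M - f x) + h * genw (fun y => M - f y) x)
    = M - (expec t f + h * expec t (genw f)).
  rewrite -e1.
  have -> : (fun x => (M - f x) + h * genw (fun y => M - f y) x)
    = (fun x => M + -1 * (f x + h * genw f x)).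
    by apply/funext => x; rewrite genw_sub; ring.
  rewrite (expecD n_gt1 walk) ?(expecZ n_gt1 walk) ?expec_cst ?mulN1r //.
  - by apply: bounded_obsD => //; exact: bounded_obsZ.
  - exact: (bounded_obs_cst n).
  - by apply: bounded_obsZ; apply: bounded_obsD => //; exact: bounded_obsZ.
rewrite e1 in h1; rewrite e2 (eN _ th0) in h2.
by rewrite ler_norml; apply/andP; split; lra.
Qed.

Lemma expec0 f : bounded_obs f -> expec 0 f = f (affine1 n).
Proof.
move=> bf; rewrite -[RHS](expec_cst P w 0) /expec /Rintegral; congr fine.
have m0 := walk_measurable n_gt1 walk (fun x => x = affine1 n) (lexx 0).
apply: ae_eq_integral => //.
- by apply/measurable_EFinP; exact: (walk_fun_measurable n_gt1 walk f (lexx 0)).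
- have E : [set om | affperm_fun (w 0 om) = id] = [set om | w 0 om = affine1 n].
    by apply/seteqP; split=> om /= [e]; [apply/val_inj|rewrite e].
  exists (~` [set om | w 0 om = affine1 n]); split.
  + exact: measurableC.
  + by apply: etrans (probability_setC P m0) _; rewrite -E (proj2 walk) subee.
  + move=> om /= h e; apply: h => _; by rewrite e.
Qed.

End OneStep.

(** * Exponential tails *)

(** No regularity of [a] is assumed: cutting the interval into [N] steps accumulates an error
    [N * B * (s / N) ^+ 2] times a bounded factor, which vanishes as [N] grows. *)
Lemma gronwall (R : realType) (a : R -> R) (c A B h0 t0 : R) :
  0 < h0 -> 0 <= A -> 0 <= B -> a t0 <= A ->
  (forall t h, t0 <= t -> 0 <= h <= h0 -> a (t + h) <= (1 + c * h) * a t + B * h ^+ 2) ->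
  forall s, 0 <= s -> a (t0 + s) <= expR (c * s) * A.
Proof.
move=> h00 A0 B0 at0 step s s0; apply/ler_addgt0Pr => e e0.
pose D : R := B * s ^+ 2 * expR (`|c| * s).
have D0 : 0 <= D by rewrite !mulr_ge0 ?expR_ge0 ?sqr_ge0.
(* The three summands make [h <= h0], [|c * h| <= 1] and the accumulated error at most [e]. *)
pose N := (Num.truncn (s / h0 + `|c| * s + D / e)).+1.
have hN : s / h0 + `|c| * s + D / e < N%:R by rewrite truncnS_gt.
have p1 : 0 <= s / h0 by rewrite divr_ge0 // ltW.
have p2 : 0 <= `|c| * s by rewrite mulr_ge0.
have p3 : 0 <= D / e by rewrite divr_ge0 // ltW.
pose h := s / N%:R.
have hge0 : 0 <= h by rewrite divr_ge0 // ltW.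
have hle : h <= h0.
  rewrite ler_pdivrMr // mulrC -ler_pdivrMr //; lra.
have ch : `|c * h| <= 1.
  rewrite normrM (ger0_norm hge0) /h mulrA ler_pdivrMr // mul1r; lra.
have claim k : a (t0 + k%:R * h) <= expR (c * (k%:R * h)) * A
    + k%:R * (B * h ^+ 2) * expR (`|c| * (k%:R * h)).
  elim: k => [|k IH]; first by rewrite mul0r addr0 mulr0 expR0 mul1r mul0r mul0r addr0.
  have -> : t0 + k.+1%:R * h = t0 + k%:R * h + h by rewrite -natr1; ring.
  have kh : 0 <= k%:R * h by rewrite mulr_ge0.
  apply: le_trans (step _ h _ _) _; first by rewrite lerDl.
    by rewrite hge0.
  have c1 : 0 <= 1 + c * h by move: ch; rewrite ler_norml => /andP[]; lra.
  pose r0 := expR (c * (k%:R * h)) * A + k%:R * (B * h ^+ 2) * expR (`|c| * (k%:R * h)).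
  have {}IH : a (t0 + k%:R * h) <= r0 by [].
  have r00 : 0 <= r0.
    rewrite /r0; apply: addr_ge0; apply: mulr_ge0; rewrite ?expR_ge0 //.
    by apply: mulr_ge0 => //; apply: mulr_ge0 => //; exact: sqr_ge0.
  have e1 : (1 + c * h) * a (t0 + k%:R * h) <= expR (c * h) * r0.
    apply: le_trans (_ : (1 + c * h) * r0 <= _); first by rewrite ler_wpM2l.
    by rewrite ler_wpM2r // expR_ge1Dx.
  have e2 : expR (c * h) <= expR (`|c| * h).
    by rewrite ler_expR ler_wpM2r // ler_norm.
  have Bh : 0 <= B * h ^+ 2 by rewrite mulr_ge0 ?sqr_ge0.
  have e3 : expR (c * h) * r0 <= expR (c * (k.+1%:R * h)) * A
      + k%:R * (B * h ^+ 2) * expR (`|c| * (k.+1%:R * h)).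
    rewrite /r0 mulrDr mulrA -expRD.
    have -> : c * h + c * (k%:R * h) = c * (k.+1%:R * h) by rewrite -natr1; ring.
    rewrite lerD2l mulrCA ler_wpM2l ?mulr_ge0 //.
    have -> : `|c| * (k.+1%:R * h) = `|c| * h + `|c| * (k%:R * h) by rewrite -natr1; ring.
    by rewrite expRD ler_wpM2r ?expR_ge0.
  have e4 : B * h ^+ 2 <= B * h ^+ 2 * expR (`|c| * (k.+1%:R * h)).
    rewrite ler_peMr //; apply: le_trans (expR_ge1Dx _).
    by rewrite lerDl; apply: mulr_ge0 => //; exact: mulr_ge0.
  apply: le_trans (lerD (le_trans e1 e3) e4) _.
  move: (expR (`|c| * _)) (expR (c * _)) => E1 E2.
  by rewrite -natr1 le_eqVlt; apply/orP; left; apply/eqP; ring.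
have := claim N; have -> : N%:R * h = s by rewrite mulrC divfK // gt_eqF.
move=> /le_trans; apply; rewrite lerD2l.
have -> : N%:R * (B * h ^+ 2) * expR (`|c| * s) = D / N%:R.
  by rewrite /D /h; field; rewrite gt_eqF.
rewrite ler_pdivrMr // mulrC -ler_pdivrMr //; lra.
Qed.

Section Tails.
Variables (R : realType) (n : nat) (n_gt1 : (1 < n)%N) (q : R).
Hypothesis q01 : 0 <= q < 1.
Variables (d : measure_display) (T : measurableType d) (P : probability T R).
Variable w : R -> T -> affperm n.
Hypothesis walk : affine_hecke_walk q P w.

Local Notation genw := (genw q).
Local Notation expec := (expec P w).
Local Notation current := (current n q).
Implicit Types f : affperm n -> R.

Lemma expec_lyapunov f (M c : R) : (forall x, 0 <= f x <= M) ->
  (forall x, genw f x <= c * f x) ->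
  forall t, 0 <= t -> expec t f <= expR (c * t) * f (affine1 n).
Proof.
move=> fM Lf t t0.
have bf : bounded_obs f by exists M => y; have /andP[a b] := fM y; rewrite ger0_norm.
have M0 : 0 <= M by have /andP[a b] := fM (affine1 n); exact: le_trans a b.
have n0 := n_gt0R R n_gt1.
have f10 : 0 <= f (affine1 n) by case/andP: (fM (affine1 n)).
rewrite -[t in expec t _]add0r.
apply: (@gronwall R (fun t => expec t f) c _ (n%:R ^+ 2 * M) n%:R^-1 0) => //.
- by rewrite invr_gt0.
- by rewrite mulr_ge0 ?sqr_ge0.
- by rewrite (expec0 n_gt1 walk).
move=> s h s0 /andP[h0 hn].
have nh : n%:R * h <= 1 by rewrite mulrC -ler_pdivlMr // div1r.
have := expec_step n_gt1 q01 walk fM s0 h0 nh.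
have h1 : expec s (genw f) <= c * expec s f.
  rewrite -(expecZ n_gt1 walk) //; apply: (expec_le n_gt1 walk) => //.
    exact: bounded_genw.
  exact: bounded_obsZ.
rewrite ler_norml => /andP[_ h2].
have h3 : h * expec s (genw f) <= h * (c * expec s f) by rewrite ler_wpM2l.
have -> : n%:R ^+ 2 * M * h ^+ 2 = n%:R ^+ 2 * h ^+ 2 * M by ring.
rewrite mulrDl mul1r -[c * h * _]mulrA mulrCA in h3 *; lra.
Qed.

Lemma expec_ind_le (b : affperm n -> bool) f (m : R) t : 0 <= t -> 0 < m -> bounded_obs f ->
  (forall x, m * (b x)%:R <= f x) -> expec t (fun x => (b x)%:R) <= expec t f / m.
Proof.
move=> t0 m0 bf h; rewrite ler_pdivlMr // mulrC.
have bb : bounded_obs (fun x => (b x)%:R : R).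
  by exists 1 => x; rewrite ger0_norm // lern1 leq_b1.
rewrite -(expecZ n_gt1 walk) //; apply: (expec_le n_gt1 walk) => //.
exact: bounded_obsZ.
Qed.

(** Chernoff bound with exponent [th]. The exponential of [th * X] must be a bounded observable: it
    is when [X] is bounded above, and otherwise it is truncated at its threshold value [m]. At the
    cap the generator is at most 0, so the growth rate [c1] has to be nonnegative there; hence the
    alternative. *)
Lemma exp_tail (X : affperm n -> R) (J l e : R) :
  (forall x r, `|X (right_mul x r) - X x| <= J) -> (forall x, genw X x <= l) -> 0 < e ->
  0 <= l \/ (exists b, forall x, X x <= b) ->
  exists C c : R, 0 < c /\ forall t, 0 <= t ->
    expec t (fun x => ((l + e) * t <= X x)%R%:R) <= C * expR (- c * t).
Proof.
move=> XJ LX e0 lX; have n0 := n_gt0R R n_gt1.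
have J0 : 0 <= J by apply: le_trans (XJ (affine1 n) (Ordinal (n_gt0 n_gt1))).
(* Small enough for [genw_expR], and for the second-order term to use up at most half of the slack
   [e]. *)
pose th : R := Num.min ((1 / 2) / (J + 1)) (e / 2 / (2 * n%:R * (J ^+ 2 + 1))).
have d1 : 0 < J + 1 by lra.
have d2 : 0 < 2 * n%:R * (J ^+ 2 + 1).
  by rewrite mulr_gt0 // ?mulr_gt0 // ltr_wpDl // sqr_ge0.
have th0 : 0 < th.
  by rewrite lt_min; apply/andP; split; apply: divr_gt0 => //; exact: divr_gt0.
have th1 : th * J <= 1 / 2.
  apply: le_trans (_ : th * (J + 1) <= _); first by rewrite ler_pM2l // lerDl.
  by rewrite -ler_pdivlMr // ge_min lexx.
have th2 : th * (2 * n%:R * J ^+ 2) <= e / 2.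
  apply: le_trans (_ : th * (2 * n%:R * (J ^+ 2 + 1)) <= _).
    by rewrite ler_pM2l // ler_pM2l ?mulr_gt0 // lerDl.
  by rewrite -ler_pdivlMr // ge_min lexx orbT.
pose Y x := th * X x.
pose c1 := th * l + 2 * n%:R * (th * J) ^+ 2.
have LY x : genw (fun x => expR (Y x)) x <= c1 * expR (Y x).
  have YJ r : `|Y (right_mul x r) - Y x| <= th * J.
    by rewrite -mulrBr normrM gtr0_norm // ler_pM2l.
  apply: le_trans (genw_expR n_gt1 q01 YJ th1) _.
  rewrite mulrC ler_wpM2r ?expR_ge0 // lerD2r genwZ ler_pM2l //.
exists (expR (Y (affine1 n))), (th * (e / 2)); split; first by rewrite mulr_gt0 // divr_gt0.
move=> t t0; pose m := expR (th * ((l + e) * t)).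
have m0 : 0 < m by rewrite expR_gt0.
suff [f [M [fM [Lf f1 fm]]]] : exists f M, (forall x, 0 <= f x <= M) /\
    [/\ forall x, genw f x <= c1 * f x, f (affine1 n) <= expR (Y (affine1 n))
      & forall x, m * ((l + e) * t <= X x)%R%:R <= f x].
  have bf : bounded_obs f by exists M => y; have /andP[a b] := fM y; rewrite ger0_norm.
  apply: le_trans (expec_ind_le t0 m0 bf fm) _.
  rewrite ler_pdivrMr //; apply: le_trans (expec_lyapunov fM Lf t0) _.
  rewrite mulrC -mulrA -expRD; apply: ler_pM; rewrite ?expR_ge0 //.
    by case/andP: (fM (affine1 n)).
  rewrite ler_expR /c1.
  have h1 : th * (th * (2 * n%:R * J ^+ 2)) * t <= th * (e / 2) * t.
    by rewrite ler_wpM2r // ler_pM2l.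
  have -> : (th * l + 2 * n%:R * (th * J) ^+ 2) * t
    = th * l * t + th * (th * (2 * n%:R * J ^+ 2)) * t by ring.
  have -> : - (th * (e / 2)) * t + th * ((l + e) * t)
    = th * l * t + th * (e / 2) * t by field.
  by rewrite lerD2l.
case: lX => [l0|[b Xb]]; last first.
  exists (fun x => expR (Y x)), (expR (th * b)); split.
    by move=> x; rewrite expR_ge0 ler_expR /Y ler_pM2l // Xb.
  split=> // x; case: (leP ((l + e) * t) (X x)) => [h|_]; last by rewrite mulr0 expR_ge0.
  by rewrite mulr1 ler_expR /Y ler_pM2l.
exists (fun x => Num.min (expR (Y x)) m), m; split.
  by move=> x; rewrite le_min expR_ge0 ltW //= ge_min lexx orbT.
split.
- move=> x; case: (leP (expR (Y x)) m) => h.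
    apply: le_trans (LY x); apply: ler_sum => r _.
    rewrite ler_wpM2l ?(rate_ge0 q01) // (min_idPl h) lerD2r ge_min lexx //.
  apply: le_trans (_ : 0 <= _).
    apply: sumr_le0 => r _; rewrite mulr_ge0_le0 ?(rate_ge0 q01) //.
    by rewrite (min_idPr (ltW h)) subr_le0 ge_min lexx orbT.
  apply: mulr_ge0; last exact: ltW.
  by apply: addr_ge0; apply: mulr_ge0; rewrite ?sqr_ge0 // ?mulr_ge0 // ltW.
- by rewrite ge_min lexx.
- move=> x; rewrite le_min; apply/andP; split.
    case: (leP ((l + e) * t) (X x)) => [h|_]; last by rewrite mulr0 expR_ge0.
    by rewrite mulr1 ler_expR /Y ler_pM2l.
  by rewrite ler_piMr ?(ltW m0) // lern1 leq_b1.
Qed.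

(** Multiplying by a reflection moves one leader up by 1 and another one down by 1. *)
Lemma sum_pos_const (x : affperm n) : \sum_i pos x i = \sum_(i < n) (i.+1%:Z : int).
Proof.
have [s xs _] := affine_word n_gt1 x.
elim/last_ind: s x xs => [|s r IH] x xs.
  apply: eq_bigr => i _; have -> : x = affine1 n by apply/val_inj; rewrite /= xs.
  exact: (position_fun (affine1 n) i.+1).
have [y ys _] := refl_word_affine n_gt1 s.
have -> : x = right_mul y r.
  by apply/val_inj; rewrite /= right_mulE // ys xs refl_word_rcons.
rewrite -(IH y ys); have [i [j [k e]]] := edge_exists n_gt1 y r.
under eq_bigr do rewrite (pos_edge _ e).
rewrite sumrB big_split /=.
have one (z : 'I_n) : \sum_(i < n) (i == z)%:Z = 1.
  by rewrite (bigD1 z) //= eqxx big1 ?addr0 // => v /negPf ->.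
by rewrite !one addrK.
Qed.

(** The foremost leaders lie on average at least as far right as the others, and the total of all
    positions is nonnegative. This provides the upper bound on the observable of the lower tail. *)
Lemma top_sum_ge0 K (x : affperm n) : (K <= n)%N -> 0 <= top_sum K x.
Proof.
move=> Kn.
have h : 0 <= \sum_(i in top K x) \sum_(j in ~: top K x) (pos x i - pos x j).
  apply: sumr_ge0 => i iK; apply: sumr_ge0 => j; rewrite inE => jK.
  rewrite subr_ge0 ltW // -(rankE n_gt1); move: iK jK; rewrite !inE -leqNgt.
  exact: leq_trans.
move: h; under eq_bigr do rewrite sumrB sumr_const.
rewrite sumrB sumr_const sumrMnl -/(top_sum K x) card_top //.
have -> : #|~: top K x|%SET = (n - K)%N.
  have := cardsC (top K x); rewrite card_top // card_ord; lia.
have tot : top_sum K x + \sum_(j in ~: top K x) pos x j = \sum_i pos x i.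
  rewrite /top_sum [RHS](bigID (mem (top K x))) /=; congr (_ + _).
  by apply: eq_bigl => j; rewrite inE.
have tot0 : 0 <= \sum_i pos x i by rewrite sum_pos_const; apply: sumr_ge0.
rewrite -[_ *+ (n - K)]mulr_natr -[_ *+ K]mulr_natr natrB // !natz => h.
have e : \sum_(j in ~: top K x) pos x j = \sum_i pos x i - top_sum K x by lia.
rewrite e in h; nia.
Qed.

Lemma current_ge0 K : (K <= n)%N -> 0 <= current K.
Proof.
move=> Kn; have /andP[_ q1] := q01; rewrite divr_ge0 //.
  by rewrite !mulr_ge0 ?subr_ge0 ?ler_nat // ltW.
by rewrite subr_ge0 ler1n (n_gt0 n_gt1).
Qed.

Lemma level_tail K (e : R) : (K <= n)%N -> 0 < e ->
  exists C c : R, [/\ 0 <= C, 0 < c & forall t, 0 <= t ->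
    expec t (fun x => (e * t < `|(top_sum K x)%:~R - current K * t|)%R%:R) <= C * expR (- c * t)].
Proof.
move=> Kn e0; have e4 : 0 < e / 4 by rewrite divr_gt0.
have [X [B [J [XB XJ LX]]]] := upper_function n_gt1 q01 e4 Kn.
have [X' [B' [J' [XB' XJ' LX']]]] := lower_function n_gt1 q01 e4 Kn.
have l0 : 0 <= current K + e / 4 by rewrite addr_ge0 ?current_ge0 // ltW.
have [C [c [c0 hC]]] := exp_tail XJ LX e4 (or_introl l0).
have [C' [c' [c'0 hC']]] : exists C c : R, 0 < c /\ forall t, 0 <= t ->
    expec t (fun x => ((- (current K - e / 4) + e / 4) * t <= - X' x)%R%:R) <= C * expR (- c * t).
  apply: (@exp_tail (fun x => - X' x) J') => //.
  - by move=> x r; rewrite -opprD normrN.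
  - move=> x; have -> : genw (fun x => - X' x) x = - genw X' x.
      by rewrite /genw -sumrN; apply: eq_bigr => r _; ring.
    by rewrite lerN2.
  (* The rate [- (current K - e / 4)] may be negative, so the second alternative of [exp_tail] is
     taken: [- X'] is bounded above. *)
  - right; exists B' => x; have := XB' x; rewrite ler_norml => /andP[h _].
    have : (0 : R) <= (top_sum K x)%:~R by rewrite ler0z top_sum_ge0.
    lra.
have B0 : 0 <= B := le_trans (normr_ge0 _) (XB (affine1 n)).
have B'0 : 0 <= B' := le_trans (normr_ge0 _) (XB' (affine1 n)).
(* From time [s] on the bounded corrections amount to at most [e * t / 2]; before [s] the constant
   [expR (k * s)] makes the bound at least 1. *)
pose s := 2 * (B + B') / e.
pose k := Num.min c c'.
have k0 : 0 < k by rewrite lt_min c0.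
exists (`|C| + `|C'| + expR (k * s)), k; split=> //.
move=> t t0.
have bI (b : affperm n -> bool) : bounded_obs (fun x => (b x)%:R : R).
  by exists 1 => x; rewrite ger0_norm // lern1 leq_b1.
have [ts|st] := ltP t s.
  apply: le_trans (_ : 1 <= _).
    rewrite -[X in _ <= X](expec_cst P w t) (expec_le n_gt1 walk) //.
      exact: (bounded_obs_cst n).
    by move=> x; rewrite lern1 leq_b1.
  apply: le_trans (_ : expR (k * s) * expR (- k * t) <= _).
    rewrite -expRD -expR0 ler_expR mulNr subr_ge0 ler_pM2l //; exact: ltW.
  by rewrite ler_wpM2r // ler_wpDl // addr_ge0.
have mono (b b' b'' : affperm n -> bool) : (forall x, b x -> b' x || b'' x) ->
    expec t (fun x => (b x)%:R) <= expec t (fun x => (b' x)%:R) + expec t (fun x => (b'' x)%:R).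
  move=> h; rewrite -(expecD n_gt1 walk) //; apply: (expec_le n_gt1 walk) => //.
    exact: bounded_obsD.
  move=> x; have := h x; case: (b x) => [/(_ isT)|_]; last by rewrite addr_ge0.
  by case: (b' x); case: (b'' x) => //= _; rewrite ?addr0 ?add0r // -natrD ler1n.
apply: le_trans (mono _ (fun x => (current K + e / 4 + e / 4) * t <= X x)
  (fun x => (- (current K - e / 4) + e / 4) * t <= - X' x) _) _.
  move=> x; have := XB x; have := XB' x; rewrite !ler_norml => /andP[h1 h2] /andP[h3 h4].
  have st' : 2 * (B + B') <= e * t by rewrite [e * t]mulrC -ler_pdivrMr.
  rewrite lter_normr => /orP[h|h]; apply/orP; [left|right]; lra.
apply: le_trans (lerD (hC t t0) (hC' t t0)) _.
have m1 D r : k <= r -> D * expR (- r * t) <= `|D| * expR (- k * t).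
  move=> kr; apply: le_trans (_ : `|D| * expR (- r * t) <= _).
    by rewrite ler_wpM2r ?expR_ge0 ?ler_norm.
  by rewrite ler_wpM2l // ler_expR ler_wpM2r // lerN2.
have kc : k <= c by rewrite ge_min lexx.
have kc' : k <= c' by rewrite ge_min lexx orbT.
have := m1 C c kc; have := m1 C' c' kc'.
have : 0 <= expR (k * s) * expR (- k * t) by rewrite mulr_ge0 ?expR_ge0.
rewrite !mulrDl; lra.
Qed.

End Tails.

(** * Almost sure behaviour of the paths *)

Section BorelCantelli.
Variables (R : realType) (d : measure_display) (T : measurableType d) (P : probability T R).

(** Comparison with a telescoping sum of differences of inverses. *)
Lemma sum_inv_sqr (M : nat) :
  \sum_(0 <= m < M.+1) (m.+1%:R ^+ 2)^-1 <= 2 - M.+1%:R^-1 :> R.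
Proof.
elim: M => [|M IH]; first by rewrite big_nat1 expr1n invr1; lra.
rewrite big_nat_recr //=; apply: le_trans (lerD IH (lexx _)) _.
have x0 : 0 < M.+1%:R :> R by rewrite ltr0n.
rewrite -[M.+2%:R]natr1; move: (M.+1%:R) x0 => x x0.
have x10 : 0 < x + 1 by rewrite addr_gt0.
rewrite -subr_ge0; have -> : 2 - (x + 1)^-1 - (2 - x^-1 + ((x + 1) ^+ 2)^-1)
  = (x * (x + 1) ^+ 2)^-1 by field; rewrite !gt_eqF.
by rewrite invr_ge0 mulr_ge0 ?sqr_ge0 // ltW.
Qed.

Lemma borel_cantelli (F : nat -> set T) (C : R) : (forall m, measurable (F m)) -> 0 <= C ->
  (forall m, P (F m) <= (C / m.+1%:R ^+ 2)%:E)%E ->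
  {ae P, forall om, exists M : nat, forall m, (M <= m)%N -> ~ F m om}.
Proof.
move=> mF C0 PF.
have h : P (lim_sup_set F) = 0%E.
  apply: lim_sup_set_cvg0 => //.
  apply: (@le_lt_trans _ _ (C * 2)%:E); last by rewrite ltry.
  apply: lime_le; first exact: is_cvg_nneseries.
  apply: nearW => M.
  apply: le_trans (_ : (\sum_(0 <= m < M.+1) (C / m.+1%:R ^+ 2)%:E <= _)%E).
    apply: le_trans (_ : (\sum_(0 <= m < M) (C / m.+1%:R ^+ 2)%:E <= _)%E).
      by apply: lee_sum => m _; exact: PF.
    by rewrite big_nat_recr //= leeDl // lee_fin divr_ge0 ?sqr_ge0.
  rewrite sumEFin lee_fin -mulr_sumr ler_wpM2l //.
  apply: le_trans (sum_inv_sqr M) _; by rewrite gerBl invr_ge0.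
exists (lim_sup_set F); split => //.
  by apply: bigcap_measurable => // k _; exact: bigcup_measurable.
move=> om /= h'; move=> M _; apply: contrapT => h2; apply: h'; exists M => m Mm Fm.
by apply: h2; exists m.
Qed.

Lemma finite_union_bound (I : Type) (s : seq I) (F : I -> set T) (c : R) :
  (forall i, measurable (F i)) -> (forall i, P (F i) <= c%:E)%E ->
  measurable (\big[setU/set0]_(i <- s) F i) /\
  (P (\big[setU/set0]_(i <- s) F i) <= ((size s)%:R * c)%:E)%E.
Proof.
move=> mF PF; elim: s => [|i s [ms Ps]].
  by rewrite big_nil measure0 mul0r; split=> //; exact: measurable0.
rewrite big_cons /=; split; first exact: measurableU.
apply: le_trans (measureU2 _ (mF i) ms) _.
rewrite -natr1 mulrDl mul1r [X in (_ <= X%:E)%E]addrC EFinD; exact: leeD (PF i) Ps.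
Qed.

End BorelCantelli.

(** * Jumps of the walk in short time intervals *)

Section Paths.
Variables (R : realType) (n : nat) (n_gt1 : (1 < n)%N) (q : R).
Hypothesis q01 : 0 <= q < 1.
Variables (d : measure_display) (T : measurableType d) (P : probability T R).
Variable w : R -> T -> affperm n.
Hypothesis walk : affine_hecke_walk q P w.

Local Notation expec := (expec P w).

Let mw (t : R) x (t0 : 0 <= t) : measurable [set om | w t om = x].
Proof. by case: walk => c _; exact: ctmc_measurable c t x t0. Qed.

Definition states_at (ts : seq R) (om : T) : seq (affperm n) := [seq w t om | t <- ts].

Lemma states_at_fiber ts xs : all (fun t => 0 <= t) ts ->
  measurable [set om | states_at ts om = xs].
Proof.
elim: ts xs => [|t ts IH] xs /=.
  move=> _; have [->|xs0] := pselect (xs = [::]).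
    by rewrite (_ : [set _ | _] = setT) //; apply/seteqP.
  rewrite (_ : [set _ | _] = set0); first exact: measurable0.
  by apply/seteqP; split=> om //= e; apply: xs0; rewrite -e.
move=> /andP[t0 ts0]; case: xs => [|x xs].
  rewrite (_ : [set _ | _] = set0); first exact: measurable0.
  by apply/seteqP; split.
rewrite (_ : [set _ | _] = [set om | w t om = x] `&` [set om | states_at ts om = xs]).
  by apply: measurableI; [exact: mw|exact: IH].
by apply/seteqP; split=> om /= => [[-> ->]|[-> ->]].
Qed.

Lemma code_seq_inj : injective (fun xs : seq (affperm n) => pickle [seq code_window x | x <- xs]).
Proof. by move=> xs ys /(pcan_inj pickleK) /(inj_map (code_window_inj n_gt1)). Qed.

Lemma states_at_measurable ts (A : set (seq (affperm n))) : all (fun t => 0 <= t) ts ->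
  measurable [set om | A (states_at ts om)].
Proof.
move=> ts0; apply: (discrete_preimage code_seq_inj) => xs; exact: states_at_fiber.
Qed.

Lemma two_measurable (s t : R) (A : affperm n -> affperm n -> Prop) : 0 <= s -> 0 <= t ->
  measurable [set om | A (w s om) (w t om)].
Proof.
move=> s0 t0.
have := @states_at_measurable [:: s; t] (fun xs => A (nth (affine1 n) xs 0) (nth (affine1 n) xs 1)).
by apply; rewrite /= s0 t0.
Qed.

Lemma event_expec (t : R) (b : affperm n -> bool) : 0 <= t ->
  P [set om | b (w t om)] = (expec t (fun x => (b x)%:R))%:E.
Proof.
move=> t0.
have mb : measurable [set om | b (w t om)] by exact: (walk_measurable n_gt1 walk (fun x => b x) t0).
rewrite -[X in P X]setIT -[LHS](integral_indic P measurableT mb).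
rewrite -(expecE n_gt1 walk) //; last by exists 1 => x; rewrite ger0_norm // lern1 leq_b1.
apply: eq_integral => om _; rewrite indicE; congr (_%:R%:E); congr nat_of_bool.
by apply/idP/idP; rewrite inE.
Qed.

(** The Markov property, with the past recorded at the finitely many times [ts]: given all recorded
    states, the walk is elsewhere after a further time [h] with conditional probability at most
    [n h]. *)
Lemma jump_after (ts : seq R) (s h : R) (D : set (seq (affperm n))) :
  all (fun t => 0 <= t <= s) ts -> 0 <= s -> 0 <= h ->
  (P ([set om | D (states_at (s :: ts) om)] `&` [set om | w (s + h) om <> w s om])
    <= (n%:R * h)%:E * P [set om | D (states_at (s :: ts) om)])%E.
Proof.
move=> tss s0 h0.
have ts0 : all (fun t => 0 <= t) (s :: ts).
  by rewrite /= s0; apply: sub_all tss => t /andP[].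
have sh0 : 0 <= s + h by rewrite addr_ge0.
apply: (discrete_prob_le (S := seq (affperm n)) (X := states_at (s :: ts)) code_seq_inj) => //.
- by move=> xs; exact: states_at_fiber.
- by rewrite mulr_ge0 // ltW.
- exact: (@two_measurable (s + h) s (fun x y => x <> y)).
move=> xs _; have mA := states_at_fiber xs ts0.
set A := [set om | _ = xs] in mA *.
have [e0|ne0] := pselect (A = set0).
  by rewrite e0 set0I !measure0 mule0.
have [om0 Aom0] : A !=set0 by apply/set0P/eqP.
move: Aom0; rewrite /A /= => xsE.
pose x := w s om0; pose past := [seq (t, w t om0) | t <- ts].
have [p pQ mk] := ctmc_markov (proj1 walk).
have hp (u : R * affperm n) : u \in past -> 0 <= u.1 <= s.
  by move=> /mapP[t tts ->] /=; move/allP: tss; apply.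
have hs : 0 <= s <= s + h by rewrite s0 lerDl.
have := mk past s (s + h) x x hp hs; rewrite addrAC subrr add0r /=.
have -> : [set om | (forall u : R * affperm n, u \in past -> w u.1 om = u.2) /\ w s om = x] = A.
  apply/seteqP; split=> om /=; rewrite /A -xsE /states_at /=.
    move=> [h1 ->]; congr (_ :: _); apply/eq_in_map => t tts.
    by apply: (h1 (t, w t om0)); apply/mapP; exists t.
  move=> [-> h1]; split=> // u /mapP[t tts ->] /=.
  by move/eq_in_map: h1; apply.
move=> mkx.
have mB : measurable [set om | w (s + h) om = x] by exact: mw.
have e1 : P A = (P (A `&` [set om | w (s + h) om = x])
    + P (A `&` [set om | w (s + h) om <> w s om]))%E.
  rewrite -measureU; last 3 first.
  - exact: measurableI.
  - apply: measurableI => //; exact: (@two_measurable (s + h) s (fun x y => x <> y)).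
  - apply/seteqP; split=> om //= [[a b] [_ c]]; apply: c; rewrite b.
    by move: a; rewrite /A /= -xsE /states_at /= => -[->].
  congr (P _); apply/seteqP; split=> om /=; last by case=> -[].
  move=> Aom; have ws : w s om = x by move: Aom; rewrite /A /= -xsE => -[->].
  by have [e|ne] := pselect (w (s + h) om = x); [left|right; split=> //; rewrite ws].
have fA : P A \is a fin_num by rewrite fin_num_measure.
rewrite mkx in e1.
have diag : 1 - n%:R * h <= p h x x.
  apply: le_trans (trans_diag pQ x h0); rewrite hecke_Qmatrix_diag // mulrN lerD2l lerN2.
  by rewrite [n%:R * h]mulrC ler_wpM2l // (sum_rate q01).
move: e1 fA; set PA := P A; set PB := P (A `&` _).
have PB0 : (0 <= PB)%E by exact: measure_ge0.
have PA0 : (0 <= PA)%E by exact: measure_ge0.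
move: PA PB PB0 PA0 => [a| |] [b| |] //= b0 a0 e1 _.
rewrite -!EFinM -EFinD in e1; case: e1 => e1; rewrite -EFinM lee_fin.
rewrite !lee_fin in b0 a0.
have h1 : a * (1 - n%:R * h) <= a * p h x x by rewrite ler_wpM2l.
by rewrite mulrC; lra.
Qed.

Lemma jump_prob (s h : R) : 0 <= s -> 0 <= h ->
  (P [set om | w (s + h) om <> w s om] <= (n%:R * h)%:E)%E.
Proof.
move=> s0 h0; have := @jump_after [::] s h setT isT s0 h0.
rewrite (_ : [set om | setT (states_at [:: s] om)] = setT); last by apply/seteqP.
by rewrite setTI [P setT](probability_setT P) mule1.
Qed.

Lemma two_jumps_prob (s1 h1 s2 h2 : R) : 0 <= s1 -> 0 <= h1 -> s1 + h1 <= s2 -> 0 <= h2 ->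
  (P ([set om | w (s1 + h1) om <> w s1 om] `&` [set om | w (s2 + h2) om <> w s2 om])
   <= (n%:R ^+ 2 * (h1 * h2))%:E)%E.
Proof.
move=> s10 h10 s12 h20; have n0 := n_gt0R R n_gt1.
have s20 : 0 <= s2 by apply: le_trans s12; rewrite addr_ge0.
(* In [states_at] the time [s2] comes at index 0, so [s1] and [s1 + h1] have the indices 1 and 2. *)
pose D : set (seq (affperm n)) :=
  fun xs => nth (affine1 n) xs 2 <> nth (affine1 n) xs 1.
have := @jump_after [:: s1; s1 + h1] s2 h2 D.
rewrite /= s10 addr_ge0 // s12 (le_trans _ s12) ?lerDl // => /(_ isT s20 h20) /le_trans; apply.
apply: le_trans (_ : ((n%:R * h2)%:E * (n%:R * h1)%:E <= _)%E).
  by rewrite lee_wpmul2l ?lee_fin ?mulr_ge0 ?(ltW n0) //; exact: jump_prob.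
rewrite -EFinM lee_fin le_eqVlt; apply/orP; left; apply/eqP; ring.
Qed.

(** [neighbour_mass] for the constant 1 leaves at most [n^2 h^2] of mass outside the neighbours. *)
Lemma far_prob (s h : R) : 0 <= s -> 0 <= h -> n%:R * h <= 1 ->
  (P [set om | w (s + h) om \notin neighbours (w s om)] <= (n%:R ^+ 2 * h ^+ 2)%:E)%E.
Proof.
move=> s0 h0 nh; have n0 := n_gt0R R n_gt1; have sh0 : 0 <= s + h by rewrite addr_ge0.
set B := [set om | _].
have mB : measurable B by exact: (@two_measurable (s + h) s (fun x y => x \notin neighbours y)).
have c0 : 0 <= n%:R ^+ 2 * h ^+ 2 :> R by rewrite mulr_ge0 ?sqr_ge0.
have := @discrete_prob_le R d T P (affperm n) _ (w s) (code_window_inj n_gt1)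
  (fun x => mw x s0) setT B _ c0 mB.
rewrite (_ : [set om | setT (w s om)] = setT); last by apply/seteqP.
rewrite setTI [P setT](probability_setT P) mule1; apply => x _.
set A := [set om | w s om = x]; have mA : measurable A by exact: mw.
have [p pQ mk] : exists2 p, transition_function (hecke_Qmatrix q) p & forall y,
   (P (A `&` [set om | w (s + h) om = y]) = P A * (p h x y)%:E)%E.
  have [p pQ mk] := ctmc_markov (proj1 walk); exists p => // y.
  have := mk [::] s (s + h) x y; rewrite addrAC subrr add0r /=.
  have -> : [set om | (forall u : R * affperm n, u \in [::] -> w u.1 om = u.2) /\ w s om = x] = A.
    by apply/seteqP; split=> om //= [].
  by apply => //; rewrite s0 lerDl.
have fin_part ys : uniq ys -> (P (A `&` [set om | w (s + h) om \in ys])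
    = P A * (\sum_(y <- ys) p h x y)%:E)%E.
  elim: ys => [_|y ys IH /= /andP[yys uys]].
    rewrite big_nil mule0 (_ : _ `&` _ = set0) ?measure0 //.
    by apply/seteqP; split=> om //= [].
  rewrite big_cons EFinD ge0_muleDr ?lee_fin ?(trans_ge0 pQ) //; last first.
    by apply: sumr_ge0 => z _; rewrite (trans_ge0 pQ).
  rewrite -IH // -mk -measureU; last 3 first.
  - by apply: measurableI => //; exact: mw.
  - apply: measurableI => //; exact: (walk_measurable n_gt1 walk (fun z => z \in ys) sh0).
  - by apply/seteqP; split=> om //= [[_ ->] [_ yin]]; rewrite yin in yys.
  congr (P _); apply/seteqP; split=> om /=; rewrite ?inE.
    by move=> [Aom /orP[/eqP ->|h']]; [left|right].
  by move=> [[Aom ->]|[Aom ->]]; rewrite ?eqxx ?orbT.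
have mA1 : measurable (A `&` [set om | w (s + h) om \in neighbours x]).
  apply: measurableI => //; exact: (walk_measurable n_gt1 walk (fun z => z \in neighbours x) sh0).
have e1 : P A = (P (A `&` [set om | w (s + h) om \in neighbours x]) + P (A `&` B))%E.
  rewrite -measureU //; last 2 first.
  - exact: measurableI.
  - apply/seteqP; split=> om //= [[a b] [_ c]]; move: c; rewrite /B /= a.
    by rewrite b.
  congr (P _); apply/seteqP; split=> om /=; last by case=> -[].
  move=> Aom; rewrite /B /= Aom; case: (boolP (w (s + h) om \in neighbours x)) => ?; by [left|right].
have fA : P A \is a fin_num by rewrite fin_num_measure.
rewrite fin_part ?neighbours_uniq // in e1.
have o1 (y : affperm n) : 0 <= (1 : R) <= 1 by rewrite ler01 lexx.
have mass := @neighbour_mass R n n_gt1 q q01 (fun=> 1) 1 h x p pQ o1 h0 nh.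
have g0 : genw q (fun=> 1 : R) x = 0.
  by rewrite /genw big1 // => r _; rewrite subrr mulr0.
rewrite g0 mulr0 addr0 mulr1 in mass.
rewrite (eq_bigr (fun y => p h x y)) in mass; last by move=> y _; rewrite mul1r.
move: e1 fA; set PA := P A; set PB := P (A `&` B).
have PB0 : (0 <= PB)%E by exact: measure_ge0.
have PA0 : (0 <= PA)%E by exact: measure_ge0.
move: PA PB PB0 PA0 => [a| |] [b| |] //= b0 a0 e1 _.
rewrite -!EFinM -EFinD in e1; case: e1 => e1; rewrite -EFinM lee_fin.
rewrite !lee_fin in b0 a0.
have h1 : a * 1 <= a * (\sum_(y <- neighbours x) p h x y + n%:R ^+ 2 * h ^+ 2) by rewrite ler_wpM2l.
by clear o1; rewrite mulrDr in h1; lra.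
Qed.

(* By right continuity dyadic times suffice: outside this event the path takes
   only its two end values on [[t, t + h]]. *)
Definition stray (t h : R) : set T := [set om | exists k j : nat,
  (j <= 2 ^ k)%N /\ w (t + j%:R * (h / 2 ^+ k)) om <> w t om
  /\ w (t + j%:R * (h / 2 ^+ k)) om <> w (t + h) om].

(** On the dyadic points of depth [k], a third value forces changes in two different cells. The
    number of pairs of cells times the probability of two such changes is at most [n^2 h^2],
    whatever the depth, and the events increase with the depth. *)
Lemma stray_prob (t h : R) : 0 <= t -> 0 <= h ->
  measurable (stray t h) /\ (P (stray t h) <= (n%:R ^+ 2 * h ^+ 2)%:E)%E.
Proof.
move=> t0 h0; have n0 := n_gt0R R n_gt1.
pose F k : set T := [set om | exists j : nat, (j <= 2 ^ k)%N /\
  w (t + j%:R * (h / 2 ^+ k)) om <> w t om /\ w (t + j%:R * (h / 2 ^+ k)) om <> w (t + h) om].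
have u0 k j : 0 <= t + j%:R * (h / 2 ^+ k).
  by rewrite addr_ge0 // mulr_ge0 // divr_ge0 // ltW.
have strayE : stray t h = \bigcup_k F k.
  by apply/seteqP; split=> [om [k [j hj]]|om [k _ [j hj]]]; exists k => //; exists j.
have mF k : measurable (F k).
  rewrite (_ : F k = \bigcup_(j in [set j | (j <= 2 ^ k)%N])
    [set om | w (t + j%:R * (h / 2 ^+ k)) om <> w t om /\ w (t + j%:R * (h / 2 ^+ k)) om <> w (t + h) om]).
    apply: bigcup_measurable => j _.
    have := @states_at_measurable [:: t; t + j%:R * (h / 2 ^+ k); t + h]
     (fun xs => nth (affine1 n) xs 1 <> nth (affine1 n) xs 0 /\ nth (affine1 n) xs 1 <> nth (affine1 n) xs 2).
    by apply; rewrite /= t0 u0 addr_ge0.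
  by apply/seteqP; split=> [om [j [a b]]|om [j a b]]; exists j.
have Fmono : {homo F : a b / (a <= b)%N >-> (a <= b)%O}.
  apply: homo_leq => [A|A B C|k]; [exact: lexx|exact: le_trans|].
  apply/subsetPset => om [j [jk hj]]; exists (2 * j)%N; split.
    by rewrite expnS leq_mul2l jk orbT.
  suff -> : (2 * j)%:R * (h / 2 ^+ k.+1) = j%:R * (h / 2 ^+ k) by [].
  by rewrite natrM exprS; field; rewrite gt_eqF.
have PF k : (P (F k) <= (n%:R ^+ 2 * h ^+ 2)%:E)%E.
  pose N := (2 ^ k)%N; pose del := h / 2 ^+ k.
  have del0 : 0 <= del by rewrite divr_ge0 // ltW.
  have NE : N%:R * del = h by rewrite /N natrX /del mulrC divfK // gt_eqF.
  pose J (j : nat) : set T := [set om | w (t + j%:R * del + del) om <> w (t + j%:R * del) om].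
  pose G (p : 'I_N * 'I_N) : set T := if (p.1 < p.2)%N then J p.1 `&` J p.2 else set0.
  have mJ j : measurable (J j).
    apply: (@two_measurable _ _ (fun x y => x <> y)); last exact: u0.
    by rewrite addr_ge0 // u0.
  have mG p : measurable (G p).
    by rewrite /G; case: ifP => _; [exact: measurableI|exact: measurable0].
  have PG p : (P (G p) <= (n%:R ^+ 2 * (del * del))%:E)%E.
    rewrite /G; case: ifP => [p12|_]; last by rewrite measure0 lee_fin mulr_ge0 ?sqr_ge0 // mulr_ge0.
    apply: two_jumps_prob => //; first exact: u0.
    by rewrite -addrA lerD2l -{2}[del]mul1r -mulrDl natr1 ler_wpM2r // ler_nat.
  have [mU PU] := finite_union_bound (enum [set: 'I_N * 'I_N]%SET) mG PG.
  have sub : F k `<=` \big[setU/set0]_(p <- enum [set: 'I_N * 'I_N]%SET) G p.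
    move=> om [j [jN [ne1 ne2]]].
    (* A change between two dyadic points happens in some cell between them; this is used before and
       after the point [j]. *)
    have chain (a b : nat) : (a <= b)%N ->
        w (t + a%:R * del) om <> w (t + b%:R * del) om ->
        exists c, (a <= c < b)%N /\ J c om.
      move=> ab; have [m ->] : exists m, b = (a + m)%N by exists (b - a)%N; lia.
      elim: m => [|m IH] ne; first by rewrite addn0 in ne.
      have [e|ne'] := pselect (w (t + a%:R * del) om = w (t + (a + m)%:R * del) om).
        exists (a + m)%N; split; first by lia.
        rewrite /J /= => e'; apply: ne; rewrite e -e'; congr (w _ om).
        by rewrite addnS -natr1; ring.
      by have [c [cb Jc]] := IH ne'; exists c; split=> //; lia.
    have [c1 [/andP[_ c1j] Jc1]] := chain 0%N j (leq0n j) ltac:(by rewrite mul0r addr0 => e; apply: ne1).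
    have [c2 [/andP[jc2 c2N] Jc2]] := chain j N jN ltac:(by rewrite NE).
    have c1N : (c1 < N)%N by exact: leq_trans c1j jN.
    rewrite -bigcup_seq; exists (Ordinal c1N, Ordinal c2N); first by rewrite /= mem_enum finset.in_setT.
    by rewrite /G /= (leq_trans c1j jc2).
  apply: le_trans (_ : (P (\big[setU/set0]_(p <- enum [set: 'I_N * 'I_N]%SET) G p) <= _)%E).
    by apply: le_measure => //; rewrite inE.
  apply: le_trans PU _; rewrite lee_fin -cardE cardsT card_prod card_ord natrM.
  by rewrite -NE le_eqVlt; apply/orP; left; apply/eqP; ring.
have mU : measurable (\bigcup_k F k) by exact: bigcup_measurable.
rewrite strayE; split => //.
have cv := nondecreasing_cvg_mu (mu := P) mF mU Fmono.
rewrite -(cvg_lim _ cv) //; apply: lime_le; first by apply/cvg_ex; eexists; exact: cv.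
exact: nearW.
Qed.

End Paths.

(** * The time grid *)

Section Grid.
Variable R : realType.

(* The mesh of the block [[m, m + 1]] is [(m + 1)^-2], so that the probabilities
   of two jumps in one cell are summable over all cells. *)
Definition cells (m : nat) : nat := (m.+1 ^ 2)%N.
Definition mesh (m : nat) : R := (m.+1%:R ^+ 2)^-1.
Definition grid (m i : nat) : R := m%:R + i%:R * mesh m.

Lemma mesh_gt0 m : 0 < mesh m.
Proof. by rewrite invr_gt0 exprn_gt0 // ltr0n. Qed.

Lemma cells_mesh m : (cells m)%:R * mesh m = 1.
Proof. by rewrite /cells /mesh natrX divff // expf_neq0 // pnatr_eq0. Qed.

Lemma mesh_le1 m : mesh m <= 1.
Proof. by rewrite invf_le1 ?exprn_gt0 ?ltr0n // exprn_ege1 // ler1n. Qed.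

Lemma grid0 m : grid m 0 = m%:R.
Proof. by rewrite /grid mul0r addr0. Qed.

Lemma gridS m i : grid m i.+1 = grid m i + mesh m.
Proof. by rewrite /grid -natr1; ring. Qed.

Lemma grid_last m : grid m (cells m) = m.+1%:R.
Proof. by rewrite /grid cells_mesh natr1. Qed.

Lemma grid_ge m i : m%:R <= grid m i.
Proof. by rewrite /grid lerDl mulr_ge0 // ltW // mesh_gt0. Qed.

Lemma grid_ge0 m i : 0 <= grid m i.
Proof. exact: le_trans (grid_ge m i). Qed.

Lemma cell_exists (s : R) : 0 <= s -> exists m i,
  [/\ m = Num.truncn s, (i < cells m)%N & grid m i <= s < grid m i + mesh m].
Proof.
move=> s0; have /andP[s1 s2] := truncn_itv s0.
set m := Num.truncn s in s1 s2.
have h0 := mesh_gt0 m.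
have d0 : 0 <= (s - m%:R) / mesh m by rewrite divr_ge0 ?subr_ge0 // ltW.
have /andP[d1 d2] := truncn_itv d0.
set i := Num.truncn _ in d1 d2; exists m, i; split=> //.
  rewrite -(ltr_nat R); apply: le_lt_trans d1 _.
  by rewrite ltr_pdivrMr // cells_mesh ltrBlDl natr1.
rewrite ler_pdivlMr // in d1; rewrite ltr_pdivrMr // -natr1 mulrDl mul1r in d2.
rewrite /grid; apply/andP; split; lra.
Qed.

End Grid.

(** * Regular paths: growth of the levels and freezing of the order *)

Section PathLimits.
Variables (R : realType) (n : nat) (n_gt1 : (1 < n)%N) (q : R).
Hypothesis q01 : 0 <= q < 1.
Variable x : R -> affperm n.
Hypothesis rc : forall t, 0 <= t -> \forall s \near t^'+, x s = x t.
Variable M0 : nat.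
Hypothesis small_steps : forall m i, (M0 <= m)%N -> (i < cells m)%N ->
  x (grid R m i + mesh R m) \in neighbours (x (grid R m i)).
Hypothesis no_stray : forall m i, (M0 <= m)%N -> (i < cells m)%N -> forall k j : nat,
  (j <= 2 ^ k)%N -> x (grid R m i + j%:R * (mesh R m / 2 ^+ k)) = x (grid R m i) \/
    x (grid R m i + j%:R * (mesh R m / 2 ^+ k)) = x (grid R m i + mesh R m).
Hypothesis on_grid : forall p K : nat, (K <= n)%N -> exists M : nat, forall m i,
  (M <= m)%N -> (i <= cells m)%N ->
  `|(top_sum K (x (grid R m i)))%:~R - current n q K * grid R m i| <= p.+1%:R^-1 * grid R m i.

Lemma dyadic_between (a b h : R) : 0 < h -> 0 <= a < h -> a < b ->
  exists k j : nat, (j <= 2 ^ k)%N /\ a < j%:R * (h / 2 ^+ k) < b.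
Proof.
move=> h0 /andP[a0 ah] ab.
pose k := Num.truncn (h / (b - a)).
have hk : h / 2 ^+ k < b - a.
  rewrite ltr_pdivrMr ?exprn_gt0 // mulrC -ltr_pdivrMr ?subr_gt0 //.
  apply: lt_le_trans (_ : k.+1%:R <= _); first by rewrite truncnS_gt.
  by rewrite -natrX ler_nat ltn_expl.
have d0 : 0 < h / 2 ^+ k by rewrite divr_gt0 // exprn_gt0.
have r0 : 0 <= a / (h / 2 ^+ k) by rewrite divr_ge0 // ltW.
have /andP[d1 d2] := truncn_itv r0.
set i := Num.truncn _ in d1 d2; exists k, i.+1; split.
  rewrite -(ltr_nat R) natrX; apply: le_lt_trans d1 _.
  by rewrite ltr_pdivrMr // mulrC divfK // gt_eqF // exprn_gt0.
rewrite ler_pdivlMr // in d1; rewrite ltr_pdivrMr // in d2.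
apply/andP; split=> //; rewrite -natr1 mulrDl mul1r; lra.
Qed.

(** By right continuity the value at [s] is also taken at a dyadic point of the cell slightly to the
    right of [s], where [no_stray] applies. *)
Lemma cell_values m i s : (M0 <= m)%N -> (i < cells m)%N ->
  grid R m i <= s < grid R m i + mesh R m -> x s = x (grid R m i) \/ x s = x (grid R m i.+1).
Proof.
move=> Mm im /andP[gs sg]; have g0 := grid_ge0 R m i; have h0 := mesh_gt0 R m.
have := rc (le_trans g0 gs); rewrite near_withinE => -[/= d d0 hd].
have [k [j [jk /andP[aj jb]]]] := @dyadic_between (s - grid R m i) (s - grid R m i + d) (mesh R m) h0
  ltac:(apply/andP; split; lra) ltac:(lra).
have xu : x (grid R m i + j%:R * (mesh R m / 2 ^+ k)) = x s.
  apply: hd => /=; last by lra.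
  by rewrite ltr0_norm; lra.
by rewrite gridS -xu; exact: no_stray.
Qed.

Lemma top_sum_rate K (e : R) : (K <= n)%N -> 0 < e -> exists A : R, forall t, A <= t ->
  `|(top_sum K (x t))%:~R - current n q K * t| <= e * t.
Proof.
move=> Kn e0; have c0 := current_ge0 n_gt1 q01 Kn.
pose p := Num.truncn (2 / e).
have pe : p.+1%:R^-1 <= e / 2.
  rewrite -[e / 2]invrK lef_pV2 ?posrE ?ltr0n ?invr_gt0 ?divr_gt0 // invf_div.
  by rewrite ltW // truncnS_gt.
have [M hM] := on_grid p Kn.
exists (Num.max (maxn M0 M)%:R ((1 + current n q K) / (e / 2) + 1)) => t.
rewrite ge_max => /andP[tM te].
have t0 : 0 <= t by apply: le_trans tM.
have [m [i [mt im gtg]]] := cell_exists t0; have /andP[gt tg] := gtg.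
have Mm : (maxn M0 M <= m)%N by rewrite mt truncn_ge_nat.
have [M0m M1m] : (M0 <= m)%N /\ (M <= m)%N by move: Mm; rewrite geq_max => /andP.
have h1 := mesh_le1 R m.
suff near g : x t = x g -> `|(top_sum K (x g))%:~R - current n q K * g| <= p.+1%:R^-1 * g ->
    t - 1 <= g <= t + 1 -> `|(top_sum K (x t))%:~R - current n q K * t| <= e * t.
  have [e1|e1] := cell_values M0m im gtg.
    by apply: near e1 (hM _ _ M1m (ltnW im)) _; apply/andP; split; lra.
  by apply: near e1 (hM _ _ M1m im) _; rewrite gridS; apply/andP; split; lra.
move=> -> hg /andP[g1 g2].
have h2 : (1 + current n q K) <= e / 2 * (t - 1).
  by rewrite mulrC -ler_pdivrMr //; lra.
have g0 : 0 <= t + 1 by lra.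
have h3 : p.+1%:R^-1 * g <= e / 2 * (t + 1).
  apply: le_trans (_ : p.+1%:R^-1 * (t + 1) <= _); first by rewrite ler_wpM2l.
  by rewrite ler_wpM2r.
have h4 : current n q K * (t - 1) <= current n q K * g by rewrite ler_wpM2l.
have h5 : current n q K * g <= current n q K * (t + 1) by rewrite ler_wpM2l.
move: hg; rewrite !ler_norml => /andP[a1 b1].
have e1 : e / 2 * (t - 1) = e * t / 2 - e / 2 by field.
have e2 : e / 2 * (t + 1) = e * t / 2 + e / 2 by field.
rewrite e1 in h2; rewrite e2 in h3; rewrite !mulrBr mulr1 in h4; rewrite !mulrDr mulr1 in h5.
move: h2 h3 h4 h5 a1 b1; clear -e0 c0.
move: (p.+1%:R^-1 * g) (current n q K * g) (current n q K * t) (e * t) (current n q K) c0 (_%:~R).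
move=> a b c d f f0 u *.
by apply/andP; split; lra.
Qed.

Lemma top_sum_rate_all (e : R) : 0 < e -> exists2 A : R, 0 <= A & forall t, A <= t ->
  forall K, (K <= n)%N -> `|(top_sum K (x t))%:~R - current n q K * t| <= e * t.
Proof.
move=> e0.
have h (K : 'I_n.+1) : exists A : R, forall t, A <= t ->
   `|(top_sum K (x t))%:~R - current n q K * t| <= e * t.
  by apply: top_sum_rate => //; rewrite -ltnS.
have [A hA] := choice h; exists (\sum_K `|A K|); first by apply: sumr_ge0 => K _; exact: normr_ge0.
move=> t At K Kn; have Kn' : (K < n.+1)%N by [].
apply: (hA (Ordinal Kn')); apply: le_trans At; rewrite (bigD1 (Ordinal Kn')) //=.
apply: le_trans (ler_norm _) _; rewrite lerDl.
by apply: sumr_ge0 => ? _; exact: normr_ge0.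
Qed.

Lemma gap_large : exists2 A : R, 0 <= A & forall t, A <= t ->
  forall K, (0 < K < n)%N -> gap K (x t) != 1.
Proof.
have c0 := curvature_gt0 n_gt1 q01.
have c80 : 0 < curvature n q / 8 by rewrite divr_gt0.
have [A A0 hA] := top_sum_rate_all c80.
(* The errors of three levels, with coefficients of total weight 4, take half of [curvature * t];
   this leaves a gap of at least 2 once [curvature * t >= 4]. *)
exists (A + 4 / curvature n q); first by rewrite addr_ge0 // divr_ge0 // ltW.
move=> t At K /andP[K0 Kn].
have p0 : 0 < 4 / curvature n q by rewrite divr_gt0.
have At' : A <= t by lra.
have h1 := hA t At' K (ltnW Kn).
have h2 := hA t At' K.-1 (leq_trans (leq_pred K) (ltnW Kn)).
have h3 := hA t At' K.+1 Kn.
have h4 := curvatureE n_gt1 q K0.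
have h5 : 4 <= curvature n q * t by rewrite mulrC -ler_pdivrMr //; lra.
apply/eqP => /(congr1 (fun z : int => z%:~R : R)); rewrite /gap !intrB intrM.
have -> : 2%:~R = 2 :> R by [].
have -> : 1%:~R = 1 :> R by [].
have e1 : 2 * (current n q K * t) - current n q K.-1 * t - current n q K.+1 * t = curvature n q * t.
  by rewrite -h4; ring.
have e2 : curvature n q / 8 * t = curvature n q * t / 8 by field.
move: h1 h2 h3; rewrite e2 !ler_norml => /andP[? ?] /andP[? ?] /andP[? ?]; lra.
Qed.

(** While no gap is 1 a single jump does not change the ranks. From one grid point to the next the
    path makes at most one jump, and inside a cell it takes no new values. *)
Lemma order_freezes : exists (A : nat) (s : 'I_n -> 'I_n), forall t, A%:R <= t -> rank (x t) = s.
Proof.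
have [A A0 hA] := gap_large.
pose m1 := maxn M0 (Num.truncn A).+1.
have m1A : A <= m1%:R.
  apply: le_trans (_ : (Num.truncn A).+1%:R <= _); first by rewrite ltW // truncnS_gt.
  by rewrite ler_nat leq_maxr.
have ranki m i : (m1 <= m)%N -> (i <= cells m)%N -> rank (x (grid R m i)) = rank (x m%:R).
  move=> mm; elim: i => [|i IH] im; first by rewrite grid0.
  rewrite -IH; last exact: ltnW.
  have M0m : (M0 <= m)%N by exact: leq_trans (leq_maxl _ _) mm.
  have := small_steps M0m im; rewrite -gridS inE => /orP[/eqP -> //|/mapP[r _ ->]].
  apply: (rank_const n_gt1) => K; apply: hA; apply: le_trans (grid_ge R m i).
  by apply: le_trans m1A _; rewrite ler_nat.
have rankm m : (m1 <= m)%N -> rank (x m%:R) = rank (x m1%:R).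
  move=> mm; have -> : m = (m1 + (m - m1))%N by lia.
  elim: (m - m1)%N => [|k IH]; first by rewrite addn0.
  rewrite -IH addnS -grid_last; apply: ranki => //; exact: leq_addr.
exists m1, (rank (x m1%:R)) => t t1.
have t0 : 0 <= t by apply: le_trans t1.
have [m [i [mt im gt]]] := cell_exists t0.
have mm : (m1 <= m)%N by rewrite mt truncn_ge_nat.
have M0m : (M0 <= m)%N by exact: leq_trans (leq_maxl _ _) mm.
rewrite -(rankm m mm).
by have [->|->] := cell_values M0m im gt; rewrite ranki // ltnW.
Qed.

End PathLimits.

(** * Almost sure regularity of the walk *)

Section AlmostSure.
Variables (R : realType) (n : nat) (n_gt1 : (1 < n)%N) (q : R).
Hypothesis q01 : 0 <= q < 1.
Variables (d : measure_display) (T : measurableType d) (P : probability T R).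
Variable w : R -> T -> affperm n.
Hypothesis walk : affine_hecke_walk q P w.

Local Notation expec := (expec P w).

Lemma cell_union_le (m k : nat) (F : nat -> set T) (c C : R) : 0 <= c ->
  (forall i, measurable (F i)) -> (forall i, P (F i) <= c%:E)%E ->
  (k%:R * c <= C / m.+1%:R ^+ 2) ->
  measurable (\big[setU/set0]_(i <- iota 0 k) F i) /\
  (P (\big[setU/set0]_(i <- iota 0 k) F i) <= (C / m.+1%:R ^+ 2)%:E)%E.
Proof.
move=> c0 mF PF kc; have [mU PU] := finite_union_bound (iota 0 k) mF PF; split => //.
by apply: le_trans PU _; rewrite lee_fin size_iota.
Qed.

(** The bound [(y / 4) ^+ 4 <= expR y] beats the quadratic number of grid points in a block and
    still leaves a summable factor. *)
Lemma exp_decay_sqr (C c : R) : 0 <= C -> 0 < c -> exists2 C' : R, 0 <= C' & forall m : nat,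
  (cells m).+1%:R * (C * expR (- c * m%:R)) <= C' / m.+1%:R ^+ 2.
Proof.
move=> C0 c0; pose D := 2 * (C * (expR c * (4 / c) ^+ 4)).
have D0 : 0 <= D by do 3 (apply: mulr_ge0 => //); rewrite ?expR_ge0 // exprn_ge0 // divr_ge0 // ltW.
exists D => // m.
have h1 : (cells m).+1%:R <= 2 * m.+1%:R ^+ 2 :> R.
  rewrite -natrX -natrM ler_nat /cells.
  have : (0 < m.+1 ^ 2)%N by rewrite expn_gt0.
  lia.
have h2 : (c * m.+1%:R / 4) ^+ 4 <= expR (c * m.+1%:R).
  have -> : c * m.+1%:R = 4%:R * (c * m.+1%:R / 4) by field.
  rewrite expRM_natl; have -> : 4 * (c * m.+1%:R / 4) / 4 = c * m.+1%:R / 4 by field.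
  have y0 : 0 <= c * m.+1%:R / 4 by rewrite divr_ge0 // mulr_ge0 // ltW.
  rewrite lerXn2r ?nnegrE ?expR_ge0 //; apply: le_trans (expR_ge1Dx _); lra.
have h3 : expR (- c * m%:R) <= expR c * (4 / c) ^+ 4 / m.+1%:R ^+ 4.
  have -> : expR (- c * m%:R) = expR c * (expR (c * m.+1%:R))^-1.
    by rewrite -expRN -expRD -natr1; congr expR; ring.
  rewrite -mulrA ler_pM2l ?expR_gt0 //.
  have -> : (4 / c) ^+ 4 / m.+1%:R ^+ 4 = ((c * m.+1%:R / 4) ^+ 4)^-1.
    by field; rewrite !gt_eqF.
  have z0 : 0 < (c * m.+1%:R / 4) ^+ 4 by rewrite exprn_gt0 // divr_gt0 // mulr_gt0.
  by rewrite lef_pV2 ?posrE ?expR_gt0.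
have h4 : C * expR (- c * m%:R) <= C * (expR c * (4 / c) ^+ 4 / m.+1%:R ^+ 4) by rewrite ler_wpM2l.
have p0 : 0 <= C * expR (- c * m%:R) by rewrite mulr_ge0 ?expR_ge0.
apply: le_trans (_ : 2 * m.+1%:R ^+ 2 * (C * (expR c * (4 / c) ^+ 4 / m.+1%:R ^+ 4)) <= _).
  by apply: ler_pM.
rewrite le_eqVlt; apply/orP; left; apply/eqP; rewrite /D.
move: (expR c) (C) => E1 C1; by field; rewrite !gt_eqF.
Qed.

(** A block has [(m + 1)^2] cells, and a bad event in a cell has probability of order
    [mesh ^+ 2 = (m + 1)^-4], so the bad blocks are summable. *)
Lemma path_regular : {ae P, forall om, exists M0 : nat, forall m, (M0 <= m)%N ->
  forall i, (i < cells m)%N ->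
   w (grid R m i + mesh R m) om \in neighbours (w (grid R m i) om) /\
   ~ stray w (grid R m i) (mesh R m) om}.
Proof.
have n0 := n_gt0R R n_gt1.
pose F m i : set T := [set om | w (grid R m i + mesh R m) om \notin neighbours (w (grid R m i) om)]
  `|` stray w (grid R m i) (mesh R m).
have g0 m i := grid_ge0 R m i; have h0 m := mesh_gt0 R m.
have mF m i : measurable (F m i).
  apply: measurableU; last by have [] := stray_prob n_gt1 q01 walk (g0 m i) (ltW (h0 m)).
  apply: (@two_measurable R n n_gt1 q d T P w walk (grid R m i + mesh R m) (grid R m i)
    (fun x y => x \notin neighbours y)) => //.
  by rewrite addr_ge0 // ltW.
pose G m := \big[setU/set0]_(i <- iota 0 (cells m)) F m i.
have C0 : 0 <= 2 * n%:R ^+ 2 + n%:R :> R by rewrite addr_ge0 // ?mulr_ge0 // ?sqr_ge0 // ltW.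
have mG m : measurable (G m).
  by apply: bigsetU_measurable.
have PG m : (P (G m) <= ((2 * n%:R ^+ 2 + n%:R) / m.+1%:R ^+ 2)%:E)%E.
  (* On the finitely many blocks with [n * mesh > 1] the summand [n] of the constant makes the bound
     trivial. *)
  have [nh|nh] := leP (n%:R * mesh R m) 1; last first.
    apply: le_trans (probability_le1 P (mG m)) _; rewrite lee_fin ler_pdivlMr // mul1r.
    have : m.+1%:R ^+ 2 < n%:R :> R by move: nh; rewrite /mesh ltr_pdivlMr // mul1r.
    have : 0 <= 2 * n%:R ^+ 2 :> R by rewrite mulr_ge0 // sqr_ge0.
    lra.
  pose c : R := 2 * (n%:R ^+ 2 * mesh R m ^+ 2).
  have PF i : (P (F m i) <= c%:E)%E.
    apply: le_trans (measureU2 _ _ _) _.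
    - apply: (@two_measurable R n n_gt1 q d T P w walk (grid R m i + mesh R m) (grid R m i)
       (fun x y => x \notin neighbours y)) => //.
      by rewrite addr_ge0 // ltW.
    - by have [] := stray_prob n_gt1 q01 walk (g0 m i) (ltW (h0 m)).
    - rewrite /c mulr2n mulrDl mul1r EFinD; apply: leeD.
        exact: (far_prob n_gt1 q01 walk (g0 m i) (ltW (h0 m)) nh).
      by have [] := stray_prob n_gt1 q01 walk (g0 m i) (ltW (h0 m)).
  have [] // := @cell_union_le m (cells m) (F m) c (2 * n%:R ^+ 2 + n%:R) _ (mF m) PF.
    by rewrite /c; apply: mulr_ge0 => //; apply: mulr_ge0; exact: sqr_ge0.
  have -> : (cells m)%:R * c = 2 * n%:R ^+ 2 * mesh R m * ((cells m)%:R * mesh R m).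
    by rewrite /c; ring.
  rewrite cells_mesh mulr1 /mesh ler_pM2r ?invr_gt0 //.
  by rewrite lerDl ltW.
apply: filterS (borel_cantelli mG C0 PG) => om [M hM]; exists M => m Mm i im.
have ii : i \in iota 0 (cells m) by rewrite mem_iota.
have nF : ~ F m i om.
  move=> Fi; apply: (hM m Mm); rewrite /G -bigcup_seq.
  by exists i; [exact: ii|exact: Fi].
split; last by move=> st; apply: nF; right.
by apply/negPn/negP => far; apply: nF; left.
Qed.

Lemma levels_on_grid (p K : nat) : (K <= n)%N -> {ae P, forall om, exists M : nat, forall m i,
  (M <= m)%N -> (i <= cells m)%N ->
  `|(top_sum K (w (grid R m i) om))%:~R - current n q K * grid R m i| <= p.+1%:R^-1 * grid R m i}.
Proof.
move=> Kn; have e0 : 0 < p.+1%:R^-1 :> R by rewrite invr_gt0 ltr0n.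
have [C [c [C0 c0 tail]]] := level_tail n_gt1 q01 walk Kn e0.
pose b (t : R) (x : affperm n) : bool :=
  p.+1%:R^-1 * t < `|(top_sum K x)%:~R - current n q K * t|.
pose F m i : set T := [set om | b (grid R m i) (w (grid R m i) om)].
have g0 m i := grid_ge0 R m i.
have mF m i : measurable (F m i).
  exact: (walk_measurable n_gt1 walk (fun x => b (grid R m i) x) (g0 m i)).
have PF m i : (P (F m i) <= (C * expR (- c * m%:R))%:E)%E.
  rewrite /F (event_expec n_gt1 walk (b (grid R m i)) (g0 m i)) lee_fin.
  apply: le_trans (tail _ (g0 m i)) _; rewrite ler_wpM2l // ler_expR !mulNr lerN2 ler_pM2l //.
  exact: grid_ge.
pose G m := \big[setU/set0]_(i <- iota 0 (cells m).+1) F m i.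
have [C' C'0 hC'] := exp_decay_sqr C0 c0.
have mPG m : measurable (G m) /\ (P (G m) <= (C' / m.+1%:R ^+ 2)%:E)%E.
  apply: (cell_union_le _ (mF m) (PF m) (hC' m)).
  by rewrite mulr_ge0 ?expR_ge0.
apply: filterS (borel_cantelli (fun m => proj1 (mPG m)) C'0 (fun m => proj2 (mPG m))) => om [M hM].
exists M => m i Mm im; rewrite leNgt; apply/negP => h.
have ii : i \in iota 0 (cells m).+1 by rewrite mem_iota add0n ltnS.
by apply: (hM m Mm); rewrite /G -bigcup_seq; exists i; [exact: ii|exact: h].
Qed.

(** What the almost sure limits use about a path; given this, they are deterministic. *)
Definition tame (x : R -> affperm n) :=
  (forall e : R, 0 < e -> exists2 A : R, 0 <= A & forall t, A <= t ->
     forall K, (K <= n)%N -> `|(top_sum K (x t))%:~R - current n q K * t| <= e * t) /\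
  exists (A : nat) (s : 'I_n -> 'I_n), forall t : R, A%:R <= t -> rank (x t) = s.

Lemma walk_tame : {ae P, forall om, tame (w ^~ om)}.
Proof.
have rc := ctmc_rcont (proj1 walk).
have lev : {ae P, forall om, forall p K : nat, (K <= n)%N -> exists M : nat, forall m i,
  (M <= m)%N -> (i <= cells m)%N ->
  `|(top_sum K (w (grid R m i) om))%:~R - current n q K * grid R m i| <= p.+1%:R^-1 * grid R m i}.
  apply: ae_foralln => p; apply: ae_foralln => K.
  case: (leqP K n) => Kn; last by apply: filterE.
  by apply: filterS (levels_on_grid p Kn).
apply: filterS3 rc lev path_regular => om rcom levom [M0 reg].
have ss m i (Mm : (M0 <= m)%N) (im : (i < cells m)%N) := proj1 (reg m Mm i im).
have ns m i : (M0 <= m)%N -> (i < cells m)%N -> forall k j : nat,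
  (j <= 2 ^ k)%N -> w (grid R m i + j%:R * (mesh R m / 2 ^+ k)) om = w (grid R m i) om \/
    w (grid R m i + j%:R * (mesh R m / 2 ^+ k)) om = w (grid R m i + mesh R m) om.
  move=> Mm im k j jk; have [_ nst] := reg m Mm i im.
  apply: contrapT => h; apply: nst; exists k, j; split=> //.
  by split=> e; apply: h; [left|right].
split; last exact: (order_freezes n_gt1 q01 rcom ss ns levom).
move=> e e0; exact: (top_sum_rate_all n_gt1 q01 rcom ns levom e0).
Qed.

End AlmostSure.

(** * The limit shape *)

Section Shape.
Variables (R : realType) (n : nat) (n_gt1 : (1 < n)%N) (q : R).
Hypothesis q01 : 0 <= q < 1.

Lemma speed_current k : (k < n)%N -> speed n q k.+1 = current n q k.+1 - current n q k.
Proof.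
move=> kn; have n1 : n%:R - 1 != 0 :> R by rewrite subr_eq0 gt_eqF // ltr1n.
by rewrite /speed /current -natr1; field.
Qed.

Lemma speed_lt j k : (j < k)%N -> speed n q k < speed n q j.
Proof.
move=> jk; have /andP[_ q1] := q01.
have n1 : 0 < n%:R - 1 :> R by rewrite subr_gt0 ltr1n.
rewrite /speed ltr_pM2r ?invr_gt0 // ltr_pM2l ?subr_gt0 //.
have : (j%:R : R) < k%:R by rewrite ltr_nat.
lra.
Qed.

Lemma speed_le j k : (j <= k)%N -> speed n q k <= speed n q j.
Proof. by rewrite leq_eqVlt => /orP[/eqP -> //|/speed_lt/ltW]. Qed.

(** The number of leaders with speed beyond [u]; at a generic [u] this is the integer [K(u)] of the
    local limit. *)
Definition faster (u : R) : nat := \sum_(k < n) (u < speed n q k.+1)%R.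

Lemma faster_le u : (faster u <= n)%N.
Proof.
rewrite -[X in (_ <= X)%N](card_ord n) -sum1_card; apply: leq_sum => k _.
by case: (_ < _).
Qed.

Lemma faster_between u K : (K <= n)%N -> (forall k, (K < k <= n)%N -> speed n q k <= u) ->
  (forall k, (0 < k <= K)%N -> u < speed n q k) -> faster u = K.
Proof.
move=> Kn hi lo; rewrite /faster.
have -> : (\sum_(k < n) (u < speed n q k.+1)%R = \sum_(k < n) (k < K)%N)%N.
  apply: eq_bigr => k _; congr nat_of_bool; case: (ltnP k K) => kK; first exact: lo.
  by apply/negbTE; rewrite -leNgt; apply: hi; rewrite ltnS kK ltn_ord.
rewrite -[RHS](card_initial Kn) -sum1_card [RHS]big_mkcond; apply: eq_bigr => k _.
by rewrite inE.
Qed.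

Lemma faster_lt u (k : 'I_n) : (k < faster u)%N = (u < speed n q k.+1).
Proof.
have mono (j l : nat) : (j <= l)%N -> u < speed n q l.+1 -> u < speed n q j.+1.
  by move=> jl h; apply: lt_le_trans h _; exact: speed_le.
apply/idP/idP => [kf|uk].
  rewrite ltNge; apply/negP => ku.
  have : (faster u <= k)%N.
    rewrite -[X in (_ <= X)%N](card_initial (ltnW (ltn_ord k))) -sum1_card big_mkcond.
    rewrite [X in (_ <= X)%N]big_mkcond.
    apply: leq_sum => j _; rewrite inE; case: (ltnP j k) => jk; first by case: (_ < _).
    suff -> : (u < speed n q j.+1) = false by [].
    by apply/negP => /(mono _ _ jk) h; move: h; rewrite ltNge ku.
  by rewrite leqNgt kf.
rewrite -[X in (X <= _)%N](card_initial (ltn_ord k)) -sum1_card big_mkcond.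
apply: leq_sum => j _; rewrite inE; case: (leqP j k) => jk; last by rewrite ltnNge jk.
by rewrite ltnS jk (mono _ _ jk uk).
Qed.

Lemma limit_shapeE (u : R) :
  limit_shape n q u = n%:R^-1 * \sum_(k < n) Num.max (speed n q k.+1 - u) 0.
Proof. by rewrite /limit_shape big_add1 big_mkord. Qed.

Lemma is_derive_ramp (u v : R) : u != v ->
  is_derive u 1 (fun y : R => Num.max (v - y) 0 : R) (- (u < v)%R%:R : R).
Proof.
move=> uv; case: ltgtP uv => // [uv|vu] _.
  apply: (near_eq_is_derive (f := fun y => v - y)).
    near=> y; rewrite max_l // subr_ge0 ltW //; near: y; exact: lt_nbhsl.
  have h := is_deriveB (is_derive_cst v u 1) (is_derive_id u 1).
  by apply: (is_derive_eq h); rewrite sub0r.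
apply: (near_eq_is_derive (f := cst 0)).
  near=> y; rewrite max_r // subr_le0 ltW //; near: y; exact: lt_nbhsr.
by apply: (is_derive_eq (is_derive_cst _ u 1)); rewrite oppr0.
Unshelve. all: by end_near.
Qed.

Lemma is_derive_shape (u : R) : (forall k, (1 <= k <= n)%N -> u != speed n q k) ->
  is_derive u 1 (limit_shape n q : R -> R) (- ((faster u)%:R / n%:R)).
Proof.
move=> hu.
have hk (k : 'I_n) := @is_derive_ramp u (speed n q k.+1) (hu k.+1 ltac:(by rewrite /= ltn_ord)).
have h := is_deriveZ n%:R^-1 (is_derive_sum hk).
have -> : limit_shape n q = n%:R^-1 \*: (\sum_(k < n) (fun y : R => Num.max (speed n q k.+1 - y) 0 : R)) :> (R -> R).
  by apply/funext => y; rewrite limit_shapeE /= fct_sumE.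
apply: is_derive_eq h _; rewrite sumrN /faster natr_sum.
by rewrite scalerN /GRing.scale /= mulrC.
Qed.

Lemma densityE (u : R) : (forall k, (1 <= k <= n)%N -> u != speed n q k) ->
  density n q u = (faster u)%:R / n%:R.
Proof.
move=> /is_derive_shape h; rewrite /density derive1E.
by rewrite derive_val opprK.
Qed.

Lemma shape_facts :
  (forall u : R, (forall k, (1 <= k <= n)%N -> u != speed n q k) ->
      derivable (limit_shape n q) u 1) /\
   (forall u : R, u < speed n q n -> density n q u = 1) /\
   (forall (K : nat) (u : R), (1 <= K <= n.-1)%N ->
      speed n q K.+1 < u < speed n q K -> density n q u = K%:R / n%:R) /\
   (forall u : R, speed n q 1 < u -> density n q u = 0).
Proof.
have n0 : n%:R != 0 :> R by rewrite gt_eqF // n_gt0R.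
split; first by move=> u /is_derive_shape h; exact: ex_derive.
split.
  move=> u un; have lo k : (k <= n)%N -> u < speed n q k.
    by move=> kn; apply: lt_le_trans un _; exact: speed_le.
  rewrite densityE; last by move=> k /andP[_ kn]; rewrite lt_eqF // lo.
  rewrite (@faster_between u n) ?divff // => k; first by case/andP => a b; move: (leq_trans a b); rewrite ltnn.
  by case/andP => _; exact: lo.
split.
  move=> K u /andP[K1 Kn] /andP[lo hi].
  have hi' k : (k <= K)%N -> u < speed n q k.
    by move=> kK; apply: lt_le_trans hi _; exact: speed_le.
  have lo' k : (K < k)%N -> speed n q k < u.
    by move=> kK; apply: le_lt_trans lo; exact: speed_le.
  have KN : (K <= n)%N by exact: leq_trans (leq_pred n).
  rewrite densityE; last first.
    move=> k _; case: (leqP k K) => kK; first by rewrite lt_eqF // hi'.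
    by rewrite gt_eqF // lo'.
  rewrite (@faster_between u K) // => k /andP[a b]; last exact: hi'.
  exact/ltW/lo'.
move=> u u1; have lo k : (0 < k)%N -> speed n q k < u.
  by move=> k0; apply: le_lt_trans u1; exact: speed_le.
rewrite densityE; last by move=> k /andP[k0 _]; rewrite gt_eqF // lo.
rewrite (@faster_between u 0) ?mul0r // => k /andP[a b]; first exact/ltW/lo.
by move: (leq_trans a b); rewrite ltnn.
Qed.

End Shape.

(** * Order and speeds of the leaders along a tame path *)

Section Leaders.
Variables (R : realType) (n : nat) (n_gt1 : (1 < n)%N) (q : R).
Hypothesis q01 : 0 <= q < 1.

Definition order_perm (x : affperm n) : 'S_n := ((rank_perm n_gt1 x)^-1)%g.

Lemma tame_order (x : R -> affperm n) : tame q x ->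
  exists (A : nat) (s : 'S_n), (0 < A)%N /\ forall t : R, A%:R <= t -> order_perm (x t) = s.
Proof.
move=> [_ [A [s h]]]; exists A.+1, (order_perm (x A%:R)); split=> // t At.
have At' : A%:R <= t by apply: le_trans At; rewrite ler_nat.
rewrite /order_perm; congr (_^-1)%g; apply/permP => i.
by rewrite !permE (h _ At') (h _ (lexx _)).
Qed.

(** The position of the leader of rank [k] is a difference of two consecutive level sums, and its
    speed that of two currents. *)
Lemma pos_leader_rate (x : R -> affperm n) : tame q x -> forall e : R, 0 < e ->
  exists2 A : R, 0 <= A & forall t, A <= t -> forall k : 'I_n,
   `|(pos (x t) (order_perm (x t) k))%:~R - speed n q k.+1 * t| <= e * t.
Proof.
move=> [h _] e e0; have e20 : 0 < e / 2 by rewrite divr_gt0.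
have [A A0 hA] := h _ e20; exists A => // t At k.
have h1 := hA t At k.+1 (ltn_ord k); have h2 := hA t At k (ltnW (ltn_ord k)).
have -> : (pos (x t) (order_perm (x t) k))%:~R
  = (top_sum k.+1 (x t))%:~R - (top_sum k (x t))%:~R :> R.
  by rewrite top_sumS intrD addrAC subrr add0r.
rewrite speed_current //.
have e1 : e / 2 * t = e * t / 2 by field.
move: h1 h2; rewrite e1 mulrBl !ler_norml => /andP[? ?] /andP[? ?]; apply/andP; split; lra.
Qed.

Lemma pos_leader_cvg (x : R -> affperm n) (s : 'S_n) (k : 'I_n) : tame q x ->
  (\forall t \near +oo, order_perm (x t) = s) ->
  (pos (x t) (s k))%:~R / t @[t --> +oo] --> speed n q k.+1.
Proof.
move=> tx xs; apply/cvgrPdist_le => e e0.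
have [A A0 hA] := pos_leader_rate tx e0.
near=> t; have t0 : 0 < t by near: t; exact: nbhs_pinfty_gt.
have -> : s k = order_perm (x t) k by congr (fun_of_perm _ k); apply/esym; near: t.
have At : A <= t by near: t; apply: nbhs_pinfty_ge; exact: num_real.
have := hA t At k; rewrite distrC.
have -> : speed n q k.+1 - (pos (x t) (order_perm (x t) k))%:~R / t
  = (speed n q k.+1 * t - (pos (x t) (order_perm (x t) k))%:~R) / t by field; rewrite gt_eqF.
by rewrite normrM normfV (gtr0_norm t0) ler_pdivrMr.
Unshelve. all: by end_near.
Qed.

End Leaders.

(** * Counting the particles of the one-species projection *)

Section ParticleCount.
Variables (R : realType) (n : nat) (n_gt1 : (1 < n)%N).
Implicit Types (w : affperm n) (x y : int).

Local Notation "x ≡ y" := (x == y %[mod n%:Z])%Z (at level 70).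

(** A site congruent to [pos w i] carries a label [i + 1 + n k], and since [1 <= i + 1 <= n] this is
    at most 0 exactly for [k < 0]. *)
Lemma one_speciesE w y i : y ≡ pos w i -> one_species w y = (y < pos w i).
Proof.
move=> /eqzmodP[k ->]; rewrite /one_species affineDn // positionK.
have := ltn_ord i; have n0 : 0 < n%:Z by rewrite ltz_nat (n_gt0 n_gt1).
move=> ii; rewrite -subr_gt0 opprD addNKr oppr_gt0.
apply/idP/idP => h; first by lia.
have k1 : k <= - 1 by nia.
have : n%:Z * k <= n%:Z * - 1 by rewrite ler_pM2l.
lia.
Qed.

Definition behind w i y : bool := (y ≡ pos w i) && (y < pos w i).

Lemma one_species_sum w y :
  one_species w y = (\sum_i behind w i y)%N :> nat.
Proof.
have [i [k [yi _]]] := pos_exists n_gt1 w y.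
have e : y ≡ pos w i by apply/eqzmodP; exists k.
rewrite /behind (bigD1 i) //= e big1 ?addn0; first by rewrite (one_speciesE e).
move=> j ji; have [ej|//] := boolP (y ≡ pos w j).
have h : pos w j ≡ pos w i by apply: eqmod_trans e; rewrite eqmod_sym.
by move: ji; rewrite (pos_mod_inj n_gt1 h) eqxx.
Qed.

(** With [D + 1] the distance from [x] to the leader, the counted sites are those at a distance from
    the leader which is a multiple of [n] among [1, ..., D]. There are [D %/ n] of them, within 1 of
    [(D + 1) / n]. *)
Lemma label_count w x i (J : nat) : (`|pos w i - x| <= J)%N ->
  `|(\sum_(0 <= j < J) behind w i (x + 1 + j%:Z)%R)%:R
    - Num.max ((pos w i)%:~R - x%:~R) 0 / n%:R| <= 1 :> R.
Proof.
move=> hJ; have n0 := n_gt0R R n_gt1.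
have [D0|D0] := lerP (pos w i - x) 0.
  have -> : Num.max ((pos w i)%:~R - x%:~R) 0 = 0 :> R.
    by rewrite max_r // -intrB lerz0.
  rewrite big1_seq ?mul0r ?subr0 ?normr0 // => j _; rewrite /behind.
  suff -> : (x + 1 + j%:Z < pos w i) = false by rewrite andbF.
  by apply/negbTE; rewrite -leNgt; lia.
have [D eD] : exists D : nat, pos w i - x = D.+1%:Z by exists (`|pos w i - x|.-1)%N; lia.
have DJ : (D <= J)%N by lia.
have -> : (\sum_(0 <= j < J) behind w i (x + 1 + j%:Z)%R = D %/ n)%N.
  rewrite /behind (big_cat_nat (n := D)) //= [X in (_ + X)%N]big1_seq ?addn0; last first.
    move=> j; rewrite mem_index_iota => /andP[_ /andP[Dj _]].
    suff -> : (x + 1 + j%:Z < pos w i) = false by rewrite andbF.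
    by apply/negbTE; rewrite -leNgt; lia.
  rewrite divn_count_dvd big_add1 /= big_nat_rev /=; apply: eq_big_nat => j /andP[_ jD].
  have -> : (x + 1 + (0 + D - j.+1)%N%:Z < pos w i) by lia.
  rewrite andbT eqmod_sym eqz_mod_dvd.
  have -> : pos w i - (x + 1 + (0 + D - j.+1)%N%:Z) = j.+1%:Z by lia.
  by [].
have -> : Num.max ((pos w i)%:~R - x%:~R) 0 = D.+1%:R :> R.
  by rewrite -intrB eD max_l // ler0z.
have e : (D%:R : R) = (D %/ n)%:R * n%:R + (D %% n)%:R.
  by rewrite -natrM -natrD -divn_eq.
have r : ((D %% n)%:R + 1 : R) <= n%:R by rewrite natr1 ler_nat ltn_mod (n_gt0 n_gt1).
have -> : ((D %/ n)%:R : R) - D.+1%:R / n%:R = - (((D %% n)%:R + 1) / n%:R).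
  by rewrite -natr1 e; field; rewrite gt_eqF.
rewrite normrN ger0_norm ?divr_ge0 ?addr_ge0 // ?(ltW n0) //.
by rewrite ler_pdivrMr // mul1r.
Qed.

Lemma particle_count_near w x :
  `|particle_count R w x - n%:R^-1 * \sum_i Num.max ((pos w i)%:~R - x%:~R) 0| <= n%:R :> R.
Proof.
(* No leader is farther than [J] from [x], so the infinite sum reduces to [J] sites. *)
pose J := (\sum_i `|pos w i - x|)%N.
have hJ i : (`|pos w i - x| <= J)%N by rewrite /J (bigD1 i) //= leq_addr.
have -> : particle_count R w x = (\sum_(0 <= j < J) (one_species w (x + 1 + j%:Z)%R))%:R.
  rewrite /particle_count natr_sum.
  pose s : seq int := [seq x + 1 + j%:Z | j <- iota 0 J].
  have us : uniq s by rewrite map_inj_uniq ?iota_uniq // => a b; lia.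
  have -> : \sum_(0 <= j < J) (one_species w (x + 1 + j%:Z))%:R
    = \sum_(y <- s) (one_species w y)%:R :> R by rewrite /s big_map /index_iota subn0.
  rewrite [RHS]fsbig_seq //; apply: esym; apply: fsbig_widen.
    by move=> y /= /mapP[j _ ->]; lia.
  move=> y [/= xy ys]; have [i [k [yi _]]] := pos_exists n_gt1 w y.
  have e : y ≡ pos w i by apply/eqzmodP; exists k.
  rewrite (one_speciesE e); suff -> : (y < pos w i) = false by [].
  apply/negbTE; rewrite -leNgt leNgt; apply/negP => yp; apply: ys => /=.
  apply/mapP; exists (absz ((y : int) - x - 1)%R); last by lia.
  by rewrite mem_iota; have := hJ i; lia.
have -> : (\sum_(0 <= j < J) one_species w (x + 1 + j%:Z)%R = \sum_i
   \sum_(0 <= j < J) behind w i (x + 1 + j%:Z)%R)%N.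
  by rewrite [RHS]exchange_big; apply: eq_bigr => j _; rewrite one_species_sum.
rewrite natr_sum mulr_sumr -sumrB.
apply: le_trans (ler_norm_sum _ _ _) _.
rewrite [X in _ <= X](_ : n%:R = \sum_(i < n) (1 : R)); last by rewrite sumr_const card_ord.
by apply: ler_sum => i _; rewrite [n%:R^-1 * _]mulrC; apply: label_count.
Qed.

End ParticleCount.

(** * The integrated limit shape *)

Section IntegratedShape.
Variables (R : realType) (n : nat) (n_gt1 : (1 < n)%N) (q : R).
Hypothesis q01 : 0 <= q < 1.

Lemma ramp_lipschitz (a b : R) : `|Num.max a 0 - Num.max b 0| <= `|a - b|.
Proof.
by case: (lerP a 0) => a0; case: (lerP b 0) => b0; rewrite ?subrr ?normr0 ?sub0r ?subr0
  ?normrN //; rewrite real_ler_normr ?num_real //; apply/orP;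
  [right; rewrite gtr0_norm|left; rewrite gtr0_norm]; lra.
Qed.

(** Up to a bounded error, both the count and the shape are averages of ramps over the leaders;
    ramps are 1-Lipschitz in the position, so the convergence of the leaders passes to the count
    uniformly in [u]. *)
Lemma integrated_shape (x : R -> affperm n) : tame q x ->
  ereal_sup [set `|particle_count R (x t) (Num.floor (u * t)) / t
                       - limit_shape n q u|%:E | u in [set: R]]
        @[t --> +oo] --> 0%E.
Proof.
move=> tx; have n0 := n_gt0R R n_gt1.
pose err (e t : R) : R := (n%:R + 1) / t + e.
have bound (e : R) : 0 < e -> \forall t \near +oo, forall u : R,
    `|particle_count R (x t) (Num.floor (u * t)) / t - limit_shape n q u| <= 2 * e.
  move=> e0; have [A A0 hA] := pos_leader_rate n_gt1 tx e0.
  near=> t; have t0 : 0 < t by near: t; exact: nbhs_pinfty_gt.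
  have At : A <= t by near: t; apply: nbhs_pinfty_ge; exact: num_real.
  have te : (n%:R + 1) / e <= t by near: t; apply: nbhs_pinfty_ge; exact: num_real.
  move=> u; set y := Num.floor (u * t).
  have /andP[y1 y2] := floor_itv (u * t); rewrite -/y intrD in y1 y2.
  set s := order_perm n_gt1 (x t).
  have h1 := particle_count_near R n_gt1 (x t) y.
  have h2 : `|n%:R^-1 * \sum_i Num.max ((pos (x t) i)%:~R - y%:~R) 0
     - n%:R^-1 * \sum_i Num.max ((pos (x t) i)%:~R - u * t) 0| <= 1.
    rewrite -mulrBr -sumrB normrM gtr0_norm ?invr_gt0 // mulrC ler_pdivrMr // mul1r.
    apply: le_trans (ler_norm_sum _ _ _) _.
    rewrite [X in _ <= X](_ : n%:R = \sum_(i < n) (1 : R)); last by rewrite sumr_const card_ord.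
    apply: ler_sum => i _; apply: le_trans (ramp_lipschitz _ _) _.
    by rewrite ler_norml; move: y2; rewrite -[1%:~R]/(1 : R) => y2; apply/andP; split; lra.
  have h3 : `|n%:R^-1 * \sum_i Num.max ((pos (x t) i)%:~R - u * t) 0 - limit_shape n q u * t| <= e * t.
    rewrite limit_shapeE (reindex_inj (@perm_inj _ s)) /= -mulrA -mulrBr mulr_suml -sumrB.
    rewrite normrM gtr0_norm ?invr_gt0 // mulrC ler_pdivrMr // mulrC.
    apply: le_trans (ler_norm_sum _ _ _) _.
    rewrite [X in _ <= X](_ : _ = \sum_(i < n) (e * t)); last by rewrite sumr_const card_ord mulr_natr.
    apply: ler_sum => k _.
    have -> : Num.max (speed n q k.+1 - u) 0 * t = Num.max (speed n q k.+1 * t - u * t) 0.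
      by rewrite maxr_pMl ?ltW // mul0r mulrBl.
    apply: le_trans (ramp_lipschitz _ _) _.
    have := hA t At k; rewrite -/s; congr (`|_| <= _); ring.
  set p := particle_count _ _ _ in h1 *.
  have -> : p / t - limit_shape n q u = (p - limit_shape n q u * t) / t by field; rewrite gt_eqF.
  rewrite normrM normfV (gtr0_norm t0) ler_pdivrMr //.
  have h4 : n%:R + 1 <= e * t by rewrite [e * t]mulrC -ler_pdivrMr.
  move: h1 h2 h3; rewrite !ler_norml => /andP[? ?] /andP[? ?] /andP[? ?]; apply/andP; split; lra.
have sup0 t : (0 <= ereal_sup [set `|particle_count R (x t) (Num.floor (u * t)) / t
                       - limit_shape n q u|%:E | u in [set: R]])%E.
  by apply: le_ereal_sup_tmp; exists (`|particle_count R (x t) (Num.floor (0 * t)) / t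
                       - limit_shape n q 0|%:E) => //=; exists 0.
have supfin (e : R) : 0 < e -> \forall t \near +oo,
   (ereal_sup [set `|particle_count R (x t) (Num.floor (u * t)) / t
                       - limit_shape n q u|%:E | u in [set: R]] <= (2 * e)%:E)%E.
  move=> e0; apply: filterS (bound e e0) => t h.
  by apply: ge_ereal_sup => _ [u _ <-]; rewrite lee_fin.
apply/fine_cvgP; split.
  apply: filterS (supfin 1 ltr01) => t h.
  rewrite ge0_fin_numE //; apply: le_lt_trans h _; exact: ltry.
apply/cvgrPdist_le => e e0.
have e2 : 0 < e / 2 by rewrite divr_gt0.
apply: filterS (supfin _ e2) => t h; rewrite /comp.
rewrite sub0r normrN ger0_norm ?fine_ge0 // -lee_fin fineK.
  by apply: le_trans h _; rewrite lee_fin mulrC divfK.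
rewrite ge0_fin_numE //; apply: le_lt_trans h _; exact: ltry.
Unshelve. all: by end_near.
Qed.

End IntegratedShape.

(** * Local equilibrium *)

Section LevelLaw.
Variables (R : realType) (n : nat) (n_gt1 : (1 < n)%N) (q : R).
Hypothesis q01 : 0 <= q < 1.
Variables (d : measure_display) (T : measurableType d) (P : probability T R).
Variable w : R -> T -> affperm n.
Hypothesis walk : affine_hecke_walk q P w.

Local Notation genw := (genw q).
Local Notation expec := (expec P w).
Local Notation step := (step n_gt1 q).
Local Notation top := (top_set n_gt1).
Implicit Types phi : {set 'I_n} -> R.

Let q01' : 0 <= q <= 1. Proof. by case/andP: q01 => -> /ltW. Qed.

Lemma exp_small (c D e : R) : 0 < c -> 0 <= D -> 0 < e ->
  exists2 A, 0 <= A & forall t, A <= t -> D * expR (- c * t) <= e.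
Proof.
move=> c0 D0 e0; exists (D / (e * c)); first by rewrite divr_ge0 // ltW // mulr_gt0.
move=> t; rewrite ler_pdivrMr ?mulr_gt0 // => h.
rewrite mulNr expRN ler_pdivrMr ?expR_gt0 //.
apply: le_trans (_ : e * (1 + c * t) <= _); last by rewrite ler_wpM2l ?expR_ge1Dx // ltW.
rewrite mulrDr mulr1; lra.
Qed.

Definition level_value K phi (t : R) : R := expec t (fun x => phi (top K x)).

Lemma bounded_level K phi : bounded_obs (fun x => phi (top K x)).
Proof. by have [B bound] := finite_bound phi; exists B => x. Qed.

(** The exclusion generator is [2 n] times [step] minus the identity, and the walk deviates from it
    only while the gap [K] is 1, an event whose probability decays with the mean of the Lyapunov
    function. *)
Lemma level_value_step K phi : exists D c B : R, [/\ 0 < c, 0 <= D, 0 <= B &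
  forall t h, 0 <= t -> 0 <= h -> n%:R * h <= 1 ->
   `|level_value K phi (t + h) - ((1 - 2 * n%:R * h) * level_value K phi t
       + 2 * n%:R * h * level_value K (step phi) t)| <= h * (D * expR (- c * t)) + B * h ^+ 2].
Proof.
have [B bound] := finite_bound phi; have B0 : 0 <= B := le_trans (normr_ge0 _) (bound finset.set0).
have [F [c [M [m [c0 m0 FM LF Fg]]]]] := lyapunov n_gt1 q01.
have [C [C0 hC]] := genw_top_set n_gt1 q01 phi K.
have n0 := n_gt0R R n_gt1.
have F10 : 0 <= F (affine1 n) by case/andP: (FM (affine1 n)).
exists (C / m * F (affine1 n)), c, (n%:R ^+ 2 * (2 * B)); split => //.
- by rewrite mulr_ge0 // divr_ge0 // ltW.
- by rewrite mulr_ge0 ?sqr_ge0 // mulr_ge0.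
move=> t h t0 h0 nh; have th0 : 0 <= t + h by rewrite addr_ge0.
pose f x := phi (top K x); have bf : bounded_obs f := bounded_level K phi.
pose f' x := phi (top K x) + B.
have f'M x : 0 <= f' x <= 2 * B.
  by have := bound (top K x); rewrite /f' ler_norml => /andP[? ?]; apply/andP; split; lra.
have := expec_step n_gt1 q01 walk f'M t0 h0 nh.
have e1 s : 0 <= s -> expec s f' = level_value K phi s + B.
  move=> s0; rewrite (expecD n_gt1 walk s0 bf (bounded_obs_cst n B)) expec_cst //.
have e2 : genw f' = genw f.
  by apply/funext => x; rewrite /genw; apply: eq_bigr => r _; rewrite /f' /f; ring.
rewrite !e1 // e2.
pose g x := gen n_gt1 q phi (top K x); pose b (x : affperm n) := (0 < K < n)%N && (gap K x == 1).
have bg : bounded_obs g by exact: bounded_level K (gen n_gt1 q phi).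
have bb : bounded_obs (fun x => (b x)%:R : R).
  by exists 1 => x; rewrite ger0_norm // lern1 leq_b1.
have eg : g = (fun x => 2 * n%:R * step phi (top K x) + - (2 * n%:R) * f x).
  by apply/funext => x; rewrite /g /f /step; field; rewrite gt_eqF.
have Eg : expec t g = 2 * n%:R * (level_value K (step phi) t - level_value K phi t).
  rewrite eg (expecD n_gt1 walk) ?(expecZ n_gt1 walk) //; try exact: bounded_level.
  - by rewrite /level_value; ring.
  - by apply: bounded_obsZ; exact: bounded_level.
  - by apply: bounded_obsZ.
have dE x : `|genw f x - g x| <= C * (b x)%:R.
  have /= [h1 h2] := hC x; rewrite /b; case: (boolP (_ && _)) h2 => /= _ h2; first by rewrite mulr1.
  by rewrite h2 // normr0 mulr0.
have bd : bounded_obs (fun x => genw f x - g x).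
  by exists C => x; have /= [] := hC x.
have Fb : bounded_obs F by exists M => x; have /andP[? ?] := FM x; rewrite ger0_norm.
have Ed : `|expec t (fun x => genw f x - g x)| <= C / m * F (affine1 n) * expR (- c * t).
  have Eb : expec t (fun x => (b x)%:R) <= expR (- c * t) * F (affine1 n) / m.
    apply: le_trans (_ : expec t F / m <= _); last first.
      rewrite ler_pM2r ?invr_gt0 //; exact: (expec_lyapunov n_gt1 q01 walk FM LF).
    apply: (expec_ind_le n_gt1 walk) => // x; rewrite /b.
    case: (boolP (_ && _)) => [/andP[h1 /eqP h2]|_]; first by rewrite mulr1 (Fg K).
    by rewrite mulr0; case/andP: (FM x).
  have -> : C / m * F (affine1 n) * expR (- c * t) = C * (expR (- c * t) * F (affine1 n) / m) by ring.
  apply: le_trans (_ : C * expec t (fun x => (b x)%:R) <= _); last by rewrite ler_wpM2l.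
  have bC : bounded_obs (fun x => C * (b x)%:R) by exact: bounded_obsZ.
  have bNC : bounded_obs (fun x => - C * (b x)%:R) by exact: bounded_obsZ.
  rewrite ler_norml -mulNr -!(expecZ n_gt1 walk) //; apply/andP; split;
    apply: (expec_le n_gt1 walk) => // x; have := dE x; rewrite ler_norml => /andP[]; rewrite ?mulNr //.
have EG : expec t (genw f) = expec t g + expec t (fun x => genw f x - g x).
  rewrite -(expecD n_gt1 walk) //.
  by have {1}-> : genw f = (fun x => g x + (genw f x - g x)) by apply/funext => y; ring.
rewrite EG Eg; set dd := expec t (fun _ => _) in Ed *.
set E := C / m * _ * _ in Ed *; have hd : `|h * dd| <= h * E.
  by rewrite normrM (ger0_norm h0) ler_wpM2l.
move=> hs; apply: le_trans (_ : h * E + n%:R ^+ 2 * h ^+ 2 * (2 * B) <= _); last first.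
  by rewrite lerD2l le_eqVlt; apply/orP; left; apply/eqP; ring.
have := lerD hd hs; move/(le_trans (ler_normD _ _)); congr (`|_| <= _); ring.
Qed.

(** Up to vanishing errors the value of [phi] relaxes at rate [2 n] towards that of [step phi], so
    an asymptotic bound for the latter passes to the former. *)
Lemma level_descent K phi (mu eta : R) : 0 <= eta ->
  (forall e, 0 < e -> exists2 A, 0 <= A &
     forall t, A <= t -> `|level_value K (step phi) t - mu| <= eta + e) ->
  forall e, 0 < e -> exists2 A, 0 <= A &
     forall t, A <= t -> `|level_value K phi t - mu| <= eta + e.
Proof.
move=> eta0 hstep e e0; have [D [c [B [c0 D0 B0 hS]]]] := level_value_step K phi.
have n0 := n_gt0R R n_gt1.
have e4 : 0 < e / 4 by rewrite divr_gt0.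
have ne : 0 < 2 * n%:R * (e / 4) by rewrite !mulr_gt0.
have [A1 A10 hA1] := hstep _ e4.
have [A2 A20 hA2] := exp_small c0 D0 ne.
pose t0 := Num.max A1 A2.
have t00 : 0 <= t0 by rewrite le_max A10.
pose a t := `|level_value K phi t - mu| - (eta + e / 2).
pose A := Num.max (a t0) 0.
have AA : 0 <= A by rewrite le_max lexx orbT.
have c20 : 0 < 2 * n%:R :> R by rewrite mulr_gt0.
have e2 : 0 < e / 2 by rewrite divr_gt0.
have [A3 A30 hA3] := exp_small c20 AA e2.
have key : forall s, 0 <= s -> a (t0 + s) <= expR (- (2 * n%:R) * s) * A.
  apply: (@gronwall R a _ A B (2 * n%:R)^-1 t0) => //.
  - by rewrite invr_gt0.
  - by rewrite le_max lexx.
  move=> t h tt /andP[h0 hn].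
  have nh : 2 * n%:R * h <= 1 by rewrite mulrC -ler_pdivlMr // div1r.
  have nh' : n%:R * h <= 1 by apply: le_trans nh; rewrite -mulrA ler_peMl ?mulr_ge0 // ?ltW // ltr1n.
  have tpos : 0 <= t by exact: le_trans tt.
  have := hS t h tpos h0 nh'.
  have tA1 : A1 <= t by apply: le_trans tt; rewrite le_max lexx.
  have tA2 : A2 <= t by apply: le_trans tt; rewrite le_max lexx orbT.
  have := hA2 _ tA2; have := hA1 _ tA1; rewrite /a.
  set X := D * _; set u := level_value K phi (t + h); set v := level_value K phi t.
  set z := level_value _ _ _; move=> hz hX hu.
  have h1 : `|u - mu| <= `|u - ((1 - 2 * n%:R * h) * v + 2 * n%:R * h * z)|
     + (1 - 2 * n%:R * h) * `|v - mu| + 2 * n%:R * h * `|z - mu|.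
    have p1 : 0 <= 1 - 2 * n%:R * h by rewrite subr_ge0.
    have p2 : 0 <= 2 * n%:R * h by rewrite mulr_ge0 // ltW.
    have -> : u - mu = (u - ((1 - 2 * n%:R * h) * v + 2 * n%:R * h * z))
      + (1 - 2 * n%:R * h) * (v - mu) + 2 * n%:R * h * (z - mu) by ring.
    apply: le_trans (ler_normD _ _) _; apply: lerD; last by rewrite normrM (ger0_norm p2).
    by apply: le_trans (ler_normD _ _) _; rewrite lerD2l normrM (ger0_norm p1).
  have h2 : 2 * n%:R * h * `|z - mu| <= 2 * n%:R * h * (eta + e / 4).
    by rewrite ler_wpM2l // mulr_ge0 // ltW.
  have h3 : h * X <= h * (2 * n%:R * (e / 4)) by rewrite ler_wpM2l.
  have e1 : (1 + - (2 * n%:R) * h) * (`|v - mu| - (eta + e / 2)) + B * h ^+ 2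
     = (1 - 2 * n%:R * h) * `|v - mu| + 2 * n%:R * h * (eta + e / 4)
       + h * (2 * n%:R * (e / 4)) + B * h ^+ 2 - (eta + e / 2) by field.
  rewrite e1; lra.
exists (t0 + A3); first by rewrite addr_ge0.
move=> t tA; have s0 : A3 <= t - t0 by lra.
have := key (t - t0) (le_trans A30 s0); have -> : t0 + (t - t0) = t by ring.
have := hA3 _ s0; rewrite mulrC /a; lra.
Qed.

(** Starts from [iter m step phi], which is uniformly close to its level mean, and removes the steps
    one at a time by [level_descent]; so discrete mixing suffices, and the walk is not restarted at
    a random time. *)
Lemma level_law phi K : (K <= n)%N ->
  level_value K phi t @[t --> +oo] --> level_mean phi K.
Proof.
move=> Kn; apply/cvgrPdist_le => e e0.
have e2 : 0 < e / 2 by rewrite divr_gt0.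
have [m hm] := mixing n_gt1 q01' phi e2.
have start t : 0 <= t -> `|level_value K (iter m step phi) t - level_mean phi K| <= e / 2.
  move=> t0; have bI := bounded_level K (iter m step phi).
  have -> : level_value K (iter m step phi) t - level_mean phi K
    = expec t (fun x => iter m step phi (top K x) + - level_mean phi K).
    by rewrite (expecD n_gt1 walk) ?expec_cst //; exact: bounded_obs_cst.
  apply: (expec_norm n_gt1 walk) => // x.
  by have := hm (top K x); rewrite card_top_set.
have descend k psi : (forall t, 0 <= t -> `|level_value K (iter k step psi) t - level_mean phi K| <= e / 2) ->
  forall e', 0 < e' -> exists2 A, 0 <= A &
     forall t, A <= t -> `|level_value K psi t - level_mean phi K| <= e / 2 + e'.
  elim: k psi => [|k IH] psi h.
    by move=> e' e'0; exists 0 => // t t0; apply: le_trans (h t t0) _; rewrite lerDl ltW.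
  apply: level_descent; first exact: ltW.
  by apply: IH => t t0; rewrite -iterSr; exact: h.
have [A A0 hA] := descend m phi start _ e2.
near=> t; rewrite distrC.
have At : A <= t by near: t; apply: nbhs_pinfty_ge; exact: num_real.
apply: le_trans (hA t At) _; lra.
Unshelve. all: by end_near.
Qed.

End LevelLaw.

(** * Integrals against the periodic law *)

Section PeriodicLaw.
Variables (R : realType) (n : nat) (n_gt1 : (1 < n)%N) (N : nat).
Variable f : {ffun 'I_N -> bool} -> R.

Lemma periodic_configE (S : {set 'I_n}) x : periodic_config S x = (residue n_gt1 x \in S).
Proof.
apply/existsP/idP => [[b /andP[bS]]|xS]; first by rewrite -(residue_eq n_gt1) => /eqP ->.
by exists (residue n_gt1 x); rewrite xS residueE.
Qed.

Definition pattern x (S : {set 'I_n}) : R := f (window N (periodic_config S) x).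

Lemma pattern_residue x : pattern x = pattern (residue n_gt1 x)%:Z.
Proof.
apply/funext => S; rewrite /pattern; congr f; apply/ffunP => j; rewrite !ffunE !periodic_configE.
suff -> : residue n_gt1 (x + j%:Z) = residue n_gt1 ((residue n_gt1 x)%:Z + j%:Z) by [].
by apply/eqP; rewrite residue_mod eqmod_add2r residueE.
Qed.

(** The uniform law on a level is invariant under rotations. This matters because the residue of
    [x t] modulo [n] may keep varying with [t]. *)
Lemma level_mean_pattern x K : level_mean (pattern x) K = level_mean (pattern 0) K.
Proof.
pose h (s : 'I_n) := residue n_gt1 (s%:Z + x).
have h_inj : injective h.
  move=> a b /eqP; rewrite residue_mod eqmod_add2r -(residue_mod n_gt1) !residue_ord.
  by move/eqP.
pose p := perm h_inj.
pose rot (S : {set 'I_n}) : {set 'I_n} := p @^-1: S.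
have rot_inj : injective rot.
  move=> S S' /setP e; apply/setP => s.
  by have := e ((p^-1)%g s); rewrite !inE permKV.
have card_rot S : #|rot S| = #|S| by rewrite card_preimset //; exact: perm_inj.
rewrite /level_mean [in RHS](reindex_inj rot_inj) /=; congr (_ / _).
apply: eq_big => [S|S _]; first by rewrite card_rot.
rewrite /pattern; congr f; apply/ffunP => j; rewrite !ffunE !periodic_configE inE permE /h add0r.
suff -> : residue n_gt1 (x + j%:Z) = residue n_gt1 ((residue n_gt1 j%:Z)%:Z + x) by [].
by apply/eqP; rewrite residue_mod addrC eqmod_add2r residueE.
Qed.

Lemma window_measurable : measurable_fun [set: config] (fun eta : config => f (window N eta 0)).
Proof.
have c_inj : injective (@pickle {ffun 'I_N -> bool}) := pcan_inj (@pickleK _).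
apply: (@discrete_fun_measurable R _ config _ _ (fun eta => window N eta 0) c_inj _ f) => v.
have -> : [set eta : config | window N eta 0 = v]
   = \bigcap_(j in [set: 'I_N]) [set eta : config | eta (0 + j%:Z) = v j].
  apply/seteqP; split=> eta /= h; first by move=> j _ /=; rewrite -h ffunE.
  by apply/ffunP => j; rewrite ffunE; apply: h.
apply: fin_bigcap_measurable => // j _; apply: sub_sigma_algebra.
by exists (0 + j%:Z), (v j).
Qed.

Lemma ge0_integral_periodic_law K (g : config -> R) : measurable_fun [set: config] g ->
  (forall eta, 0 <= g eta) ->
  (\int[periodic_law R n K]_eta (g eta)%:E)%E
  = (level_mean (fun S : {set 'I_n} => g (periodic_config S)) K)%:E.
Proof.
move=> mg g0; have mG : measurable_fun [set: config] (fun eta => (g eta)%:E : \bar R).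
  exact/measurable_EFinP.
rewrite ge0_integral_mscale //; last by move=> eta _; rewrite lee_fin.
rewrite ge0_integral_measure_sum //; last by move=> eta _; rewrite lee_fin.
have sz : 'C(n, K) = size (enum [set B : {set 'I_n} | #|B| == K]%SET).
  by rewrite -cardE -card_level; apply: eq_card => S; rewrite !inE.
under eq_bigr do rewrite integral_dirac // diracE in_setT mul1e.
rewrite sumEFin -EFinM /level_mean mulrC; congr ((_ * _)%:E).
rewrite -(big_mkord xpredT (fun i => g (periodic_config
   (nth finset.set0 (enum [set B : {set 'I_n} | #|B| == K]%SET) i)))).
rewrite sz -(big_nth finset.set0 xpredT (fun S => g (periodic_config S))) big_enum /=.
by apply: eq_bigl => S; rewrite inE.
Qed.

Lemma integral_pattern K :
  (\int[periodic_law R n K]_eta (f (window N eta 0))%:E)%E = (level_mean (pattern 0) K)%:E.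
Proof.
have mf := window_measurable.
rewrite integralE.
have ep : ((fun eta : config => (f (window N eta 0))%:E)^\+
   = fun eta => (Num.max (f (window N eta 0)) 0)%:E)%E.
  by apply/funext => eta; rewrite funeposE -EFin_max.
have en : ((fun eta : config => (f (window N eta 0))%:E)^\-
   = fun eta => (Num.max (- f (window N eta 0)) 0)%:E)%E.
  by apply/funext => eta; rewrite funenegE -EFinN -EFin_max.
rewrite ep en !ge0_integral_periodic_law //.
- rewrite -EFinB /level_mean -mulrBl -sumrB; congr ((_ / _)%:E); apply: eq_bigr => S _.
  rewrite /pattern; set y := f _; case: (lerP y 0) => y0; case: (lerP (- y) 0) => y1; lra.
- by apply: measurable_maxr => //; exact: measurableT_comp.
- by move=> eta; rewrite le_max lexx orbT.
- by apply: measurable_maxr.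
- by move=> eta; rewrite le_max lexx orbT.
Qed.

End PeriodicLaw.

(** * Convergence in law of the window *)

Section LocalEquilibrium.
Variables (R : realType) (n : nat) (n_gt1 : (1 < n)%N) (q : R).
Hypothesis q01 : 0 <= q < 1.
Variables (d : measure_display) (T : measurableType d) (P : probability T R).
Variable w : R -> T -> affperm n.
Hypothesis walk : affine_hecke_walk q P w.
Variables (x : R -> int) (u : R).
Hypothesis xu : (x t)%:~R / t @[t --> +oo] --> u.
Hypothesis generic : forall k, (1 <= k <= n)%N -> u != speed n q k.

Local Notation expec := (expec P w).
Local Notation K := (faster n q u).
Local Notation pat f := (@pattern R n _ f).

(** Each site of the window lies in the residue class of one leader and is occupied when it is
    behind that leader; a leader ahead of the whole window fills its class there, and one behind the
    window leaves it empty. *)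
Lemma window_separated N (y : int) (v : affperm n) L :
  (forall k : 'I_n, (k < L)%N -> y + N%:Z <= pos v (leader n_gt1 v k)) ->
  (forall k : 'I_n, (L <= k)%N -> pos v (leader n_gt1 v k) <= y) ->
  window N (one_species v) y = window N (periodic_config (top_set n_gt1 L v)) y.
Proof.
move=> hi lo; apply/ffunP => j; rewrite !ffunE (periodic_configE n_gt1).
have [i [k [yi _]]] := pos_exists n_gt1 v (y + j%:Z).
have e : (y + j%:Z == pos v i %[mod n%:Z])%Z by apply/eqzmodP; exists k.
rewrite (one_speciesE n_gt1 e).
have -> : residue n_gt1 (y + j%:Z) = residue n_gt1 (pos v i).
  by apply/eqP; rewrite residue_mod.
rewrite mem_top_set inE; have jN := ltn_ord j.
rewrite -(leader_rank n_gt1 v i) rank_leader; case: ltnP => h.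
  by have := hi _ h; lia.
by have := lo _ h; lia.
Qed.

Lemma speed_gap : exists2 del : R, 0 < del & forall k : 'I_n, del <= `|speed n q k.+1 - u|.
Proof.
exists (\big[Num.min/1]_(k < n) `|speed n q k.+1 - u|); last by move=> k; exact: bigmin_le.
apply: lt_bigmin => // k _; rewrite normr_gt0 subr_eq0 eq_sym; apply: generic.
by rewrite /= ltn_ord.
Qed.

Definition deviates (e t : R) (v : affperm n) : bool :=
  [exists k : 'I_n.+1, e * t < `|(top_sum k v)%:~R - current n q k * t|].

Lemma deviates_small (e : R) : 0 < e ->
  expec t (fun v => (deviates e t v)%:R) @[t --> +oo] --> 0.
Proof.
move=> e0; pose b (k : 'I_n.+1) t (v : affperm n) : R :=
  (e * t < `|(top_sum k v)%:~R - current n q k * t|)%R%:R.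
have bb k t : bounded_obs (b k t).
  by exists 1 => v; rewrite ger0_norm // lern1 leq_b1.
have bd t : bounded_obs (fun v => (deviates e t v)%:R : R).
  by exists 1 => v; rewrite ger0_norm // lern1 leq_b1.
have small (eta : R) : 0 < eta -> \forall t \near +oo, forall k : 'I_n.+1, expec t (b k t) <= eta.
  move=> eta0; apply: filter_forall => k.
  have [C [c [C0 c0 h]]] := level_tail n_gt1 q01 walk (leq_ord k) e0.
  have [A A0 hA] := exp_small c0 C0 eta0.
  near=> t; have At : A <= t by near: t; apply: nbhs_pinfty_ge; exact: num_real.
  by apply: le_trans (h t (le_trans A0 At)) (hA t At).
apply/cvgrPdist_le => eta eta0; have n10 : 0 < n.+1%:R :> R by rewrite ltr0n.
have eta1 : 0 < eta / n.+1%:R by rewrite divr_gt0.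
near=> t; have t0 : 0 <= t by near: t; apply: nbhs_pinfty_ge; exact: num_real.
have hb : forall k : 'I_n.+1, expec t (b k t) <= eta / n.+1%:R by near: t; exact: small.
have ge0 : 0 <= expec t (fun v => (deviates e t v)%:R).
  by rewrite -(expec_cst P w t 0); apply: (expec_le n_gt1 walk) => //; exact: bounded_obs_cst.
rewrite sub0r normrN ger0_norm //.
have sumE (s : seq 'I_n.+1) : bounded_obs (fun v => \sum_(k <- s) b k t v) /\
    expec t (fun v => \sum_(k <- s) b k t v) = \sum_(k <- s) expec t (b k t).
  elim: s => [|k s [IH1 IH2]].
    rewrite big_nil -[RHS](expec_cst P w t); split.
      by exists 0 => v; rewrite big_nil normr0.
    by have -> : (fun v => \sum_(k <- [::]) b k t v) = (fun=> 0) by apply/funext => v; rewrite big_nil.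
  have -> : (fun v => \sum_(k0 <- k :: s) b k0 t v) = (fun v => b k t v + \sum_(k0 <- s) b k0 t v).
    by apply/funext => v; rewrite big_cons.
  by rewrite big_cons -IH2; split; [exact: bounded_obsD|exact: (expecD n_gt1 walk)].
have [bs es] := sumE (index_enum _).
apply: le_trans (_ : \sum_(k < n.+1) expec t (b k t) <= _); last first.
  apply: le_trans (_ : \sum_(k < n.+1) eta / n.+1%:R <= _); first by apply: ler_sum => k _.
  by rewrite sumr_const card_ord -[X in X <= _]mulr_natr divfK // gt_eqF.
rewrite -es; apply: (expec_le n_gt1 walk) => // v; rewrite /deviates.
case: existsP => [[k hk]|_]; last by apply: sumr_ge0.
rewrite (bigD1 k) //= {1}/b hk lerDl; exact: sumr_ge0.
Unshelve. all: by end_near.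
Qed.

Lemma separated_near : exists2 e : R, 0 < e & forall N, \forall t \near +oo, forall v : affperm n,
  ~~ deviates e t v ->
  window N (one_species v) (x t) = window N (periodic_config (top_set n_gt1 K v)) (x t).
Proof.
have [del d0 gap] := speed_gap; have d8 : 0 < del / 8 by rewrite divr_gt0.
(* Leader positions are differences of two level sums, hence known up to [del / 4 * t]; with as much
   again for [x t] and for the width [N], the total stays below [del * t]. *)
exists (del / 8) => // N.
have d4 : 0 < del / 4 by rewrite divr_gt0.
near=> t; have t0 : 0 < t by near: t; exact: nbhs_pinfty_gt.
have Nt : N%:R <= del / 4 * t.
  rewrite mulrC -ler_pdivrMr //; near: t; apply: nbhs_pinfty_ge; exact: num_real.
have xt : `|(x t)%:~R - u * t| <= del / 4 * t.
  have : `|u - (x t)%:~R / t| <= del / 4 by near: t; move/cvgrPdist_le : xu; exact.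
  rewrite distrC; have -> : (x t)%:~R / t - u = ((x t)%:~R - u * t) / t by field; rewrite gt_eqF.
  by rewrite normrM normfV (gtr0_norm t0) ler_pdivrMr.
move=> v /existsPn dev.
have lead (k : 'I_n) : `|(pos v (leader n_gt1 v k))%:~R - speed n q k.+1 * t| <= del / 4 * t.
  have h1 := dev (inord k.+1); have h2 := dev (inord k).
  rewrite !inordK ?ltnS ?(ltnW (ltn_ord k)) // -!leNgt in h1 h2.
  have -> : (pos v (leader n_gt1 v k))%:~R = (top_sum k.+1 v)%:~R - (top_sum k v)%:~R :> R.
    by rewrite top_sumS intrD addrAC subrr add0r.
  rewrite speed_current // mulrBl.
  have e1 : del / 4 * t = 2 * (del / 8 * t) by field.
  rewrite e1; move: h1 h2; rewrite !ler_norml => /andP[? ?] /andP[? ?]; apply/andP; split; lra.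
have dt : 0 < del * t by rewrite mulr_gt0.
have e4 : del / 4 * t = (del * t) / 4 by field.
rewrite e4 in Nt xt lead.
apply: window_separated => k; [rewrite (faster_lt n_gt1 q01)|rewrite leqNgt (faster_lt n_gt1 q01) -leNgt] => uk.
  have : (u + del) * t <= speed n q k.+1 * t.
    by rewrite ler_pM2r //; have := gap k; rewrite gtr0_norm ?subr_gt0 //; lra.
  rewrite mulrDl => h; have := lead k; move: xt; rewrite !ler_norml => /andP[? ?] /andP[? ?].
  rewrite -(ler_int R) intrD /=; rewrite -[(N%:Z)%:~R]/(N%:R : R); lra.
have : speed n q k.+1 * t <= (u - del) * t.
  by rewrite ler_pM2r //; have := gap k; rewrite ler0_norm ?subr_le0 //; lra.
rewrite mulrBl => h; have := lead k; move: xt; rewrite !ler_norml => /andP[? ?] /andP[? ?].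
rewrite -(ler_int R); lra.
Unshelve. all: by end_near.
Qed.

Lemma window_law N (f : {ffun 'I_N -> bool} -> R) :
  expec t (fun v => f (window N (one_species v) (x t))) @[t --> +oo]
    --> level_mean (pat f 0) K.
Proof.
have [B bound] := finite_bound f.
have B0 : 0 <= B := le_trans (normr_ge0 _) (bound [ffun=> false]).
have [e e0 sep] := separated_near.
have Kn : (K <= n)%N := faster_le n q u.
apply/cvgrPdist_le => eta eta0.
have eta4 : 0 < eta / 2 by rewrite divr_gt0.
have eta1 : 0 < eta / 2 / (2 * B + 1) by rewrite divr_gt0 //; lra.
(* The pattern seen from [x t] depends on the moving residue of [x t], so the limit is taken for all
   [n] residues at once. *)
have law : \forall t \near +oo, forall r : 'I_n,
   `|level_mean (pat f r%:Z) K - level_value n_gt1 P w K (pat f r%:Z) t| <= eta / 2.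
  apply: filter_forall => r.
  by move/cvgrPdist_le: (level_law n_gt1 q01 walk (phi := pat f r%:Z) Kn); exact.
near=> t; have t0 : 0 <= t by near: t; apply: nbhs_pinfty_ge; exact: num_real.
pose r := residue n_gt1 (x t); pose p := pat f r%:Z.
have h1 : `|level_mean p K - level_value n_gt1 P w K p t| <= eta / 2.
  move: r @p; near: t; apply: filterS law => t h r p; exact: h.
rewrite (level_mean_pattern n_gt1) in h1.
have h2 : expec t (fun v => (deviates e t v)%:R) <= eta / 2 / (2 * B + 1).
  have : `|0 - expec t (fun v => (deviates e t v)%:R)| <= eta / 2 / (2 * B + 1).
    by near: t; move/cvgrPdist_le: (deviates_small e0); exact.
  by rewrite sub0r normrN; apply: le_trans; exact: ler_norm.
have sept : forall v, ~~ deviates e t v ->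
  window N (one_species v) (x t) = window N (periodic_config (top_set n_gt1 K v)) (x t).
  by near: t; exact: sep.
pose g (v : affperm n) := f (window N (one_species v) (x t)); pose g' v := p (top_set n_gt1 K v).
have bg : bounded_obs g by exists B => v; exact: bound.
have bg' : bounded_obs g' by exists B => v; exact: bound.
have bd : bounded_obs (fun v => (deviates e t v)%:R : R).
  by exists 1 => v; rewrite ger0_norm // lern1 leq_b1.
have close v : `|g v - g' v| <= 2 * B * (deviates e t v)%:R.
  have -> : g' v = f (window N (periodic_config (top_set n_gt1 K v)) (x t)).
    by rewrite /g' /p /r -(pattern_residue n_gt1).
  case: (boolP (deviates e t v)) => [_|/sept e1]; last by rewrite /g e1 subrr normr0 mulr0.
  rewrite mulr1; apply: le_trans (ler_normB _ _) _.
  by have := bound (window N (one_species v) (x t));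
     have := bound (window N (periodic_config (top_set n_gt1 K v)) (x t)); rewrite /g; lra.
have h3 : `|expec t g - expec t g'| <= 2 * B * expec t (fun v => (deviates e t v)%:R).
  have bD := bounded_obsZ (2 * B) bd.
  have cmp (g1 g2 : affperm n -> R) : bounded_obs g1 -> bounded_obs g2 ->
      (forall v, `|g1 v - g2 v| <= 2 * B * (deviates e t v)%:R) ->
      expec t g1 <= expec t g2 + 2 * B * expec t (fun v => (deviates e t v)%:R).
    move=> b1 b2 h; rewrite -(expecZ n_gt1 walk) // -(expecD n_gt1 walk) //.
    apply: (expec_le n_gt1 walk) => //; first exact: bounded_obsD.
    by move=> v; have := h v; rewrite ler_norml => /andP[? ?]; lra.
  have h1' := cmp g g' bg bg' close.
  have h2' : expec t g' <= expec t g + 2 * B * expec t (fun v => (deviates e t v)%:R).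
    by apply: cmp => // v; rewrite distrC.
  by rewrite ler_norml; apply/andP; split; lra.
have h4 : 2 * B * expec t (fun v => (deviates e t v)%:R) <= eta / 2.
  apply: le_trans (_ : (2 * B + 1) * (eta / 2 / (2 * B + 1)) <= _); last first.
    by rewrite mulrC divfK // gt_eqF //; lra.
  have p0 : 0 <= expec t (fun v => (deviates e t v)%:R).
    by rewrite -(expec_cst P w t 0); apply: (expec_le n_gt1 walk) => //; exact: bounded_obs_cst.
  by apply: ler_pM => //; lra.
have -> : level_mean (pat f 0) K - expec t g
  = level_mean (pat f 0) K - level_value n_gt1 P w K p t - (expec t g - expec t g').
  by rewrite /level_value -/g'; ring.
apply: le_trans (ler_normB _ _) _; have := le_trans h3 h4; lra.
Unshelve. all: by end_near.
Qed.

Lemma local_equilibrium : exists L : nat,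
  unique (fun L => (L <= n)%N /\ density n q u = L%:R / n%:R) L /\
  forall (N : nat) (f : {ffun 'I_N -> bool} -> R), (1 <= N)%N ->
    ('E_P[fun om => f (window N (one_species (w t om)) (x t))])%E @[t --> +oo]
    --> (\int[periodic_law R n L]_eta (f (window N eta 0))%:E)%E.
Proof.
have n0 := n_gt0R R n_gt1.
exists K; split.
  rewrite (densityE generic) //; split; first by rewrite faster_le.
  by move=> L [_ /(mulIf (invr_neq0 (lt0r_neq0 n0))) /eqP]; rewrite eqr_nat => /eqP.
move=> N f _; rewrite integral_pattern.
have bounded t : bounded_obs (fun v : affperm n => f (window N (one_species v) (x t))).
  by have [B hB] := finite_bound f; exists B => v; exact: hB.
have E t : 0 <= t -> ('E_P[fun om => f (window N (one_species (w t om)) (x t))])%E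
    = (expec t (fun v => f (window N (one_species v) (x t))))%:E.
  by move=> t0; rewrite unlock; apply: (expecE n_gt1 walk t0 (bounded t)).
have pos_t : \forall t \near +oo, 0 <= t :> R by apply: nbhs_pinfty_ge; exact: num_real.
apply/fine_cvgP; split; first by apply: filterS pos_t => t /E ->.
apply: cvg_trans (window_law (f := f)); apply: near_eq_cvg.
by apply: filterS pos_t => t /E /= ->.
Qed.

End LocalEquilibrium.

(** * Measurable choice of the limiting order *)

Section LimitOrder.
Variables (R : realType) (n : nat) (n_gt1 : (1 < n)%N) (q : R).
Hypothesis q01 : 0 <= q < 1.
Variables (d : measure_display) (T : measurableType d) (P : probability T R).
Variable w : R -> T -> affperm n.
Hypothesis walk : affine_hecke_walk q P w.

(** Integer times suffice to identify the order, and they make the event a countable union of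
    countable intersections. *)
Definition settles s om : Prop :=
  exists M : nat, forall m : nat, (M <= m)%N -> order_perm n_gt1 (w m%:R om) = s.

(** The identity stands in where no order settles, an event of probability zero. *)
Definition limit_order om : 'S_n := xget 1%g [set s | settles s om].

Lemma settles_limit s om : settles s om -> limit_order om = s.
Proof.
move=> [M hM]; apply: xget_unique; first by exists M.
move=> s' [M' hM']; rewrite -(hM (maxn M M')) ?leq_maxl //; apply/esym/hM'.
exact: leq_maxr.
Qed.

Lemma settles_measurable s : measurable [set om | settles s om].
Proof.
have -> : [set om | settles s om]
   = \bigcup_M \bigcap_(m in [set m | (M <= m)%N]) [set om | order_perm n_gt1 (w m%:R om) = s].
  by apply/seteqP; split=> om; [move=> [M h]|move=> [M _ h]]; exists M.
apply: bigcup_measurable => M _; apply: bigcap_measurable => [|m _].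
  by exists M; rewrite /= leqnn.
exact: (walk_measurable n_gt1 walk (fun x => order_perm n_gt1 x = s)).
Qed.

Lemma limit_order_measurable s : measurable [set om | limit_order om = s].
Proof.
have -> : [set om | limit_order om = s] = [set om | settles s om]
  `|` ((if s == 1%g then setT else set0) `&` ~` \bigcup_(s' in setT) [set om | settles s' om]).
  apply/seteqP; split=> om /=; last first.
    move=> [/settles_limit //|[]]; case: eqP => // -> _ h.
    by rewrite /limit_order xgetPN // => s' hs; apply: h; exists s'.
  have [[s' hs']|none] := pselect (exists s', settles s' om).
    by rewrite (settles_limit hs') => <-; left.
  rewrite /limit_order xgetPN; last by move=> s' hs; apply: none; exists s'.
  by move=> <-; right; rewrite eqxx; split=> // -[s' _ hs]; apply: none; exists s'.
apply: measurableU; first exact: settles_measurable.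
apply: measurableI; first by case: ifP.
apply: measurableC; apply: fin_bigcup_measurable => [|s' _]; first exact: finite_finset; exact: settles_measurable.
Qed.

Lemma leaders_law : {ae P, forall om,
  (\forall t \near +oo, forall j k : 'I_n, (j < k)%N ->
     position (w t om) (limit_order om k).+1%:Z < position (w t om) (limit_order om j).+1%:Z) /\
  (forall k : 'I_n,
     (position (w t om) (limit_order om k).+1%:Z)%:~R / t @[t --> +oo]
       --> speed n q k.+1)}.
Proof.
apply: filterS (walk_tame n_gt1 q01 walk) => om tx.
have [A [s [_ hs]]] := tame_order n_gt1 tx.
have es : limit_order om = s.
  by apply: settles_limit; exists A => m Am; apply: hs; rewrite ler_nat.
have ev : \forall t \near +oo, order_perm n_gt1 (w t om) = s.
  near=> t; apply: hs; near: t; apply: nbhs_pinfty_ge; exact: num_real.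
rewrite es; split; last by move=> k; exact: (pos_leader_cvg tx ev).
apply: filterS ev => t <- j k jk; exact: leader_lt.
Unshelve. all: by end_near.
Qed.

End LimitOrder.

Theorem theorem3p7 (R : realType) (n : nat) (q : R)
    (d : measure_display) (T : measurableType d) (P : probability T R)
    (w : R -> T -> affperm n) :
  (1 < n)%N -> 0 <= q < 1 -> affine_hecke_walk q P w ->
  (* The ordinal i : 'I_n stands for the element i + 1 of [n]. *)
  (exists a : T -> 'S_n,
     (forall s : 'S_n, measurable [set om | a om = s]) /\
     {ae P, forall om,
       (\forall t \near +oo, forall j k : 'I_n, (j < k)%N ->
          position (w t om) (a om k).+1%:Z < position (w t om) (a om j).+1%:Z) /\
       (forall k : 'I_n,
          (position (w t om) (a om k).+1%:Z)%:~R / t @[t --> +oo]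
            --> speed n q k.+1)}) /\
  ({ae P, forall om,
      ereal_sup [set `|particle_count R (w t om) (Num.floor (u * t)) / t
                       - limit_shape n q u|%:E | u in [set: R]]
        @[t --> +oo] --> 0%E} /\
   (forall u : R, (forall k, (1 <= k <= n)%N -> u != speed n q k) ->
      derivable (limit_shape n q) u 1) /\
   (forall u : R, u < speed n q n -> density n q u = 1) /\
   (forall (K : nat) (u : R), (1 <= K <= n.-1)%N ->
      speed n q K.+1 < u < speed n q K -> density n q u = K%:R / n%:R) /\
   (forall u : R, speed n q 1 < u -> density n q u = 0)) /\
  (forall (x : R -> int) (u : R),
     (x t)%:~R / t @[t --> +oo] --> u ->
     (forall k, (1 <= k <= n)%N -> u != speed n q k) ->
     exists K : nat,
       unique (fun K => (K <= n)%N /\ density n q u = K%:R / n%:R) K /\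
       forall (N : nat) (f : {ffun 'I_N -> bool} -> R), (1 <= N)%N ->
         ('E_P[fun om => f (window N (one_species (w t om)) (x t))])%E
           @[t --> +oo]
         --> (\int[periodic_law R n K]_eta (f (window N eta 0))%:E)%E).
Proof.
move=> n_gt1 q01 walk; split; first by exists (limit_order n_gt1 w); split;
  [exact: (limit_order_measurable n_gt1 walk)|exact: (leaders_law n_gt1 q01 walk)].
split; last by move=> x u; exact: (local_equilibrium n_gt1 q01 walk).
split; last exact: shape_facts.
by apply: filterS (walk_tame n_gt1 q01 walk) => om; exact: integrated_shape.
Qed.
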